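(* Assume the multi-scale setup below and in addition $\rho_{\min}^\alpha\ge K_\alpha$. Then there exists a constant $C$ depending only on $d,\alpha,K_\alpha,K_0$ such that for all $n\ge 1$, $$I_d\, e^{-n\epsilon}\prod_{k=0}^{n}\lambda_{\min}\big(D(U_k)\big)\;\le\; D(V_0^n)\;\le\; I_d\, e^{n\epsilon}\prod_{k=0}^{n}\lambda_{\max}\big(D(U_k)\big),\qquad \epsilon=C\rho_{\min}^{-\alpha/2}.$$ In particular $\epsilon\to0$ as $\rho_{\min}\to\infty$.
   Context: For $R>0$ let $\mathbb{T}^d_R=\mathbb{R}^d/(R\mathbb{Z})^d$, $\mathbb{T}^d=\mathbb{T}^d_1$; functions on $\mathbb{T}^d_R$ are identified with $R\mathbb{Z}^d$-periodic functions on $\mathbb{R}^d$. For $U\in L^\infty(\mathbb{T}^d_R)$ let $m_U(dx)=e^{-2U(x)}dx/\int_{\mathbb{T}^d_R}e^{-2U(z)}dz$ on $\mathbb{T}^d_R$, and let the effective diffusivity $D(U)$ be the symmetric positive definite $d\times d$ matrix defined by ${}^tl D(U) l=\inf_{f\in C^\infty(\mathbb{T}^d_R)}\int_{\mathbb{T}^d_R}|l-\nabla f(x)|^2 m_U(dx)$ for $l\in\mathbb{R}^d$. $\operatorname{Osc}(U)=\sup U-\inf U$. $\lambda_{\min}(A),\lambda_{\max}(A)$ denote smallest/largest eigenvalues of a symmetric matrix $A$; matrix inequalities are in the sense of quadratic forms; $I_d$ is the identity. For $0<\alpha\le1$, $C^\alpha(\mathbb{T}^d)$ is the space of $\alpha$-Hölder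 continuous $\mathbb{Z}^d$-periodic functions and $\|T\|_\alpha=\sup_{x\neq y}|T(x)-T(y)|/|x-y|^\alpha$. Multi-scale setup: $U_k\in C^\alpha(\mathbb{T}^d)$ ($k\in\mathbb{N}$) with $U_k(0)=0$, $K_\alpha:=\sup_k\|U_k\|_\alpha<\infty$, $K_0:=\sup_k\operatorname{Osc}(U_k)$. $R_0=1$, $R_k=r_1r_2\cdots r_k$ with integers $r_k\ge2$; $\rho_{\min}=\inf_{k\ge1}r_k$, $\rho_{\max}=\sup_{k\ge1}r_k$. For $0\le p\le n$, $V_p^n(x)=\sum_{k=p}^nU_k(x/R_k)$; $V_0^n$ is $R_n\mathbb{Z}^d$-periodic and $D(V_0^n)$ is its effective diffusivity on $\mathbb{T}^d_{R_n}$. *)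

(* Defs.v *)
From HB Require Import structures.
From mathcomp Require Import all_boot all_order all_algebra.
From mathcomp Require Import all_classical all_reals all_analysis.
Set Implicit Arguments.
Unset Strict Implicit.
Unset Printing Implicit Defensive.
Import Order.TTheory GRing.Theory Num.Theory.
Import numFieldNormedType.Exports.
Local Open Scope classical_set_scope.
Local Open Scope ring_scope.

Section Defs.
Variables (R : realType) (d : nat).
Notation pt := 'rV[R]_d.

Definition ms_enorm (x : pt) : R := Num.sqrt (\sum_(i < d) x ord0 i ^+ 2).

Definition ms_ebasis (k : 'I_d) : pt := \row_(j < d) (if j == k then 1 else 0).

Definition ms_periodic (L : R) (f : pt -> R) : Prop :=
  forall (x : pt) (k : 'I_d), f (x + L *: ms_ebasis k) = f x.

Fixpoint ms_iter_partial (f : pt -> R) (s : seq 'I_d) : pt -> R :=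
  match s with
  | [::] => f
  | k :: s' => fun x => derive (ms_iter_partial f s') x (ms_ebasis k)
  end.

Definition ms_smooth (f : pt -> R) : Prop :=
  forall (s : seq 'I_d) (x : pt), differentiable (ms_iter_partial f s) x.

Definition ms_grad (f : pt -> R) (x : pt) : pt :=
  \row_(i < d) derive f x (ms_ebasis i).

Definition ms_setcoord (x : pt) (k : nat) (t : R) : pt :=
  \row_(j < d) (if (j : nat) == k then t else x ord0 j).

Fixpoint ms_iter_int (L : R) (k : nat) (F : pt -> R) (x : pt) : R :=
  match k with
  | 0 => F x
  | k'.+1 => Rintegral (@lebesgue_measure R) `[0, L]
               (fun t => ms_iter_int L k' F (ms_setcoord x k' t))
  end.

Definition ms_cube_int (L : R) (F : pt -> R) : R := ms_iter_int L d F 0.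

Definition ms_eff_qform (L : R) (U : pt -> R) (l : pt) : R :=
  inf [set (ms_cube_int L (fun x => ms_enorm (l - ms_grad f x) ^+ 2 * expR (- 2 * U x))
            / ms_cube_int L (fun x => expR (- 2 * U x))) |
       f in [set f : pt -> R | ms_smooth f /\ ms_periodic L f]].

(* effective diffusivity matrix D(U) on T^d_L, recovered by polarization
   from its quadratic form *)
Definition ms_eff_diff (L : R) (U : pt -> R) : 'M[R]_d :=
  \matrix_(i < d, j < d)
    ((ms_eff_qform L U (ms_ebasis i + ms_ebasis j) - ms_eff_qform L U (ms_ebasis i - ms_ebasis j)) / 4).

Definition ms_lambda_min (A : 'M[R]_d) : R := inf [set a : R | eigenvalue A a].
Definition ms_lambda_max (A : 'M[R]_d) : R := sup [set a : R | eigenvalue A a].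

Definition ms_mx_le (A B : 'M[R]_d) : Prop :=
  forall l : pt, (l *m A *m l^T) ord0 ord0 <= (l *m B *m l^T) ord0 ord0.

Definition ms_hquot (a : R) (T : pt -> R) : set R :=
  [set q | exists x y : pt, x != y /\ q = `|T x - T y| / powR (ms_enorm (x - y)) a].

Definition ms_holder_semi (a : R) (T : pt -> R) : R :=
  sup (ms_hquot a T).

Definition ms_holder_bounded (a : R) (T : pt -> R) : Prop :=
  has_ubound (ms_hquot a T).

Definition ms_osc (T : pt -> R) : R := sup (range T) - inf (range T).

Definition ms_Vsum (U : nat -> pt -> R) (Rk : nat -> R) (p n : nat) (x : pt) : R :=
  \sum_(p <= k < n.+1) U k ((Rk k)^-1 *: x).

End Defs.

Definition ms_Rscale (r : nat -> nat) (k : nat) : nat := \prod_(1 <= i < k.+1) r i.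

(* Main.v *)
Require Import Defs.
From HB Require Import structures.
From mathcomp Require Import all_boot all_order all_algebra.
From mathcomp Require Import all_classical all_reals all_analysis.
From mathcomp Require Import ring lra zify.
Set Implicit Arguments.
Unset Strict Implicit.
Unset Printing Implicit Defensive.
Import Order.TTheory GRing.Theory Num.Theory.
Import numFieldNormedType.Exports.
Local Open Scope classical_set_scope.
Local Open Scope ring_scope.

(** The quadratic form q_N(V) of D(V) on the torus of size N is invariant under scaling, so the scales can
    be peeled off one at a time: it suffices to compare q_N(U + W) with q_N(W) when U is 1-periodic and W is
    N-periodic and varies slowly, oscillating by at most delta over distances of order M, where
    1 << M << N.  Both comparisons lose a factor exp(O(delta + 1/M)).

    Upper bound: smooth a test function f of W by a kernel of width M and add the correctors of U weighted by
    the slopes of the smoothed function.  Averaging over all unit translates of the correctors decouples the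
    fast variable and produces lambda_max(D(U)) times the energy of f.

    Lower bound: for a test function f of U + W and a base point y, the lattice average of the kernel times
    f(. + y) is a test function for U on the unit cell.  Its field is the average of the field of f near y
    up to an error which is small because difference quotients of f over distance M, averaged by the
    kernel, vary only by O(1/M) over a unit cell; by Jensen's inequality the energy of f near y is at least
    lambda_min(D(U)) times the square of the averaged field, whose total energy dominates q_N(W).

    With M of the order of the square root of rho_min, Hoelder continuity of the potentials bounds delta and
    1/M by O(rho_min^(- alpha / 2)). *)

(** * Cell means of bounded uniformly continuous functions *)

(** Both one-scale comparisons end in Young's inequality (a - b)^2 <= (1 + s) a^2 + (1 + 1/s) b^2
    with s = 1/M. The error terms b have energy O(1/M^2), so the loss is a factor 1 + O(1/M). To
    reach this order without second derivatives of a test function, the kernel Phi is built so that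
    its derivative is 1/M times a difference of two translates of another kernel K; M is an integer,
    so that the translation is by a lattice vector and is compatible with lattice averages. The
    infimum defining D(U) need not be attained among smooth functions, and correctors are therefore
    near-minimizers of precision 1/M. They also give the parallelogram law for the infimum, without
    which the matrix defined by polarization could not be identified with its quadratic form.
    Additive errors become factors because lambda_max(D(U)) >= exp(-4 A) when |U| <= A. The loss per
    scale must not depend on how many scales remain: seen from one scale, the moduli of all coarser
    potentials form a geometric series. *)

Section BoundedUniformlyContinuous.
Context {R : realType} {V : normedModType R}.
Implicit Types F G : V -> R.

(* Every integrand below is bounded and uniformly continuous; the iterated integrals of such functions
   are limits of finite averages, which gives Fubini without any measure on ['rV[R]_d]. *)
Definition buc F :=
  (exists B : R, forall x, `|F x| <= B) /\
  (forall e : R, 0 < e -> exists2 s : R, 0 < s &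
     forall x y, `|x - y| <= s -> `|F x - F y| <= e).

Lemma buc_bound F : buc F -> exists2 B : R, 0 < B & forall x, `|F x| <= B.
Proof.
move=> [[B HB] _]; exists (`|B| + 1); first by rewrite ltr_wpDl.
by move=> x; rewrite (le_trans (HB x))// (le_trans (ler_norm B))// lerDl.
Qed.

Lemma buc_continuous F : buc F -> continuous F.
Proof.
move=> [_ H] x; apply/cvgrPdist_le => e e0; have [s s0 Hs] := H e e0.
near=> y; apply: Hs; near: y; exact: cvgr_dist_le.
Unshelve. all: by end_near. Qed.

Lemma buc_cst (c : R) : buc (fun=> c).
Proof.
split; first by exists `|c|.
by move=> e e0; exists 1 => // x y _; rewrite subrr normr0 ltW.
Qed.

Lemma bucD F G : buc F -> buc G -> buc (fun x => F x + G x).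
Proof.
move=> [[B HB] HF] [[C HC] HG]; split.
  by exists (B + C) => x; rewrite (le_trans (ler_normD _ _))// lerD.
move=> e e0; have e20 : 0 < e / 2 by rewrite divr_gt0.
have [s s0 Hs] := HF _ e20; have [t t0 Ht] := HG _ e20.
exists (Num.min s t); first by rewrite lt_min s0.
move=> x y; rewrite le_min => /andP[xs xt].
have -> : F x + G x - (F y + G y) = (F x - F y) + (G x - G y) by ring.
rewrite (le_trans (ler_normD _ _))// [leRHS](splitr e) lerD//; [exact: Hs|exact: Ht].
Qed.

Lemma bucM F G : buc F -> buc G -> buc (fun x => F x * G x).
Proof.
move=> bF bG; have [B B0 HB] := buc_bound bF; have [C C0 HC] := buc_bound bG.
split; first by exists (B * C) => x; rewrite normrM ler_pM.
move=> e e0; have [_ HF] := bF; have [_ HG] := bG.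
have eC : 0 < e / 2 / C by rewrite !divr_gt0.
have eB : 0 < e / 2 / B by rewrite !divr_gt0.
have [s s0 Hs] := HF _ eC; have [t t0 Ht] := HG _ eB.
exists (Num.min s t); first by rewrite lt_min s0.
move=> x y; rewrite le_min => /andP[/Hs xs /Ht xt].
have -> : F x * G x - (F y * G y) = (F x - F y) * G x + F y * (G x - G y) by ring.
rewrite (le_trans (ler_normD _ _))// [leRHS](splitr e) !normrM lerD//.
  rewrite -[leRHS](divfK (lt0r_neq0 C0)).
  by rewrite (le_trans (ler_wpM2r _ xs))// ler_wpM2l// ltW.
rewrite -[leRHS](divfK (lt0r_neq0 B0)) mulrC.
by rewrite (le_trans (ler_wpM2r _ xt))// ler_wpM2l// ltW.
Qed.

Lemma bucN F : buc F -> buc (fun x => - F x).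
Proof.
move=> bF; rewrite (_ : (fun x => - F x) = fun x => (-1) * F x); last first.
  by apply/funext => x; rewrite mulN1r.
exact/bucM/bF/buc_cst.
Qed.

Lemma bucB F G : buc F -> buc G -> buc (fun x => F x - G x).
Proof. by move=> bF bG; apply: bucD bF (bucN bG). Qed.

Lemma buc_expr F n : buc F -> buc (fun x => F x ^+ n).
Proof.
move=> bF; elim: n => [|n IH]; first exact: buc_cst.
under [X in buc X]funext do rewrite exprS.
exact: bucM.
Qed.

Lemma buc_sum (I : Type) (r : seq I) (P : pred I) (H : I -> V -> R) :
  (forall i, P i -> buc (H i)) -> buc (fun x => \sum_(i <- r | P i) H i x).
Proof.
move=> bH; elim: r => [|i r IH].
  by under [X in buc X]funext do rewrite big_nil; exact: buc_cst.
under [X in buc X]funext do rewrite big_cons.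
case: (boolP (P i)) => // Pi; apply: bucD IH; exact: bH.
Qed.

Lemma buc_norm F : buc F -> buc (fun x => `|F x|).
Proof.
move=> [[B HB] HF]; split; first by exists B => x; rewrite normr_id.
move=> e e0; have [s s0 Hs] := HF _ e0; exists s => // x y /Hs.
exact/le_trans/ler_dist_dist.
Qed.

Lemma buc_expR F : buc F -> buc (fun x => expR (F x)).
Proof.
move=> bF; have [B B0 HB] := buc_bound bF.
have eB x : expR (F x) <= expR B by rewrite ler_expR (le_trans (ler_norm _)).
split; first by exists (expR B) => x; rewrite ger0_norm// expR_ge0.
move=> e e0; have [_ HF] := bF.
have [s s0 Hs] := HF (e / expR B) (divr_gt0 e0 (expR_gt0 _)).
have key x y : expR (F x) - expR (F y) <= expR B * `|F x - F y|.
  have : expR (F x) * (1 + (F y - F x)) <= expR (F x) * expR (F y - F x).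
    by rewrite ler_pM2l ?expR_gt0// expR_ge1Dx.
  rewrite -expRD (addrC (F x)) subrK => h.
  have h2 : expR (F x) * (F x - F y) <= expR B * `|F x - F y|.
    rewrite (le_trans (ler_norm _))// normrM ger0_norm ?expR_ge0//.
    by rewrite ler_wpM2r.
  by apply: le_trans h2; rewrite -subr_ge0 in h; rewrite -subr_ge0; move: h; nra.
exists s => // x y /Hs xy; rewrite ler_norml; apply/andP; split.
  rewrite lerNl opprB (le_trans (key _ _))// distrC -ler_pdivlMl ?expR_gt0//.
  by rewrite mulrC.
by rewrite (le_trans (key _ _))// -ler_pdivlMl ?expR_gt0// mulrC.
Qed.

End BoundedUniformlyContinuous.

Lemma buc_comp {R : realType} {V W : normedModType R} (C : R) (g : W -> V)
    (F : V -> R) : (forall x y, `|g x - g y| <= C * `|x - y|) ->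
  buc F -> buc (fun x => F (g x)).
Proof.
move=> Hg [[B HB] HF]; split; first by exists B.
move=> e e0; have [s s0 Hs] := HF _ e0.
have C0 : 0 < `|C| + 1 by rewrite ltr_wpDl.
exists (s / (`|C| + 1)); first exact: divr_gt0.
move=> x y xy; apply: Hs; apply: le_trans (Hg _ _) _.
rewrite (@le_trans _ _ ((`|C| + 1) * `|x - y|))//.
  by rewrite ler_wpM2r// (le_trans (ler_norm _))// lerDl.
by rewrite -ler_pdivlMl// mulrC.
Qed.

Lemma buc_shift {R : realType} {V : normedModType R} (F : V -> R) (y : V) :
  buc F -> buc (fun x => F (x + y)).
Proof.
apply: (@buc_comp _ _ _ 1) => x x'.
by rewrite mul1r (_ : x + y - (x' + y) = x - x')// opprD addrACA subrr addr0.
Qed.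

Lemma buc_fst {R : realType} {V W : normedModType R} (F : V -> R) :
  buc F -> buc (fun p : V * W => F p.1).
Proof.
apply: (@buc_comp _ _ _ 1) => x y.
by rewrite mul1r [leRHS]/Num.norm/= le_max lexx.
Qed.

Lemma buc_snd {R : realType} {V W : normedModType R} (F : W -> R) :
  buc F -> buc (fun p : V * W => F p.2).
Proof.
apply: (@buc_comp _ _ _ 1) => x y.
by rewrite mul1r [leRHS]/Num.norm/= le_max lexx orbT.
Qed.

Lemma buc_pair_add {R : realType} {V : normedModType R} (F : V -> R) :
  buc F -> buc (fun p : V * V => F (p.1 + p.2)).
Proof.
apply: (@buc_comp _ _ _ 2) => x y.
rewrite (_ : x.1 + x.2 - (y.1 + y.2) = (x.1 - y.1) + (x.2 - y.2)); last first.
  by rewrite opprD addrACA.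
rewrite (le_trans (ler_normD _ _))// mulr_natl mulr2n.
by rewrite lerD// [leRHS]/Num.norm/= le_max lexx ?orbT.
Qed.

Lemma buc_section {R : realType} {V W : normedModType R} (F : V * W -> R) x :
  buc F -> buc (fun y => F (x, y)).
Proof.
apply: (@buc_comp _ _ _ 1) => y y'.
have -> : (x, y) - (x, y') = (0, y - y') by congr pair; rewrite subrr.
by rewrite mul1r prod_normE ge_max normr0 lexx normr_ge0.
Qed.

Lemma buc_swap {R : realType} {V W : normedModType R} (F : V * W -> R) :
  buc F -> buc (fun p : W * V => F (p.2, p.1)).
Proof.
apply: (@buc_comp _ _ _ 1) => y y'.
by rewrite mul1r !prod_normE maxC.
Qed.

(** * Integrals over intervals, computed through primitives *)

Section IntervalIntegral.
Context {R : realType}.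
Notation mu := (@lebesgue_measure R).
Implicit Types (g G : R -> R) (a b c L K : R).

Definition is_derive1_at (x : R) (G : R -> R) (l : R) := is_derive x 1 G l.

Lemma continuous_integrable_itv g a b : continuous g ->
  mu.-integrable `[a, b] (EFin \o g).
Proof.
move=> cg; apply: continuous_compact_integrable; first exact: segment_compact.
exact: continuous_subspaceT.
Qed.

(** Shift, scaling, periodicity and Riemann sums are all read off from the values of such a
    primitive; integrating from -K makes it available at both signs of x. *)
Lemma primitive_exists g K : continuous g ->
  exists G, forall x, -K < x < K -> is_derive1_at x G (g x).
Proof.
move=> cg; exists (fun x => Rintegral mu `[- K, x] g) => x /andP[Kx xK].
have [dG GE] := continuous_FTC1_closed xK (continuous_integrable_itv _ _ cg) Kx (cg x).
by apply: DeriveDef; [exact: dG|rewrite -derive1E; exact: GE].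
Qed.

Lemma is_derive1_continuous G (x l : R) : is_derive1_at x G l -> {for x, continuous G}.
Proof. by move=> [/derivable1_diffP + _]; exact: differentiable_continuous. Qed.

Lemma Rintegral_primitive g G a b : a <= b -> continuous g ->
  (forall x, a <= x <= b -> is_derive1_at x G (g x)) ->
  Rintegral mu `[a, b] g = G b - G a.
Proof.
rewrite le_eqVlt => /predU1P[<- _ _|ab cg dG].
  by rewrite set_itv1 Rintegral_set1 subrr.
have cG x : a <= x <= b -> {for x, continuous G}.
  by move=> /dG; exact: is_derive1_continuous.
rewrite /Rintegral (@continuous_FTC2 R g G)//=.
- exact: continuous_subspaceT.
- split.
  + by move=> x; rewrite in_itv/= => /andP[ax xb]; have [|//] := dG x; rewrite !ltW.
  + by apply: cvg_at_right_filter; apply: cG; rewrite lexx ltW.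
  + by apply: cvg_at_left_filter; apply: cG; rewrite lexx ltW.
- move=> x; rewrite in_itv/= => /andP[ax xb]; rewrite derive1E.
  by have [|_ ->//] := dG x; rewrite !ltW.
Qed.

Lemma MVT_closed G g a b : a <= b ->
  (forall x, a <= x <= b -> is_derive1_at x G (g x)) ->
  exists2 c, a <= c <= b & G b - G a = g c * (b - a).
Proof.
move=> ab dG; have [||c] := @MVT_segment R G g a b ab.
- by move=> x; rewrite in_itv/= => /andP[ax xb]; apply: dG; rewrite !ltW.
- apply: continuous_in_subspaceT => x; rewrite inE/= in_itv/= => xab.
  exact: (is_derive1_continuous (dG _ xab)).
- by rewrite in_itv/= => cab E; exists c.
Qed.

Lemma is_derive_shift_arg G x c l : is_derive1_at (x + c) G l ->
  is_derive1_at x (fun t => G (t + c)) l.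
Proof.
move=> dG; rewrite -[l]mulr1; apply: (@is_derive1_comp R G (shift c)) dG _.
exact: is_derive_shift.
Qed.

Lemma is_derive_scale_arg G x c l : is_derive1_at (x * c) G l ->
  is_derive1_at x (fun t => G (t * c)) (l * c).
Proof.
move=> dG; apply: (@is_derive1_comp R G (fun t => t * c)) => //.
have := is_deriveM (is_derive_id x 1) (is_derive_cst c x 1).
rewrite scaler0 add0r => h.
by apply: is_derive_eq h _; rewrite /GRing.scale/= mulr1.
Qed.

(** For a primitive G of g, the increment G(t + L) - G(t) has derivative g(t + L) - g(t) = 0; the
    two integrals are its values at c and at 0. *)
Lemma Rintegral_shift_periodic g L c : 0 <= L -> continuous g ->
  (forall t, g (t + L) = g t) ->
  Rintegral mu `[0, L] (fun t => g (t + c)) = Rintegral mu `[0, L] g.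
Proof.
move=> L0 cg pg.
have cgs c' : continuous (fun t => g (t + c')).
  by move=> x; apply: continuous_comp; [exact: cvgD cvg_id (cvg_cst _)|exact: cg].
have [G dG] := primitive_exists (L + `|c| + L + 1) cg.
have K x : - (`|c| + L) <= x <= L + `|c| + L -> is_derive1_at x G (g x).
  by move=> /andP[? ?]; apply: dG; lra.
have c1 := ler_norm c; have c2 := ler_norm (- c); rewrite normrN in c2.
rewrite (@Rintegral_primitive g G)//; last by move=> x ?; apply: K; lra.
rewrite (@Rintegral_primitive _ (fun t => G (t + c)))//; last first.
  by move=> x ?; apply: is_derive_shift_arg; apply: K; lra.
rewrite add0r.
pose D t := G (t + L) - G t.
have dD x : - `|c| <= x <= `|c| -> is_derive1_at x D 0.
  move=> xc; rewrite -(subrr (g x)) -{1}pg; apply: is_deriveB.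
    by apply: is_derive_shift_arg; apply: K; lra.
  by apply: K; lra.
have [c0|c0] := leP 0 c.
  have [x|x _] := @MVT_closed D (fun=> 0) 0 c c0; first by move=> ?; apply: dD; lra.
  by rewrite mul0r => /eqP; rewrite subr_eq0 => /eqP; rewrite /D !add0r (addrC L) => h; lra.
have [x|x _] := @MVT_closed D (fun=> 0) c 0 (ltW c0); first by move=> ?; apply: dD; lra.
by rewrite mul0r => /eqP; rewrite subr_eq0 => /eqP; rewrite /D !add0r (addrC L) => h; lra.
Qed.

Lemma Rintegral_scale g L c : 0 <= L -> 0 < c -> continuous g ->
  Rintegral mu `[0, L * c] (fun t => g (c^-1 * t)) = c * Rintegral mu `[0, L] g.
Proof.
move=> L0 c0 cg.
have [G dG] := primitive_exists (L + 1) cg.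
rewrite (@Rintegral_primitive g G)//; last by move=> x ?; apply: dG; lra.
rewrite (@Rintegral_primitive _ (fun t => c * G (t * c^-1))).
- by rewrite mul0r mulfK ?gt_eqF// mulrBr.
- by rewrite mulr_ge0// ltW.
- move=> x; apply: continuous_comp; last exact: cg.
  exact: mulrl_continuous.
- move=> x /andP[x0 xL]; have := is_derive_scale_arg (x := x) (c := c^-1).
  move=> /(_ G (g (c^-1 * x))) h.
  have {}h : is_derive1_at x (fun t => G (t * c^-1)) (g (c^-1 * x) * c^-1).
    apply: h; rewrite mulrC; apply: dG.
    have : 0 <= c^-1 * x by rewrite mulr_ge0// invr_ge0 ltW.
    have : c^-1 * x <= L by rewrite ler_pdivrMl// mulrC.
    by move=> *; lra.
  have := is_deriveZ c h.
  by move=> h2; apply: is_derive_eq h2 _; rewrite /GRing.scale/= mulrCA mulfV ?gt_eqF// mulr1.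
Qed.

Lemma Rintegral_periods g n : continuous g -> (forall t, g (t + 1) = g t) ->
  Rintegral mu `[0, n%:R] g = n%:R * Rintegral mu `[0, 1] g.
Proof.
move=> cg pg; have [G dG] := primitive_exists (n%:R + 1) cg.
have E m : (m < n)%N -> G m.+1%:R - G m%:R = Rintegral mu `[0, 1] g.
  move=> mn; have mn' : m%:R + 1 <= n%:R :> R by rewrite natr1 ler_nat.
  have m0 : 0 <= m%:R :> R by [].
  rewrite (@Rintegral_primitive _ (fun t => G (t + m%:R)))//.
    by rewrite add0r -natr1 (addrC 1).
  move=> x ?; have -> : g x = g (x + m%:R).
    by elim: m {mn mn' m0} => [|m IH]; rewrite ?addr0// IH -natr1 addrA pg.
  by apply: is_derive_shift_arg; apply: dG; lra.
rewrite (@Rintegral_primitive g G)//; last by move=> x ?; apply: dG; lra.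
rewrite -[G 0]/(G 0%:R) -(@telescope_sumr _ 0%N n (fun m => G m%:R))// big_mkord.
rewrite (eq_bigr (fun=> Rintegral mu `[0, 1] g)) => [|i _]; last exact: E.
by rewrite sumr_const card_ord mulr_natl.
Qed.

(** By the mean value theorem for a primitive, the integral over each of the m subintervals is its
    length times a value of g there, within e of the value at the left endpoint. *)
Lemma Rintegral_Riemann g L m (e : R) : 0 < L -> (0 < m)%N -> continuous g ->
  (forall t s, `|t - s| <= L / m%:R -> `|g t - g s| <= e) ->
  `|L^-1 * Rintegral mu `[0, L] g
    - m%:R^-1 * \sum_(j < m) g (L / m%:R * j%:R)| <= e.
Proof.
move=> L0 m0 cg ge; have m0' : 0 < m%:R :> R by rewrite ltr0n.
set h := L / m%:R; have h0 : 0 < h by exact: divr_gt0.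
have hm : h * m%:R = L by rewrite divfK ?gt_eqF.
have [G dG] := primitive_exists (L + 1) cg.
rewrite (@Rintegral_primitive g G)//; last first.
- by move=> x ?; apply: dG; lra.
- exact: ltW.
have -> : G L - G 0 = \sum_(j < m) (G (h * j.+1%:R) - G (h * j%:R)).
  rewrite -[in LHS]hm -[in LHS](mulr0 h).
  by rewrite -(big_mkord xpredT (fun j => G (h * j.+1%:R) - G (h * j%:R))) (@telescope_sumr _ 0%N m (fun j => G (h * j%:R))).
rewrite !mulr_sumr -sumrB (le_trans (ler_norm_sum _ _ _))//.
apply: (@le_trans _ _ (\sum_(j < m) m%:R^-1 * e)); last first.
  by rewrite sumr_const card_ord -[leLHS]mulr_natl mulVKf// gt_eqF.
apply: ler_sum => j _.
have hj : h * j.+1%:R - h * j%:R = h by rewrite -mulrBr -natrB// subSnn mulr1.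
have hj0 : 0 <= h * j%:R by rewrite mulr_ge0// ltW.
have hjL : h * j.+1%:R <= L by rewrite -hm ler_pM2l// ler_nat.
have [||c cc ->] := @MVT_closed G g (h * j%:R) (h * j.+1%:R).
- by lra.
- by move=> x ?; apply: dG; lra.
rewrite hj.
have -> : L^-1 * (g c * h) - m%:R^-1 * g (h * j%:R) = m%:R^-1 * (g c - g (h * j%:R)).
  by rewrite /h; field; rewrite !gt_eqF.
rewrite normrM ger0_norm ?invr_ge0// ler_wpM2l ?invr_ge0//; apply: ge.
by rewrite -/h ger0_norm; lra.
Qed.

End IntervalIntegral.

Section RowVectors.
Context {R : realType} {d : nat}.
Notation pt := 'rV[R]_d.
Implicit Types x y : pt.

Lemma rV_norm_le x (e : R) : 0 <= e -> (forall i, `|x ord0 i| <= e) -> `|x| <= e.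
Proof.
move=> e0 H; rewrite [leLHS]/Num.norm/= mx_normrE; apply: bigmax_le => //= -[i j] _ /=.
by rewrite ord1.
Qed.

Lemma rV_coord_le x i : `|x ord0 i| <= `|x|.
Proof. by rewrite [leRHS]/Num.norm/= mx_normrE; exact: (@le_bigmax _ _ _ _ _ (ord0, i)). Qed.

Lemma setcoord_dist x y k t s :
  `|ms_setcoord x k t - ms_setcoord y k s| <= Num.max `|x - y| `|t - s|.
Proof.
apply: rV_norm_le => [|i]; first by rewrite le_max normr_ge0.
rewrite !mxE; case: ifP => _; rewrite le_max ?lexx ?orbT//.
by have := rV_coord_le (x - y) i; rewrite !mxE => ->.
Qed.

Lemma setcoord_addr x y (k : 'I_d) t :
  ms_setcoord x k t + y = ms_setcoord (x + y) k (t + y ord0 k).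
Proof. by apply/rowP => j; rewrite !mxE; case: eqP => // /ord_inj ->. Qed.

Lemma setcoord_scale x k (c t : R) :
  c *: ms_setcoord x k t = ms_setcoord (c *: x) k (c * t).
Proof. by apply/rowP => j; rewrite !mxE; case: ifP. Qed.

Lemma buc_section_setcoord F x k : buc F -> buc (fun t : R => F (ms_setcoord x k t)).
Proof.
apply: (@buc_comp _ _ _ 1) => t s; rewrite mul1r.
apply: le_trans (setcoord_dist _ _ _ _ _) _.
by rewrite subrr normr0 ge_max normr_ge0 lexx.
Qed.

End RowVectors.

(** * Normalized iterated integrals over cubes *)

Section Mean.
Context {R : realType} {d : nat}.
Notation pt := 'rV[R]_d.
Notation mu := (@lebesgue_measure R).
Implicit Types (F G : pt -> R) (x y : pt) (L : R).

Lemma Rintegral_cst0 L (c : R) : 0 <= L -> Rintegral mu `[0, L] (fun=> c) = c * L.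
Proof.
move=> L0; rewrite Rintegral_cst//= lebesgue_measure_itv/= lte_fin.
by case: ltP => //= h; rewrite ?subr0// (_ : L = 0)//; apply/le_anti; rewrite h.
Qed.

Lemma le_Rintegral_itv L (g h : R -> R) : 0 <= L -> continuous g -> continuous h ->
  (forall t, 0 <= t <= L -> g t <= h t) ->
  Rintegral mu `[0, L] g <= Rintegral mu `[0, L] h.
Proof.
move=> L0 cg ch gh; apply: le_Rintegral => //; try exact: continuous_integrable_itv.
Qed.

Definition iter_mean L k F x : R := L^-1 ^+ k * ms_iter_int L k F x.

(** The base point 0 leaves no trace, since every coordinate is integrated out ([iter_mean_indep]
    with k = d). Dividing by the volume makes tori of different sizes comparable. *)
Definition mean L F : R := iter_mean L d F 0.

Lemma mean_int L F : 0 < L -> ms_cube_int L F = L ^+ d * mean L F.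
Proof.
by move=> L0; rewrite /mean /iter_mean mulrA -exprMn mulfV ?gt_eqF// expr1n mul1r.
Qed.

Lemma iter_int_buc L k F : 0 <= L -> buc F -> buc (ms_iter_int L k F).
Proof.
move=> L0 bF; elim: k => [//|k IH] /=.
have cs x : continuous (fun t => ms_iter_int L k F (ms_setcoord x k t)).
  exact/buc_continuous/buc_section_setcoord.
have [B B0 HB] := buc_bound IH; have [_ HF] := IH; split.
  exists (B * L) => x; rewrite ler_norml -mulNr -!Rintegral_cst0//.
  by apply/andP; split; apply: le_Rintegral_itv => //;
    try exact: cst_continuous; move=> t _;
    have := HB (ms_setcoord x k t); rewrite ler_norml => /andP[].
move=> e e0; have eL : 0 < e / (L + 1) by rewrite divr_gt0// ltr_wpDl.
have [s s0 Hs] := HF _ eL; exists s => // x y xy.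
have key x' y' : `|x' - y'| <= s ->
    Rintegral mu `[0, L] (fun t => ms_iter_int L k F (ms_setcoord x' k t)) <=
    Rintegral mu `[0, L] (fun t => ms_iter_int L k F (ms_setcoord y' k t)) + e.
  move=> xys; rewrite (@le_trans _ _ (Rintegral mu `[0, L] (fun t =>
    ms_iter_int L k F (ms_setcoord y' k t) + e / (L + 1))))//.
    apply: le_Rintegral_itv => //.
      by move=> t; apply: cvgD; [exact: cs|exact: cvg_cst].
    move=> t _; rewrite -lerBlDl (le_trans (ler_norm _))// Hs//.
    rewrite (le_trans (setcoord_dist _ _ _ _ _))// subrr normr0.
    by rewrite ge_max xys ltW.
  rewrite RintegralD//; last first.
  - by apply: continuous_integrable_itv; exact: cst_continuous.
  - exact: continuous_integrable_itv.
  rewrite lerD2l Rintegral_cst0// mulrAC ler_pdivrMr ?ler_pM2l//; last by lra.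
  by lra.
have h1 := key _ _ xy; rewrite distrC in xy; have h2 := key _ _ xy.
by rewrite ler_norml; apply/andP; split; lra.
Qed.

Lemma iter_mean_buc L k F : 0 <= L -> buc F -> buc (iter_mean L k F).
Proof. by move=> L0 bF; apply: bucM (buc_cst _) _; exact: iter_int_buc. Qed.

Lemma iter_meanS L k F x : 0 <= L -> buc F -> iter_mean L k.+1 F x =
  L^-1 * Rintegral mu `[0, L] (fun t => iter_mean L k F (ms_setcoord x k t)).
Proof.
move=> L0 bF; rewrite /iter_mean exprS -mulrA; congr (_ * _).
rewrite RintegralZl//; apply: continuous_integrable_itv.
exact/buc_continuous/buc_section_setcoord/iter_int_buc.
Qed.

Lemma iter_mean0 L F x : iter_mean L 0 F x = F x.
Proof. by rewrite /iter_mean expr0 mul1r. Qed.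

Lemma section_continuous L k F x : 0 <= L -> buc F ->
  continuous (fun t => iter_mean L k F (ms_setcoord x k t)).
Proof. by move=> L0 bF; exact/buc_continuous/buc_section_setcoord/iter_mean_buc. Qed.

Lemma iter_meanD L k F G x : 0 <= L -> buc F -> buc G ->
  iter_mean L k (fun z => F z + G z) x = iter_mean L k F x + iter_mean L k G x.
Proof.
move=> L0 bF bG; elim: k x => [|k IH] x; first by rewrite !iter_mean0.
rewrite !iter_meanS//; last exact: bucD.
under eq_Rintegral do rewrite IH.
by rewrite RintegralD ?mulrDr//; apply: continuous_integrable_itv;
  exact: section_continuous.
Qed.

Lemma iter_meanZ L k F (c : R) x : 0 <= L -> buc F ->
  iter_mean L k (fun z => c * F z) x = c * iter_mean L k F x.
Proof.
move=> L0 bF; elim: k x => [|k IH] x; first by rewrite !iter_mean0.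
rewrite !iter_meanS//; last by apply: bucM => //; exact: buc_cst.
under eq_Rintegral do rewrite IH.
rewrite RintegralZl//; first by rewrite mulrCA.
by apply: continuous_integrable_itv; exact: section_continuous.
Qed.

Lemma iter_mean_cst L k (c : R) x : 0 < L -> iter_mean L k (fun=> c) x = c.
Proof.
move=> L0; elim: k x => [|k IH] x; first by rewrite !iter_mean0.
rewrite iter_meanS ?(ltW L0)//; last exact: buc_cst.
under eq_Rintegral do rewrite IH.
by rewrite Rintegral_cst0 ?(ltW L0)// mulrC mulfK// gt_eqF.
Qed.

Lemma le_iter_mean L k F G x : 0 <= L -> buc F -> buc G ->
  (forall z : pt, (forall j : 'I_d, if (j < k)%N then 0 <= z ord0 j <= L
     else z ord0 j == x ord0 j) -> F z <= G z) ->
  iter_mean L k F x <= iter_mean L k G x.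
Proof.
move=> L0 bF bG; elim: k x => [|k IH] x H.
  by rewrite !iter_mean0; apply: H => j; rewrite ltn0.
rewrite !iter_meanS// ler_wpM2l ?invr_ge0//.
apply: le_Rintegral_itv => //; try exact: section_continuous.
move=> t tL; apply: IH => z Hz; apply: H => j.
have := Hz j; rewrite !mxE ltnS.
by case: (ltngtP j k) => // _ /eqP ->.
Qed.

Lemma iter_mean_indep L k F x y : 0 <= L -> buc F ->
  (forall j : 'I_d, (k <= j)%N -> x ord0 j = y ord0 j) ->
  iter_mean L k F x = iter_mean L k F y.
Proof.
move=> L0 bF; elim: k x y => [|k IH] x y H.
  by rewrite !iter_mean0; congr F; apply/rowP => j; exact: H.
rewrite !iter_meanS//; congr (_ * _); apply: eq_Rintegral => t _.
apply: IH => j kj; rewrite !mxE; case: eqP => // /eqP jk; apply: H.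
by rewrite ltn_neqAle eq_sym jk.
Qed.

Lemma periodic_shift (L : R) F y : ms_periodic L F -> ms_periodic L (fun z => F (z + y)).
Proof. by move=> pF z k; rewrite addrAC pF. Qed.

Lemma setcoord_period x (k : 'I_d) (t s : R) :
  ms_setcoord x k (t + s) = ms_setcoord x k t + s *: ms_ebasis R k.
Proof.
apply/rowP => j; rewrite !mxE (_ : (j : nat) == k = (j == k))//.
by case: eqP => _; rewrite ?mulr1// mulr0 addr0.
Qed.

(** Periodicity is used one coordinate at a time: the shift inside the k-th integral is absorbed by
    [Rintegral_shift_periodic], while coordinates not yet integrated only move the base point. *)
Lemma iter_mean_shift L k F x y : 0 <= L -> buc F -> ms_periodic L F ->
  (k <= d)%N -> iter_mean L k (fun z => F (z + y)) x = iter_mean L k F (x + y).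
Proof.
move=> L0 bF pF; elim: k x y => [|k IH] x y kd; first by rewrite !iter_mean0.
rewrite !iter_meanS//; last exact: buc_shift.
congr (_ * _); under eq_Rintegral do rewrite (IH _ _ (ltnW kd)).
pose i := Ordinal kd.
rewrite -(@Rintegral_shift_periodic _ (fun t => iter_mean L k F (ms_setcoord (x + y) k t)) L (y ord0 i))//.
- by apply: eq_Rintegral => t _; rewrite (setcoord_addr x y i).
- exact: section_continuous.
- move=> t; rewrite (setcoord_period (x + y) i) -IH ?(ltnW kd)//.
  by congr iter_mean; apply/funext => z; rewrite pF.
Qed.

Lemma iter_mean_scale L (c : R) k F x : 0 <= L -> 0 < c -> buc F ->
  iter_mean (L * c) k (fun z => F (c^-1 *: z)) x = iter_mean L k F (c^-1 *: x).
Proof.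
move=> L0 c0 bF; elim: k x => [|k IH] x; first by rewrite !iter_mean0.
have Lc : 0 <= L * c by rewrite mulr_ge0// ltW.
rewrite !iter_meanS//; last first.
  apply: (@buc_comp _ _ _ `|c^-1|) bF => y z.
  by rewrite -scalerBr normrZ.
under eq_Rintegral do rewrite IH setcoord_scale.
rewrite (Rintegral_scale L0 c0 (section_continuous (k := k) (x := c^-1 *: x) L0 bF)).
by rewrite invfM mulrA divfK// gt_eqF.
Qed.

Lemma iter_mean_periods n k F x : (0 < n)%N -> buc F -> ms_periodic 1 F ->
  (k <= d)%N -> iter_mean n%:R k F x = iter_mean 1 k F x.
Proof.
move=> n0 bF pF; elim: k x => [|k IH] x kd; first by rewrite !iter_mean0.
rewrite !iter_meanS// invr1 mul1r.
under eq_Rintegral do rewrite (IH _ (ltnW kd)).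
rewrite Rintegral_periods.
- by rewrite mulKf// pnatr_eq0 -lt0n.
- exact: section_continuous.
- move=> t; rewrite (setcoord_period x (Ordinal kd)).
  rewrite -iter_mean_shift// ?(ltnW kd)//.
  by congr iter_mean; apply/funext => z; rewrite pF.
Qed.

Definition mix k (p x : pt) : pt :=
  \row_j (if (j < k)%N then p ord0 j else x ord0 j).

(** The sample points P depend on L, k and the scale s alone. One P thus serves all functions with a
    given modulus, in particular all sections of a function of two variables, which is what
    [mean_swap] needs. *)
Lemma iter_mean_approx L k (s : R) : 0 < L -> 0 < s -> exists2 P : seq pt,
  (0 < size P)%N & forall F (e : R) x, buc F ->
    (forall y z : pt, `|y - z| <= s -> `|F y - F z| <= e) ->
    `|iter_mean L k F x - (size P)%:R^-1 * \sum_(p <- P) F (mix k p x)| <= k%:R * e.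
Proof.
move=> L0 s0; elim: k => [|k [P P0 HP]].
  exists [:: 0] => // F e x bF _; rewrite iter_mean0 big_seq1 invr1 !mul1r mul0r.
  rewrite (_ : mix 0 0 x = x) ?subrr ?normr0//.
  by apply/rowP => j; rewrite mxE.
pose m := (Num.truncn (L / s)).+1.
have m0 : 0 < m%:R :> R by rewrite ltr0n.
have Lms : L / m%:R <= s.
  rewrite ler_pdivrMr// mulrC -ler_pdivrMr//.
  by have := truncnS_gt (L / s) => /ltW.
pose Q := [seq ms_setcoord p k (L / m%:R * j%:R) | p <- P, j <- index_iota 0 m].
exists Q; first by rewrite size_allpairs size_iota subn0 muln_gt0 P0.
move=> F e x bF He; rewrite iter_meanS ?(ltW L0)//.
set g := fun t => iter_mean L k F (ms_setcoord x k t).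
have gc : continuous g by apply: section_continuous => //; exact: ltW.
pose h t := (size P)%:R^-1 * \sum_(p <- P) F (mix k p (ms_setcoord x k t)).
have P0' : 0 < (size P)%:R :> R by rewrite ltr0n.
have mixE p t : mix k p (ms_setcoord x k t) = mix k.+1 (ms_setcoord p k t) x.
  apply/rowP => j; rewrite !mxE ltnS.
  by case: (ltngtP j k).
have bh : buc h.
  apply: bucM (buc_cst _) _; apply: buc_sum => p _.
  apply: (@buc_comp _ _ _ 1) bF => t u; rewrite mul1r.
  apply: rV_norm_le => // i; rewrite !mxE; case: ifP => _; rewrite ?subrr ?normr0//.
  by case: ifP => _; rewrite ?subrr ?normr0//.
have hm t u : `|t - u| <= L / m%:R -> `|h t - h u| <= e.
  move=> tu; rewrite /h -mulrBr -sumrB normrM ger0_norm ?invr_ge0//.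
  rewrite -[leRHS](mulKf (lt0r_neq0 P0')) ler_pM2l ?invr_gt0//.
  have -> : (size P)%:R * e = \sum_(p <- P) e.
    by rewrite big_const_seq count_predT iter_addr_0 mulr_natl.
  rewrite (le_trans (ler_norm_sum _ _ _))//.
  apply: ler_sum => p _; apply: He; apply: rV_norm_le => [|i]; first exact: ltW.
  rewrite !mxE; case: ifP => _; rewrite ?subrr ?normr0 ?(ltW s0)//.
  by case: ifP => _; rewrite ?subrr ?normr0 ?(ltW s0)// (le_trans tu).
have e0 : 0 <= e by apply: le_trans (He 0 0 _); rewrite ?normr_ge0// subrr normr0 ltW.
have h1 : `|L^-1 * Rintegral mu `[0, L] g - L^-1 * Rintegral mu `[0, L] h| <= k%:R * e.
  rewrite -mulrBr -RintegralB//; last 2 first.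
  - exact: continuous_integrable_itv.
  - by apply: continuous_integrable_itv; exact: buc_continuous.
  rewrite normrM ger0_norm ?invr_ge0 ?(ltW L0)// ler_pdivrMl//.
  have cgh : continuous (fun t => g t - h t).
    by move=> t; apply: cvgB; [exact: gc|exact: buc_continuous].
  rewrite ler_norml mulrC -mulNr -(Rintegral_cst0 (k%:R * e) (ltW L0)).
  rewrite -(Rintegral_cst0 (- (k%:R * e)) (ltW L0)).
  apply/andP; split; apply: le_Rintegral_itv => //;
   try exact: cst_continuous; try exact: ltW; move=> t _;
   by have := HP F e (ms_setcoord x k t) bF He; rewrite ler_norml => /andP[].
have h2 := @Rintegral_Riemann R h L m e L0 isT (buc_continuous bh) hm.
have -> : (size Q)%:R^-1 * \sum_(p <- Q) F (mix k.+1 p x) =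
    m%:R^-1 * \sum_(j < m) h (L / m%:R * j%:R).
  rewrite /Q size_allpairs size_iota subn0 natrM invfM [_^-1 * m%:R^-1]mulrC -mulrA.
  congr (_ * _); rewrite big_allpairs_dep exchange_big big_mkord mulr_sumr.
  apply: eq_bigr => j _; congr (_ * _); apply: eq_bigr => p _.
  by rewrite mixE.
rewrite -natr1 mulrDl mul1r.
rewrite (le_trans (ler_distD (L^-1 * Rintegral mu `[0, L] h) _ _))//.
exact: lerD.
Qed.

Lemma meanD L F G : 0 < L -> buc F -> buc G ->
  mean L (fun x => F x + G x) = mean L F + mean L G.
Proof. by move=> /ltW L0 bF bG; exact: iter_meanD. Qed.

Lemma meanZ L (c : R) F : 0 < L -> buc F -> mean L (fun x => c * F x) = c * mean L F.
Proof. by move=> /ltW L0 bF; exact: iter_meanZ. Qed.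

Lemma meanZr L (c : R) F : 0 < L -> buc F -> mean L (fun x => F x * c) = mean L F * c.
Proof.
by move=> L0 bF; rewrite mulrC -meanZ//; congr mean; apply/funext => x; rewrite mulrC.
Qed.

Lemma mean_cst L (c : R) : 0 < L -> mean L (fun=> c) = c.
Proof. by move=> L0; exact: iter_mean_cst. Qed.

Lemma meanN L F : 0 < L -> buc F -> mean L (fun x => - F x) = - mean L F.
Proof.
move=> L0 bF; rewrite -mulN1r -meanZ//.
by congr mean; apply/funext => x; rewrite mulN1r.
Qed.

Lemma meanB L F G : 0 < L -> buc F -> buc G ->
  mean L (fun x => F x - G x) = mean L F - mean L G.
Proof. by move=> L0 bF bG; rewrite meanD ?meanN//; exact: bucN. Qed.

Lemma mean_sum L (I : Type) (r : seq I) (H : I -> pt -> R) : 0 < L ->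
  (forall i, buc (H i)) ->
  mean L (fun x => \sum_(i <- r) H i x) = \sum_(i <- r) mean L (H i).
Proof.
move=> L0 bH; elim: r => [|i r IH].
  rewrite big_nil -[RHS](mean_cst 0 L0); congr mean.
  by apply/funext => x; rewrite big_nil.
rewrite big_cons -IH -meanD//; last by apply: buc_sum => j _.
by congr mean; apply/funext => x; rewrite big_cons.
Qed.

Lemma le_mean_cube L F G : 0 < L -> buc F -> buc G ->
  (forall x, (forall j, 0 <= x ord0 j <= L) -> F x <= G x) ->
  mean L F <= mean L G.
Proof.
move=> L0 bF bG H; apply: le_iter_mean => //; first exact: ltW.
by move=> z Hz; apply: H => j; have := Hz j; rewrite ltn_ord.
Qed.

Lemma le_mean L F G : 0 < L -> buc F -> buc G ->
  (forall x, F x <= G x) -> mean L F <= mean L G.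
Proof. by move=> L0 bF bG H; apply: le_mean_cube => // x _. Qed.

Lemma mean_ge0 L F : 0 < L -> buc F -> (forall x, 0 <= F x) -> 0 <= mean L F.
Proof. by move=> L0 bF H; rewrite -(mean_cst 0 L0); apply: le_mean => //; exact: buc_cst. Qed.

Lemma mean_dist L F G (e : R) : 0 < L -> buc F -> buc G ->
  (forall x, `|F x - G x| <= e) -> `|mean L F - mean L G| <= e.
Proof.
move=> L0 bF bG H; rewrite -meanB// ler_norml.
rewrite -{1}(mean_cst (- e) L0) -{2}(mean_cst e L0).
by apply/andP; split; apply: le_mean => //; try exact: buc_cst; try exact: bucB;
  move=> x; have := H x; rewrite ler_norml => /andP[].
Qed.

Lemma mean_shift L F y : 0 < L -> buc F -> ms_periodic L F ->
  mean L (fun x => F (x + y)) = mean L F.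
Proof.
move=> L0 bF pF; rewrite /mean iter_mean_shift ?(ltW L0)//.
apply: iter_mean_indep => //; first exact: ltW.
by move=> j; rewrite leqNgt ltn_ord.
Qed.

Lemma mean_scale L (c : R) F : 0 < L -> 0 < c -> buc F ->
  mean (L * c) (fun x => F (c^-1 *: x)) = mean L F.
Proof. by move=> L0 c0 bF; rewrite /mean iter_mean_scale ?scaler0// ltW. Qed.

Lemma mean_periods n F : (0 < n)%N -> buc F -> ms_periodic 1 F ->
  mean n%:R F = mean 1 F.
Proof. by move=> n0 bF pF; rewrite /mean iter_mean_periods. Qed.

Lemma mean_approx L (s : R) : 0 < L -> 0 < s -> exists2 P : seq pt,
  (0 < size P)%N & forall F (e : R), buc F ->
    (forall y z : pt, `|y - z| <= s -> `|F y - F z| <= e) ->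
    `|mean L F - (size P)%:R^-1 * \sum_(p <- P) F p| <= d%:R * e.
Proof.
move=> L0 s0; have [P P0 HP] := @iter_mean_approx L d s L0 s0.
exists P => // F e bF He; have := HP F e 0 bF He.
rewrite (eq_bigr F)// => p _; congr F; apply/rowP => j.
by rewrite mxE ltn_ord.
Qed.

End Mean.

Lemma pair_dist1 {R : realType} {V W : normedModType R} (x y : V) (z : W) :
  `|(x, z) - (y, z)| = `|x - y|.
Proof.
have -> : (x, z) - (y, z) = (x - y, 0) by congr pair; rewrite subrr.
by rewrite prod_normE/= normr0; apply/max_idPl.
Qed.

Lemma pair_dist2 {R : realType} {V W : normedModType R} (x : V) (y z : W) :
  `|(x, y) - (x, z)| = `|y - z|.
Proof.
have -> : (x, y) - (x, z) = (0, y - z) by congr pair; rewrite subrr.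
by rewrite prod_normE/= normr0; apply/max_idPr.
Qed.

Lemma buc_mean {R : realType} {V : normedModType R} {d} (L : R)
    (F : V * 'rV[R]_d -> R) : 0 < L -> buc F ->
  buc (fun x => mean L (fun y => F (x, y))).
Proof.
move=> L0 bF; have bs x := buc_section x bF.
have [[B HB] HF] := bF; split.
  exists B => x; rewrite -(mean_cst (d := d) B L0).
  have h y := HB (x, y); rewrite ler_norml.
  rewrite -(meanN (d := d))//; last exact: buc_cst.
  by apply/andP; split; apply: le_mean => //; try exact: buc_cst;
    move=> y; have := h y; rewrite ler_norml => /andP[].
move=> e e0; have [s s0 Hs] := HF _ e0; exists s => // x y xy.
by apply: mean_dist => // z; apply: Hs; rewrite pair_dist1.
Qed.

(** Replacing the mean over y by an average over the same finitely many points for all x leaves an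
    error uniform in x, and finite sums commute with the mean over x by linearity. *)
Lemma mean_swap {R : realType} {d} (L L' : R)
    (F : 'rV[R]_d * 'rV[R]_d -> R) : 0 < L -> 0 < L' -> buc F ->
  mean L (fun x => mean L' (fun y => F (x, y))) =
  mean L' (fun y => mean L (fun x => F (x, y))).
Proof.
move=> L0 L0' bF; have bs x := buc_section x bF.
have bF' := buc_swap bF; have bs' y := buc_section y bF'.
have bm := buc_mean L0' bF; have bm' := buc_mean L0 bF'.
rewrite /= in bm' bs'.
apply/eqP; rewrite -subr_eq0 -normr_le0; apply/ler_addgt0Pr => e e0; rewrite add0r.
(* Each of the two approximations costs d times this modulus, hence less than e / 2. *)
have e20 : 0 < e / (2 * (d%:R + 1)) by rewrite divr_gt0// mulr_gt0// ltr_wpDl.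
have [s s0 Hs] := bF.2 _ e20.
have [P P0 HP] := mean_approx (d := d) L0' s0.
set c := (size P)%:R^-1 in HP.
set a := mean L _; set b := mean L' _.
have h1 : `|a - mean L (fun x => c * \sum_(p <- P) F (x, p))| <= d%:R * (e / (2 * (d%:R + 1))).
  apply: mean_dist => //.
    by apply: bucM (buc_cst _) _; apply: buc_sum => p _; exact: bs'.
  by move=> x; apply: HP => // y z yz; apply: Hs; rewrite pair_dist2.
have h2 : `|b - c * \sum_(p <- P) mean L (fun x => F (x, p))| <= d%:R * (e / (2 * (d%:R + 1))).
  apply: HP => // y z yz; apply: mean_dist => // x.
  by apply: Hs; rewrite pair_dist2.
rewrite meanZ// in h1; last by apply: buc_sum => p _; exact: bs'.
rewrite mean_sum// in h1.
set m := c * _ in h1 h2.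
rewrite (le_trans (ler_distD m _ _))// (distrC m).
rewrite (le_trans (lerD h1 h2))//.
have d0 : 0 <= d%:R :> R by [].
set t := d%:R * _; have -> : t + t = e * (d%:R / (d%:R + 1)) :> R.
  by rewrite /t; field; rewrite gt_eqF// ltr_wpDl.
by rewrite ler_piMr ?(ltW e0)// ler_pdivrMr ?mul1r ?ltr_wpDl// lerDl.
Qed.

(** * Smooth periodic functions *)

Lemma differentiable_near0 {R : realType} {V W : normedModType R} (f : V -> W)
    (df : {linear V -> W}) (x : V) : continuous df ->
  (forall e : R, 0 < e ->
     exists2 s : R, 0 < s & forall h : V, `|h| <= s ->
       `|f (x + h) - f x - df h| <= e * `|h|) ->
  differentiable f x /\ 'd f x = df :> (V -> W).
Proof.
move=> dfc H.
have fo : f \o shift x = cst (f x) + df +o_ 0 id.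
  apply/eqaddoP => e e0; have [s s0 Hs] := H e e0; near=> h.
  rewrite (_ : _ h = f (x + h) - f x - df h); last first.
    by rewrite !fctE /= opprD addrA [h + x]addrC.
  apply: Hs; rewrite -normrN -sub0r; near: h; exact: cvgr_dist_le.
have dE := diff_unique dfc fo.
by split=> //; apply/diff_locallyP; rewrite dE; split.
Unshelve. all: by end_near. Qed.

Section Periodic.
Context {R : realType} {d : nat}.
Notation pt := 'rV[R]_d.
Implicit Types (f g : pt -> R) (x y h : pt) (L : R).

Lemma row_ebasis x : x = \sum_k x ord0 k *: ms_ebasis R k.
Proof.
apply/rowP => j; rewrite summxE (bigD1 j)//= !mxE eqxx mulr1 big1 ?addr0// => i ij.
by rewrite !mxE eq_sym (negbTE ij) mulr0.
Qed.

Lemma periodic_int L f x k (n : int) : ms_periodic L f ->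
  f (x + (L *~ n) *: ms_ebasis R k) = f x.
Proof.
move=> pf; have pn m y : f (y + (L *+ m) *: ms_ebasis R k) = f y.
  elim: m => [|m IH]; first by rewrite mulr0n scale0r addr0.
  by rewrite mulrSr scalerDl addrA pf.
case: n => m; first exact: pn.
by rewrite NegzE mulrNz scaleNr -[in RHS](subrK ((L *+ m.+1) *: ms_ebasis R k) x) pn.
Qed.

Lemma periodic_lattice L f x (n : 'I_d -> int) : ms_periodic L f ->
  f (x + \row_k (L *~ n k)) = f x.
Proof.
move=> pf; rewrite [\row_k _]row_ebasis.
under eq_bigr do rewrite mxE.
elim: (index_enum _) => [|k s IH]; first by rewrite big_nil addr0.
by rewrite big_cons addrCA addrC periodic_int.
Qed.

Lemma lattice_reduce L x : 0 < L -> exists n : 'I_d -> int,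
  forall k, 0 <= (x + \row_k (L *~ n k)) ord0 k <= L.
Proof.
move=> L0; exists (fun k => - Num.floor (x ord0 k / L)) => k; rewrite !mxE.
have /andP[h1 h2] := mem_rg1_floor (x ord0 k / L).
have -> : x ord0 k + L *~ - Num.floor (x ord0 k / L) =
    L * (x ord0 k / L - (Num.floor (x ord0 k / L))%:~R).
  by rewrite mulrNz -mulrzr mulrBr mulrCA mulfV ?mulr1// gt_eqF.
rewrite mulr_ge0 ?subr_ge0 ?(ltW L0)//=.
by rewrite ler_piMr ?(ltW L0)// lerBlDl ltW.
Qed.

(** The period cell enlarged by 1 on every side: when a lattice vector brings x into the cell, it
    brings every point within distance 1 of x into this set. *)
Definition cubeset L : set pt := [set x | forall k, -1 <= x ord0 k <= L + 1].

Lemma compact_cube L : compact (cubeset L).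
Proof.
rewrite (_ : cubeset L = [set v | forall i, `[-1, L + 1]%classic (v ord0 i)]).
  by apply: (@rV_compact R _ (fun=> `[-1, L + 1]%classic)) => _; exact: segment_compact.
by apply/seteqP; split => x H k; have := H k; rewrite /= in_itv.
Qed.

(** Uniform continuity by compactness: the pairs of points of the enlarged cell whose values differ
    by at least e form a compact set, on which the distance attains a positive minimum. *)
Lemma periodic_buc L f : 0 < L -> continuous f -> ms_periodic L f -> buc f.
Proof.
move=> L0 cf pf; pose K := cubeset L; have cK : compact K := @compact_cube L.
have K0 : K !=set0 by exists 0 => k; rewrite !mxE; apply/andP; split; lra.
have cfK : {within K, continuous f} by exact: continuous_subspaceT.
split.
  have [c _ Hc] := compact_EVT_max K0 cK cfK.
  have [c' _ Hc'] := compact_EVT_min K0 cK cfK.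
  exists (`|f c| + `|f c'|) => x; have [n Hn] := lattice_reduce x L0.
  rewrite -(periodic_lattice x n pf); set z := x + _ in Hn *.
  have zK : z \in K by rewrite inE => k; have := Hn k; lra.
  have h1 := Hc _ zK; have h2 := Hc' _ zK.
  have := ler_norm (f c); have := ler_norm (- f c'); rewrite normrN.
  have := normr_ge0 (f c); have := normr_ge0 (f c').
  by move=> *; rewrite ler_norml; apply/andP; split; lra.
move=> e e0; pose C := [set p : pt * pt | e <= `|f p.1 - f p.2|].
have key x y : `|x - y| <= 1 -> exists z w, [/\ K z, K w, z - w = x - y, f z = f x & f w = f y].
  move=> xy; have [n Hn] := lattice_reduce x L0.
  exists (x + \row_k (L *~ n k)), (y + \row_k (L *~ n k)); split.
  - by move=> k; have := Hn k; lra.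
  - move=> k; have := Hn k; have := le_trans (rV_coord_le (x - y) k) xy.
    by rewrite !mxE ler_norml => *; lra.
  - by rewrite opprD addrACA subrr addr0.
  - exact: periodic_lattice.
  - exact: periodic_lattice.
have cC : compact (K `*` K `&` C).
  apply: (@subclosed_compact _ _ (K `*` K)); last 2 first.
  - exact: compact_setX.
  - by move=> p [].
  apply: closedI; first by apply: compact_closed; [exact: norm_hausdorff|exact: compact_setX].
  rewrite (_ : C = (fun p : pt * pt => `|f p.1 - f p.2|) @^-1` [set r | e <= r])//.
  apply: preimage_closed; last exact: closed_ge.
  move=> p _; apply: cvg_norm; apply: cvgB.
    by apply: (@cvg_comp _ _ _ fst); [exact: cvg_fst|exact: cf].
  by apply: (@cvg_comp _ _ _ snd); [exact: cvg_snd|exact: cf].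
have [C0|/set0P C0] := eqVneq (K `*` K `&` C) set0.
  exists 1 => // x y xy; rewrite leNgt; apply/negP => ef.
  have [z [w [Kz Kw _ fz fw]]] := key x y xy.
  have : (K `*` K `&` C) (z, w) by split=> //; rewrite /C /= fz fw ltW.
  by rewrite C0.
have cn : {within K `*` K `&` C, continuous (fun p : pt * pt => `|p.1 - p.2|)}.
  apply: continuous_subspaceT => p; apply: cvg_norm; apply: cvgB;
    [exact: cvg_fst|exact: cvg_snd].
have [[z0 w0] zwC Hm] := compact_EVT_min C0 cC cn.
set m := `|_ - _| in Hm; have m0 : 0 < m.
  rewrite /m normr_gt0 subr_eq0; apply/negP => /eqP /= zw.
  move: zwC; rewrite inE /C /= zw => -[_]; rewrite subrr normr0.
  by rewrite leNgt e0.
exists (Num.min 1 (m / 2)); first by rewrite lt_min ltr01/= divr_gt0.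
move=> x y; rewrite le_min => /andP[xy xym]; rewrite leNgt; apply/negP => ef.
have [z [w [Kz Kw zw fz fw]]] := key x y xy.
have : (z, w) \in K `*` K `&` C by rewrite inE; split=> //; rewrite /C /= fz fw ltW.
by move=> /Hm /=; rewrite zw; lra.
Qed.

Lemma differentiable_from_approx f x (g : 'I_d -> R) :
  (forall e : R, 0 < e -> exists2 s : R, 0 < s & forall h, `|h| <= s ->
     `|f (x + h) - f x - \sum_k h ord0 k * g k| <= e * `|h|) ->
  differentiable f x /\ forall h, 'D_h f x = \sum_k h ord0 k * g k.
Proof.
move=> H; pose l h := \sum_k h ord0 k * g k.
have l_lin : linear l.
  move=> a u v; rewrite /l /GRing.scale/= mulr_sumr -big_split; apply: eq_bigr => k _ /=.
  by rewrite !mxE mulrDl mulrA.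
pose lM := GRing.isLinear.Build _ _ _ _ _ l_lin.
pose L : {linear pt -> R} := HB.pack l lM.
have lc : continuous L.
  rewrite /L/= /l; elim: (index_enum _) => [|k r IH].
    by under [X in continuous X]funext do rewrite big_nil; exact: cst_continuous.
  under [X in continuous X]funext do rewrite big_cons.
  move=> y; apply: cvgD (IH y).
  by apply: cvgM; [exact: coord_continuous|exact: cvg_cst].
have [df dE] : differentiable f x /\ 'd f x = L :> (pt -> R).
  exact: differentiable_near0.
by split=> // h; rewrite deriveE// dE.
Qed.

Lemma derive_partial f x h : differentiable f x ->
  'D_h f x = \sum_k h ord0 k * 'D_(ms_ebasis R k) f x.
Proof.
move=> df; rewrite deriveE// {1}[h]row_ebasis linear_sum; apply: eq_bigr => k _.
by rewrite linearZ/= deriveE.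
Qed.

End Periodic.

(** * Smooth functions and differentiation under the mean *)

Section Smooth.
Context {R : realType} {d : nat}.
Notation pt := 'rV[R]_d.
Notation e_ k := (ms_ebasis R k).
Implicit Types (f g : pt -> R) (x y h : pt) (L : R) (k : 'I_d).

Definition pd k f : pt -> R := fun x => derive f x (e_ k).

Lemma iter_partial_rcons f s k :
  ms_iter_partial f (rcons s k) = ms_iter_partial (pd k f) s.
Proof. by elim: s => //= a s ->. Qed.

Lemma smooth_diff f x : ms_smooth f -> differentiable f x.
Proof. exact: (fun H => H [::] x). Qed.

Lemma smooth_pd k f : ms_smooth f -> ms_smooth (pd k f).
Proof. by move=> H s x; rewrite -iter_partial_rcons. Qed.

(** Coinduction for smoothness. The last index of s is the derivative taken first, so stripping it
    replaces f by [pd k f], which stays in the class P; the closure properties below need only a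
    class stable under one derivative. *)
Lemma smooth_coind (P : (pt -> R) -> Prop) :
  (forall f, P f -> (forall x, differentiable f x) /\ forall k, P (pd k f)) ->
  forall f, P f -> ms_smooth f.
Proof.
move=> HP f Pf s; move: {2}(size s) (erefl (size s)) => n.
elim: n s f Pf => [|n IH] s f Pf; first by move=> /size0nil -> x; case: (HP f Pf).
case/lastP: s => // s k; rewrite size_rcons => -[sn] x.
by rewrite iter_partial_rcons; apply: IH => //; case: (HP f Pf).
Qed.

(** Sums must accompany products, because the Leibniz rule sends a product to a sum of products. *)
Inductive smooth_closure : (pt -> R) -> Prop :=
| smooth_base f : ms_smooth f -> smooth_closure f
| smooth_add f g : smooth_closure f -> smooth_closure g ->
    smooth_closure (fun x => f x + g x)
| smooth_mul f g : smooth_closure f -> smooth_closure g ->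
    smooth_closure (fun x => f x * g x).

Lemma differentiable_pdD f g x k : differentiable f x -> differentiable g x ->
  pd k (fun z => f z + g z) x = pd k f x + pd k g x.
Proof. by move=> df dg; apply: deriveD; exact: diff_derivable. Qed.

Lemma differentiable_pdM f g x k : differentiable f x -> differentiable g x ->
  pd k (fun z => f z * g z) x = f x * pd k g x + g x * pd k f x.
Proof. by move=> df dg; apply: deriveM; exact: diff_derivable. Qed.

Lemma smooth_closureP f : smooth_closure f -> ms_smooth f.
Proof.
apply: smooth_coind => {}f; elim => {f} [f sf|f g sf [df pf] sg [dg pg]|f g sf [df pf] sg [dg pg]].
- by split=> [x|k]; [exact: smooth_diff|apply/smooth_base/smooth_pd].
- split=> [x|k]; first exact: differentiableD.
  rewrite (_ : pd k _ = fun x => pd k f x + pd k g x); first exact: smooth_add.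
  by apply/funext => x; exact: differentiable_pdD.
- split=> [x|k]; first exact: differentiableM.
  rewrite (_ : pd k _ = fun x => f x * pd k g x + g x * pd k f x).
    by apply: smooth_add; exact: smooth_mul.
  by apply/funext => x; exact: differentiable_pdM.
Qed.

Lemma smoothD f g : ms_smooth f -> ms_smooth g -> ms_smooth (fun x => f x + g x).
Proof. by move=> sf sg; apply/smooth_closureP/smooth_add; exact: smooth_base. Qed.

Lemma smoothM f g : ms_smooth f -> ms_smooth g -> ms_smooth (fun x => f x * g x).
Proof. by move=> sf sg; apply/smooth_closureP/smooth_mul; exact: smooth_base. Qed.

Lemma pd_cst k (c : R) : pd k (fun=> c) = fun=> 0.
Proof. by apply/funext => x; exact: derive_cst. Qed.

Lemma smooth_cst (c : R) : ms_smooth (fun _ : pt => c).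
Proof.
apply: (smooth_coind (P := fun f => exists c, f = fun=> c)); last by exists c.
move=> f [{}c ->]; split=> [x|k]; first exact: differentiable_cst.
by exists 0; rewrite pd_cst.
Qed.

Lemma smooth_sum (I : Type) (r : seq I) (H : I -> pt -> R) :
  (forall i, ms_smooth (H i)) -> ms_smooth (fun x => \sum_(i <- r) H i x).
Proof.
move=> sH; elim: r => [|i r IH].
  by under [X in ms_smooth X]funext do rewrite big_nil; exact: smooth_cst.
by under [X in ms_smooth X]funext do rewrite big_cons; exact: smoothD.
Qed.

Lemma smooth_prod (I : Type) (r : seq I) (H : I -> pt -> R) :
  (forall i, ms_smooth (H i)) -> ms_smooth (fun x => \prod_(i <- r) H i x).
Proof.
move=> sH; elim: r => [|i r IH].
  by under [X in ms_smooth X]funext do rewrite big_nil; exact: smooth_cst.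
by under [X in ms_smooth X]funext do rewrite big_cons; exact: smoothM.
Qed.

Lemma smoothZ (c : R) f : ms_smooth f -> ms_smooth (fun x => c * f x).
Proof. by apply: smoothM; exact: smooth_cst. Qed.

Lemma pd_sum (I : Type) (r : seq I) (H : I -> pt -> R) k x :
  (forall i, ms_smooth (H i)) ->
  pd k (fun z => \sum_(i <- r) H i z) x = \sum_(i <- r) pd k (H i) x.
Proof.
move=> sH; elim: r => [|i r IH].
  under [X in pd k X]funext do rewrite big_nil.
  by rewrite pd_cst big_nil.
under [X in pd k X]funext do rewrite big_cons.
rewrite differentiable_pdD ?big_cons ?IH//; first exact: smooth_diff.
by apply: smooth_diff; exact: smooth_sum.
Qed.

Lemma pdZ (c : R) f k x : ms_smooth f -> pd k (fun z => c * f z) x = c * pd k f x.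
Proof.
move=> sf; rewrite differentiable_pdM ?pd_cst ?mulr0 ?addr0//.
exact: smooth_diff.
Qed.

Lemma pd_shift k f y : pd k (fun x => f (x + y)) = fun x => pd k f (x + y).
Proof.
apply/funext => x; rewrite /pd /derive; set F := fun h : R => _; set G := fun h : R => _.
by have -> : F = G by apply/funext => h; rewrite /F /G/= addrA.
Qed.

Lemma smooth_shift f y : ms_smooth f -> ms_smooth (fun x => f (x + y)).
Proof.
move=> sf; apply: (smooth_coind
  (P := fun g => exists2 f, ms_smooth f & g = fun x => f (x + y))); last by exists f.
move=> _ [{sf}f sf ->]; split=> [x|k].
  by apply: differentiable_comp; [exact: differentiableD|exact: smooth_diff].
by exists (pd k f); [exact: smooth_pd|rewrite pd_shift].
Qed.

Lemma derive_scale_arg f (c : R) x h : 'D_h (fun z => f (c *: z)) x = 'D_(c *: h) f (c *: x).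
Proof.
rewrite /derive; set F := fun t : R => _; set G := fun t : R => _.
by have -> : F = G by apply/funext => t; rewrite /F /G/=; congr (_ *: (f _ - _)); rewrite scalerDr !scalerA (mulrC c).
Qed.

Lemma pd_scale k f (c : R) : ms_smooth f ->
  pd k (fun x => f (c *: x)) = fun x => c * pd k f (c *: x).
Proof.
move=> sf; apply/funext => x; rewrite /pd derive_scale_arg !deriveE; try exact: smooth_diff.
by rewrite linearZ.
Qed.

Lemma smooth_scale f (c : R) : ms_smooth f -> ms_smooth (fun x => f (c *: x)).
Proof.
move=> sf; apply: (smooth_coind (P := fun g =>
  exists a f, ms_smooth f /\ g = fun x => a * f (c *: x))); last first.
  by exists 1, f; split=> //; apply/funext => x; rewrite mul1r.
move=> _ [a [{sf}f [sf ->]]].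
have dfc x : differentiable (fun x => f (c *: x)) x.
  by apply: differentiable_comp; [exact: differentiableZ|exact: smooth_diff].
split=> [x|k]; first by apply: differentiableM => //; exact: differentiable_cst.
exists (a * c), (pd k f); split; first exact: smooth_pd.
apply/funext => x; rewrite differentiable_pdM//.
by rewrite pd_cst mulr0 addr0 pd_scale// mulrA.
Qed.

Lemma periodic_pd L k f : ms_periodic L f -> ms_periodic L (pd k f).
Proof.
move=> pf x j; rewrite -[LHS]/((fun z => pd k f (z + L *: e_ j)) x) -pd_shift.
by congr (pd k _ x); apply/funext => z; rewrite pf.
Qed.

Lemma smooth_continuous f : ms_smooth f -> continuous f.
Proof. by move=> sf x; exact/differentiable_continuous/smooth_diff. Qed.

Lemma smooth_buc L f : 0 < L -> ms_smooth f -> ms_periodic L f -> buc f.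
Proof. by move=> L0 sf pf; apply: periodic_buc pf => //; exact: smooth_continuous. Qed.

Lemma smooth_pd_buc L k f : 0 < L -> ms_smooth f -> ms_periodic L f -> buc (pd k f).
Proof. by move=> L0 sf pf; apply: smooth_buc L0 (smooth_pd _ sf) (periodic_pd _ pf). Qed.

Lemma is_derive_line f x h (t : R) : (forall z, differentiable f z) ->
  is_derive1_at t (fun s => f (x + s *: h)) (\sum_k h ord0 k * pd k f (x + t *: h)).
Proof.
move=> df; rewrite -derive_partial//; have := @diff_derivable _ _ _ f (x + t *: h) h (df _).
rewrite /derivable.
have E : (fun s : R => s^-1 *: ((f \o shift (x + t *: h)) (s *: h) - f (x + t *: h))) =
  (fun s : R => s^-1 *: (((fun s => f (x + s *: h)) \o shift t) (s *: 1) - f (x + t *: h))).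
  apply/funext => s /=; congr (_ *: (f _ - _)).
  by rewrite addrCA -scalerDl; congr (_ + _ *: _); rewrite /GRing.scale/= mulr1.
move=> c; apply: DeriveDef; first by rewrite /derivable -E.
by rewrite /derive -E.
Qed.

Lemma line_MVT f x h : (forall z, differentiable f z) -> exists2 c : R, 0 <= c <= 1 &
  f (x + h) - f x = \sum_k h ord0 k * pd k f (x + c *: h).
Proof.
move=> df; have [|c c01] := @MVT_closed R (fun s => f (x + s *: h))
  (fun s => \sum_k h ord0 k * pd k f (x + s *: h)) 0 1 ler01.
  by move=> t _; exact: is_derive_line.
by rewrite scale1r scale0r addr0 subr0 mulr1 => E; exists c.
Qed.

(** The mean value theorem on the segment and the uniform continuity of the partial derivatives make
    the first-order error uniform in x; this is what allows differentiation under [mean]. *)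
Lemma smooth_uniform_diff L f (e : R) : 0 < L -> ms_smooth f -> ms_periodic L f ->
  0 < e -> exists2 s : R, 0 < s & forall x h, `|h| <= s ->
    `|f (x + h) - f x - \sum_k h ord0 k * pd k f x| <= e * `|h|.
Proof.
move=> L0 sf pf e0; have e'0 : 0 < e / (d%:R + 1) by rewrite divr_gt0// ltr_wpDl.
have /choice[S HS] : forall k, exists s : R, 0 < s /\
    forall x y, `|x - y| <= s -> `|pd k f x - pd k f y| <= e / (d%:R + 1).
  move=> k; have [_ /(_ _ e'0)[s s0 Hs]] := smooth_pd_buc k L0 sf pf.
  by exists s.
exists (\big[Num.min/1]_k S k).
  by apply: lt_bigmin => // k _; case: (HS k).
move=> x h hs; have [c /andP[c0 c1] ->] := line_MVT x h (fun z => smooth_diff z sf).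
rewrite -sumrB (le_trans (ler_norm_sum _ _ _))//.
apply: (@le_trans _ _ (\sum_(k < d) `|h| * (e / (d%:R + 1)))).
  apply: ler_sum => k _; rewrite -mulrBr normrM ler_pM//; first exact: rV_coord_le.
  apply: (HS k).2; rewrite addrC addKr normrZ ger0_norm//.
  rewrite (le_trans (ler_piMl _ c1))// (le_trans hs)//.
  by apply: bigmin_le_cond.
rewrite sumr_const card_ord -[leLHS]mulr_natl mulrCA mulrC ler_wpM2r//.
rewrite mulrCA ler_piMr ?(ltW e0)// ler_pdivrMr ?mul1r ?lerDl// ltr_wpDl//.
Qed.

(** A correlation rather than a convolution: y enters through f only, so derivatives in y fall on f
    and the kernel need only be [buc]. *)
Definition smoothing L (Phi f : pt -> R) : pt -> R :=
  fun y => mean L (fun x => Phi x * f (x + y)).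

Lemma smoothing_diff L Phi f y : 0 < L -> buc Phi -> ms_smooth f -> ms_periodic L f ->
  differentiable (smoothing L Phi f) y /\
  forall k, pd k (smoothing L Phi f) y = smoothing L Phi (pd k f) y.
Proof.
move=> L0 bPhi sf pf; have [B B0 HB] := buc_bound bPhi.
have bf := smooth_buc L0 sf pf; have bpf k := smooth_pd_buc k L0 sf pf.
have bs g z : buc g -> buc (fun x => Phi x * g (x + z)).
  by move=> bg; apply: bucM => //; exact: buc_shift.
have [|dT DT] := @differentiable_from_approx R d (smoothing L Phi f) y
    (fun k => smoothing L Phi (pd k f) y); last first.
  split=> // k; rewrite /pd DT (bigD1 k)//= !mxE eqxx mul1r big1 ?addr0// => i ik.
  by rewrite !mxE (negbTE ik) mul0r.
move=> e e0; have [s s0 Hs] := smooth_uniform_diff L0 sf pf (divr_gt0 e0 B0).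
exists s => // h hs.
have -> : smoothing L Phi f (y + h) - smoothing L Phi f y -
    \sum_k h ord0 k * smoothing L Phi (pd k f) y =
  mean L (fun x => Phi x * (f (x + y + h) - f (x + y)
            - \sum_k h ord0 k * pd k f (x + y))).
  have E k : h ord0 k * smoothing L Phi (pd k f) y =
      mean L (fun x => h ord0 k * (Phi x * pd k f (x + y))) by rewrite meanZ//; exact: bs.
  under eq_bigr do rewrite E.
  rewrite /smoothing.
  rewrite -mean_sum//; last by move=> k; apply: bucM; [exact: buc_cst|exact: bs].
  rewrite -!meanB//; try exact: bs.
  - congr mean; apply/funext => x; rewrite !mulrBr addrA mulr_sumr; congr (_ - _).
    by apply: eq_bigr => k _; rewrite mulrCA.
  - by apply: bucB; exact: bs.
  - by apply: buc_sum => k _; apply: bucM; [exact: buc_cst|exact: bs].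
rewrite -[X in `|X|]subr0 -[X in `|_ - X|](mean_cst (d := d) 0 L0); apply: mean_dist => //.
- apply: bucM => //; apply: bucB.
    by apply: bucB; [exact: (buc_shift y (buc_shift h bf))|exact: buc_shift].
  by apply: buc_sum => k _; apply: bucM; [exact: buc_cst|exact: buc_shift].
- exact: buc_cst.
- move=> x; rewrite subr0 normrM (le_trans (ler_pM _ _ (HB x) (Hs _ _ hs)))//.
  by rewrite mulrA mulrCA mulfV ?mulr1// gt_eqF.
Qed.

Lemma smoothing_periodic L L' Phi f : ms_periodic L' f -> ms_periodic L' (smoothing L Phi f).
Proof.
by move=> pf x k; congr mean; apply/funext => z; rewrite addrA pf.
Qed.

Lemma pd_smoothing L Phi f k : 0 < L -> buc Phi -> ms_smooth f -> ms_periodic L f ->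
  pd k (smoothing L Phi f) = smoothing L Phi (pd k f).
Proof. by move=> L0 bP sf pf; apply/funext => x; case: (smoothing_diff x L0 bP sf pf). Qed.

Lemma smooth_smoothing L Phi f : 0 < L -> buc Phi -> ms_smooth f -> ms_periodic L f ->
  ms_smooth (smoothing L Phi f).
Proof.
move=> L0 bP sf pf; apply: (smooth_coind (P := fun g => exists f,
  [/\ ms_smooth f, ms_periodic L f & g = smoothing L Phi f])); last by exists f.
move=> _ [{sf pf}f [sf pf ->]]; split=> [x|k].
  by case: (smoothing_diff x L0 bP sf pf).
exists (pd k f); split; [exact: smooth_pd|exact: periodic_pd|exact: pd_smoothing].
Qed.

End Smooth.

(** * Smooth kernels forming partitions of unity *)

Section SmoothReal.
Context {R : realType}.
Implicit Types (f g h : R -> R) (t c : R).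

Fixpoint smoothn n h := if n is m.+1 then
  exists2 h', forall t, is_derive1_at t h (h' t) & smoothn m h' else True.

Definition smooth1 h := forall n, smoothn n h.

Lemma smooth1_coind (P : (R -> R) -> Prop) :
  (forall h, P h -> exists2 h', forall t, is_derive1_at t h (h' t) & P h') ->
  forall h, P h -> smooth1 h.
Proof.
move=> HP h Ph n; elim: n h Ph => //= n IH h /HP[h' dh Ph'].
by exists h' => //; exact: IH.
Qed.

Lemma is_derive1_at_unique t h a b : is_derive1_at t h a -> is_derive1_at t h b -> a = b.
Proof. by move=> [_ <-] [_ <-]. Qed.

(** [smoothn] supplies a derivative for each order separately; by uniqueness of the derivative they
    coincide. *)
Lemma smooth1_deriv h : smooth1 h ->
  exists2 h', forall t, is_derive1_at t h (h' t) & smooth1 h'.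
Proof.
move=> sh; have [h' dh _] := sh 1; exists h' => // n.
have [h2 dh2] := sh n.+1; suff -> : h2 = h' by [].
by apply/funext => t; exact: (is_derive1_at_unique (dh2 t)).
Qed.

Lemma smooth1_prim h h' : (forall t, is_derive1_at t h (h' t)) -> smooth1 h' -> smooth1 h.
Proof. by move=> dh sh' [//|n]; exists h'. Qed.

Lemma smooth1_continuous h : smooth1 h -> continuous h.
Proof. by move=> /smooth1_deriv[h' dh _] t; exact: is_derive1_continuous (dh t). Qed.

Inductive smooth1_closure : (R -> R) -> Prop :=
| smooth1_base h a c : smooth1 h -> smooth1_closure (fun t => h (t * a + c))
| smooth1_cst c : smooth1_closure (fun=> c)
| smooth1_add f g : smooth1_closure f -> smooth1_closure g ->
    smooth1_closure (fun x => f x + g x)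
| smooth1_mul f g : smooth1_closure f -> smooth1_closure g ->
    smooth1_closure (fun x => f x * g x).

Lemma is_derive_affine_arg h (l x a c : R) : is_derive1_at (x * a + c) h l ->
  is_derive1_at x (fun t => h (t * a + c)) (l * a).
Proof.
by move=> dh; apply: (@is_derive_scale_arg _ (fun t => h (t + c))); exact: is_derive_shift_arg.
Qed.

Lemma smooth1_closureP f : smooth1_closure f -> smooth1 f.
Proof.
apply: smooth1_coind => {}f; elim => {f} [h a c sh|c|f g sf [f' df sf'] sg [g' dg sg']|f g sf [f' df sf'] sg [g' dg sg']].
- have [h' dh sh'] := smooth1_deriv sh; exists (fun t => h' (t * a + c) * a).
    by move=> t; exact: is_derive_affine_arg.
  by apply: smooth1_mul; [exact: smooth1_base|exact: smooth1_cst].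
- by exists (fun=> 0); [move=> t; exact: is_derive_cst|exact: smooth1_cst].
- exists (fun t => f' t + g' t); last exact: smooth1_add.
  by move=> t; exact: (is_deriveD (df t) (dg t)).
- exists (fun t => f t * g' t + g t * f' t).
    by move=> t; exact: (is_deriveM (df t) (dg t)).
  by apply: smooth1_add; exact: smooth1_mul.
Qed.

Lemma smooth1_affine h a c : smooth1 h -> smooth1 (fun t => h (t * a + c)).
Proof. by move=> sh; exact/smooth1_closureP/smooth1_base. Qed.

Lemma smooth1_closure_self h : smooth1 h -> smooth1_closure h.
Proof.
move=> sh; rewrite (_ : h = fun t => h (t * 1 + 0)); first exact: smooth1_base.
by apply/funext => t; rewrite mulr1 addr0.
Qed.

Lemma smooth1M f g : smooth1 f -> smooth1 g -> smooth1 (fun t => f t * g t).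
Proof. by move=> sf sg; apply/smooth1_closureP/smooth1_mul; exact: smooth1_closure_self. Qed.

Lemma smooth1D f g : smooth1 f -> smooth1 g -> smooth1 (fun t => f t + g t).
Proof. by move=> sf sg; apply/smooth1_closureP/smooth1_add; exact: smooth1_closure_self. Qed.

Lemma smooth1Z c f : smooth1 f -> smooth1 (fun t => c * f t).
Proof. by apply: smooth1M; exact/smooth1_closureP/smooth1_cst. Qed.

Lemma smooth1B f g : smooth1 f -> smooth1 g -> smooth1 (fun t => f t - g t).
Proof.
move=> sf sg; apply: smooth1D => //.
under [X in smooth1 X]funext do rewrite -mulN1r.
exact: smooth1Z.
Qed.

Lemma is_derive1_near t f g l : {near t, f =1 g} -> is_derive1_at t g l -> is_derive1_at t f l.
Proof.
move=> fg dg; apply: near_eq_is_derive dg.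
by near=> s; apply/esym; near: s.
Unshelve. all: by end_near. Qed.

Lemma is_derive1_approx t f (l : R) :
  (forall e : R, 0 < e -> exists2 s : R, 0 < s & forall h : R, `|h| <= s ->
     `|f (t + h) - f t - h * l| <= e * `|h|) -> is_derive1_at t f l.
Proof.
move=> H; pose L0 (h : R) := h * l.
have L_lin : linear L0 by move=> a u v; rewrite /L0 mulrDl /GRing.scale/= mulrA.
pose lM := GRing.isLinear.Build _ _ _ _ _ L_lin.
pose L : {linear R -> R} := HB.pack L0 lM.
have lc : continuous L by move=> x; exact: mulrr_continuous.
have [df dE] := differentiable_near0 lc H.
apply: DeriveDef; first exact: diff_derivable.
by rewrite deriveE// dE /L/= /L0 mul1r.
Qed.

(* The derivative of [p(1/t) exp(-1/t)] is again of this form, so all of these are smooth. *)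
Definition flat (p : {poly R}) t : R :=
  if 0 < t then p.[t^-1] * expR (- t^-1) else 0.

(** From exp s = (exp (s / m))^m >= (s / m)^m; the division sets the case m = 0 apart. *)
Lemma exp_decay (s : R) m : 0 < s -> s ^+ m * expR (- s) <= m%:R ^+ m.
Proof.
move=> s0; rewrite expRN ler_pdivrMr ?expR_gt0//.
case: m => [|m]; first by rewrite !expr0 mul1r ltW// expR_gt1.
have m0 : 0 < m.+1%:R :> R by rewrite ltr0n.
have -> : s = (s / m.+1%:R) * m.+1%:R by rewrite divfK// gt_eqF.
rewrite expRM_natr exprMn mulrC ler_pM2l ?exprn_gt0//.
apply: lerXn2r; rewrite ?nnegrE ?divr_ge0 ?expR_ge0 ?(ltW s0)//.
by rewrite (le_trans _ (expR_ge1Dx _))// lerDr.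
Qed.

(** A quadratic bound suffices for the derivative at the origin to exist and be 0. It comes from
    writing t^(-i) as t^(-(i + 2)) t^2 and applying [exp_decay] with s = 1 / t. *)
Lemma flat_small (p : {poly R}) : exists2 C : R, 0 <= C &
  forall t, `|flat p t| <= C * t ^+ 2.
Proof.
pose C := \sum_(i < size p) `|p`_i| * (i.+2%:R ^+ i.+2); exists C.
  by apply: sumr_ge0 => i _; rewrite mulr_ge0// exprn_ge0.
move=> t; rewrite /flat; case: ifP => [t0|_]; last first.
  by rewrite normr0 mulr_ge0 ?sqr_ge0//; apply: sumr_ge0 => i _; rewrite mulr_ge0// exprn_ge0.
rewrite horner_coef mulr_suml (le_trans (ler_norm_sum _ _ _))// /C mulr_suml.
apply: ler_sum => i _; rewrite -mulrA normrM -mulrA ler_wpM2l//.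
rewrite ger0_norm; last by rewrite mulr_ge0 ?expR_ge0// exprn_ge0// invr_ge0 ltW.
have -> : t^-1 ^+ i * expR (- t^-1) = t^-1 ^+ i.+2 * expR (- t^-1) * t ^+ 2.
  by rewrite !exprS; field; rewrite gt_eqF.
by rewrite ler_wpM2r ?sqr_ge0// exp_decay// invr_gt0.
Qed.

Lemma flat_derive (p : {poly R}) t :
  is_derive1_at t (flat p) (flat ('X^2 * (p - p^`())) t).
Proof.
have [t0|t0|->] := ltgtP t 0.
- rewrite [X in is_derive1_at _ _ X]/flat ltNge (ltW t0)/=.
  apply: (@is_derive1_near _ _ (fun=> 0)); last exact: is_derive_cst.
  near=> s; rewrite /flat ifF//; apply/negbTE; rewrite -leNgt ltW//.
  near: s; exact: lt_nbhsl.
- rewrite [X in is_derive1_at _ _ X]/flat t0.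
  apply: (@is_derive1_near _ _ (fun t => p.[t^-1] * expR (- t^-1))).
    near=> s; rewrite /flat ifT//; near: s; exact: lt_nbhsr.
  have tn0 : t != 0 by rewrite gt_eqF.
  have dV : is_derive1_at t (fun t => t^-1) (- t^-2).
    have := @is_deriveV R id t 1 1 tn0 (is_derive_id _ _).
    by rewrite /GRing.scale/= mulr1.
  have dp : is_derive1_at t (fun t => p.[t^-1]) (p^`().[t^-1] * (- t^-2)).
    by apply: (@is_derive1_comp R (horner p) (fun t => t^-1)) dV; exact: is_derive_poly.
  have de : is_derive1_at t (fun t => expR (- t^-1)) (expR (- t^-1) * (- (- t^-2))).
    exact: (@is_derive1_comp R expR (fun t => - t^-1) t _ _ (is_derive_expR _) (is_deriveN dV)).
  have := is_deriveM dp de; rewrite /GRing.scale/= => h.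
  apply: is_derive_eq h _.
  by rewrite !hornerE/= exprVn; ring.
- rewrite [X in is_derive1_at _ _ X]/flat ltxx.
  have [C C0 HC] := flat_small p.
  apply: is_derive1_approx => e e0; exists (e / (C + 1)); first by rewrite divr_gt0// ltr_wpDl.
  move=> h hs; rewrite add0r mulr0 subr0 {2}/flat ltxx subr0.
  rewrite (le_trans (HC h))// -real_normK ?num_real// expr2 mulrA ler_wpM2r//.
  rewrite ler_pdivlMr ?ltr_wpDl// in hs.
  by rewrite (le_trans _ hs)// mulrC ler_wpM2l// lerDl.
Unshelve. all: by end_near. Qed.

Lemma smooth1_flat (p : {poly R}) : smooth1 (flat p).
Proof.
apply: (smooth1_coind (P := fun h => exists p, h = flat p)); last by exists p.
move=> _ [{}p ->]; exists (flat ('X^2 * (p - p^`()))); last by eexists.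
by move=> t; exact: flat_derive.
Qed.

Lemma primitive_left0 g : continuous g -> (forall t, t <= 0 -> g t = 0) ->
  exists2 G, forall t, is_derive1_at t G (g t) & forall t, t <= 0 -> G t = 0.
Proof.
move=> cg g0; pose G x := Rintegral (@lebesgue_measure R) `[-1, x] g.
have G0 t : t <= 0 -> G t = 0.
  move=> t0; have [t1|t1] := leP (-1) t; last by rewrite /G set_itv_ge ?Rintegral_set0// bnd_simp -ltNge.
  rewrite /G (@eq_Rintegral _ _ _ _ _ (fun=> 0)).
    by rewrite Rintegral_cst//= mul0r.
  by move=> x; rewrite inE/= in_itv/= => /andP[_ xt]; apply: g0; exact: le_trans t0.
exists G => // t; have [t1|t1] := ltP (-1) t.
  have tt : t < t + 1 by rewrite ltrDl.
  have [dG GE] := continuous_FTC1_closed tt (continuous_integrable_itv _ _ cg) t1 (cg t).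
  by apply: DeriveDef; [exact: dG|rewrite -derive1E; exact: GE].
have t0 : t < 0 by lra.
rewrite g0 ?ltW//; apply: (@is_derive1_near _ _ (fun=> 0)); last exact: is_derive_cst.
by near=> s; apply: G0; apply: ltW; near: s; exact: lt_nbhsl.
Unshelve. all: by end_near. Qed.

Lemma derive_ge0_homo G g a b : (forall t, is_derive1_at t G (g t)) -> (forall t, 0 <= g t) ->
  a <= b -> G a <= G b.
Proof.
move=> dG g0 ab; have [x _ E] := MVT_closed ab (fun x _ => dG x).
by rewrite -subr_ge0 E mulr_ge0// subr_ge0.
Qed.

Lemma derive_bound_lip G g (C : R) a b : (forall t, is_derive1_at t G (g t)) ->
  (forall t, `|g t| <= C) -> `|G a - G b| <= C * `|a - b|.
Proof.
move=> dG gC; wlog ab : a b / b <= a.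
  move=> H; have [|/ltW] := leP b a; first exact: H.
  by rewrite distrC (distrC a); exact: H.
have [x _ E] := MVT_closed ab (fun x _ => dG x).
by rewrite E normrM ler_wpM2r.
Qed.

Lemma derive0_cst_right G g (c : R) : (forall t, is_derive1_at t G (g t)) ->
  (forall t, c < t -> g t = 0) -> forall t, c <= t -> G t = G c.
Proof.
move=> dG g0 t ct; have [->//|tc] := eqVneq t c.
have {}ct : c < t by rewrite lt_neqAle eq_sym tc.
have [|x] := @MVT R G g c t ct (fun x _ => dG x).
  by apply: continuous_subspaceT => x; exact: is_derive1_continuous (dG x).
by rewrite in_itv/= => /andP[cx _] /eqP; rewrite g0// mul0r subr_eq0 => /eqP.
Qed.

(** B is the normalized primitive of u(t) = e(t) e(1 - t), where e is exp(-1/t) for t > 0 and 0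
    elsewhere; u is smooth, takes values in [0, 1] and vanishes outside (0, 1). *)
Lemma smooth_step : exists B b : R -> R, [/\ smooth1 B, forall t, is_derive1_at t B (b t),
  forall t, t <= 0 -> B t = 0, forall t, 1 <= t -> B t = 1 &
  (forall t, 0 <= b t) /\ exists C, forall t, b t <= C].
Proof.
pose e := flat (1 : {poly R}).
have e0 t : t <= 0 -> e t = 0 by rewrite /e /flat leNgt => /negbTE ->.
have eP t : 0 < t -> 0 < e t by move=> t0; rewrite /e /flat t0 hornerE mul1r expR_gt0.
have ege t : 0 <= e t by have [/eP/ltW//|/e0->] := ltP 0 t.
have ele t : e t <= 1.
  have [t0|/e0->//] := ltP 0 t; rewrite /e /flat t0 hornerE mul1r -expR0 ler_expR.
  by rewrite oppr_le0 invr_ge0 ltW.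
pose u t := e t * e (t * (-1) + 1).
have su : smooth1 u by apply: smooth1M; [exact: smooth1_flat|apply: smooth1_affine; exact: smooth1_flat].
have u0 t : t <= 0 -> u t = 0 by move=> t0; rewrite /u e0// mul0r.
have u1 t : 1 <= t -> u t = 0 by move=> t0; rewrite /u (e0 (_ + 1)) ?mulr0//; lra.
have uge t : 0 <= u t by rewrite mulr_ge0.
have ule t : u t <= 1 by rewrite -[leRHS]mulr1 ler_pM.
have [G dG G0] := primitive_left0 (smooth1_continuous su) u0.
have G1 : 0 < G 1.
  have [|x] := @MVT R G u 0 1 ltr01 (fun x _ => dG x).
    by apply: continuous_subspaceT => x; exact: is_derive1_continuous (dG x).
  rewrite in_itv/= (G0 0)// !subr0 mulr1 => /andP[x0 x1] ->.
  by rewrite mulr_gt0// eP//; lra.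
exists (fun t => (G 1)^-1 * G t), (fun t => (G 1)^-1 * u t); split.
- by apply: smooth1Z; exact: smooth1_prim dG su.
- by move=> t; exact: (is_deriveZ (G 1)^-1 (dG t)).
- by move=> t t0; rewrite (G0 t)// mulr0.
- move=> t t1; rewrite (derive0_cst_right dG _ t1) ?mulVf ?gt_eqF// => s s1.
  by rewrite u1// ltW.
- split=> [t|]; first by rewrite mulr_ge0// invr_ge0 ltW.
  by exists (G 1)^-1 => t; rewrite ler_piMr// invr_ge0 ltW.
Qed.

(** The restriction of h to [0, N) repeated, instead of a sum over all translates. Smoothness across
    the multiples of N will come from h vanishing outside some [0, c] with c < N. *)
Definition periodize (N : R) h t : R := h (t - N * (Num.floor (t / N))%:~R).

Lemma periodize_at (N : R) h t (q : int) : 0 < N -> 0 <= t - N * q%:~R < N ->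
  periodize N h t = h (t - N * q%:~R).
Proof.
move=> N0 /andP[t0 tN]; rewrite /periodize (@floor_def _ _ q)//.
rewrite intrD ler_pdivlMr// ltr_pdivrMr// mulrC mulrDl mul1r [q%:~R * N]mulrC.
by apply/andP; split; lra.
Qed.

Lemma periodize_floor (N : R) h t : 0 < N -> exists q : int,
  [/\ 0 <= t - N * q%:~R, t - N * q%:~R < N & periodize N h t = h (t - N * q%:~R)].
Proof.
move=> N0; exists (Num.floor (t / N)).
have /andP[] := mem_rg1_floor (t / N).
rewrite ler_pdivlMr// ltr_pdivrMr// mulrDl mul1r [_%:~R * N]mulrC => h1 h2.
by split=> //; lra.
Qed.

Lemma periodize_periodic (N : R) h t : 0 < N -> periodize N h (t + N) = periodize N h t.
Proof.
move=> N0; have [q [q0 qN ->]] := periodize_floor h t N0.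
rewrite (@periodize_at _ _ _ (q + 1))//; first by rewrite intrD; congr h; ring.
by rewrite intrD; apply/andP; split; lra.
Qed.

Lemma periodize_id (N : R) h t : 0 <= t < N -> periodize N h t = h t.
Proof.
move=> /andP[t0 tN]; have N0 : 0 < N by apply: le_lt_trans tN.
by rewrite (@periodize_at _ _ _ 0) ?mulr0 ?subr0// t0.
Qed.

Lemma periodize_derive (N c : R) h h' t : 0 <= c < N ->
  (forall s, is_derive1_at s h (h' s)) -> (forall s, s < 0 \/ c < s -> h s = 0) ->
  is_derive1_at t (periodize N h) (periodize N h' t).
Proof.
move=> /andP[c0 cN] dh h0; have N0 : 0 < N by apply: le_lt_trans cN.
have [q [q0 qN ->]] := periodize_floor h' t N0.
apply: (@is_derive1_near _ _ (fun s => h (s + - (N * q%:~R)))); last first.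
  by apply: is_derive_shift_arg; exact: dh.
near=> s.
(* This window keeps s either in the period of t or in the gap (c, N) at the end of the previous
   one, where both formulas vanish. *)
have s1 : t - (N - c) < s by near: s; apply: lt_nbhsr; lra.
have s2 : s < t + (N - (t - N * q%:~R)) by near: s; apply: lt_nbhsl; lra.
have [sq|sq] := leP 0 (s - N * q%:~R).
  by apply: periodize_at => //; apply/andP; split; lra.
rewrite (@periodize_at _ _ _ (q - 1)) ?intrB//; last by apply/andP; split; lra.
by rewrite !h0//; [left|right; lra].
Unshelve. all: by end_near. Qed.

Lemma smooth1_periodize (N c : R) h : 0 <= c < N -> smooth1 h ->
  (forall s, s < 0 \/ c < s -> h s = 0) -> smooth1 (periodize N h).
Proof.
move=> cN sh h0; apply: (smooth1_coind (P := fun g => exists h, [/\ smooth1 h,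
  forall s, s < 0 \/ c < s -> h s = 0 & g = periodize N h])); last by exists h.
move=> _ [{sh h0}h [sh h0 ->]]; have [h' dh sh'] := smooth1_deriv sh.
exists (periodize N h'); first by move=> t; exact: periodize_derive dh h0.
exists h'; split=> // s s0; apply: (is_derive1_at_unique (dh s)).
apply: (@is_derive1_near _ _ (fun=> 0)); last exact: is_derive_cst.
case: s0 => s0; near=> u; apply: h0; [left|right]; near: u.
  exact: lt_nbhsl.
exact: lt_nbhsr.
Unshelve. all: by end_near. Qed.

(** The sum is invariant under t -> t + 1, so only t in [0, 1) matters; there every t + k lies in
    [0, N), where the periodization is h itself. *)
Lemma sum_periodize (N : nat) h (c : R) : (0 < N)%N ->
  (forall t, 0 <= t < 1 -> \sum_(k < N) h (t + k%:R) = c) ->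
  forall t, \sum_(k < N) periodize N%:R h (t + k%:R) = c.
Proof.
move=> N0 H t; have N0' : 0 < N%:R :> R by rewrite ltr0n.
pose S t := \sum_(k < N) periodize N%:R h (t + k%:R).
have S1 s : S (s + 1) = S s.
  case: N N0 {H} @S N0' => // N _ S N0'; rewrite /S big_ord_recr big_ord_recl /= addr0 addrC.
  rewrite -addrA [1 + _]addrC natr1 periodize_periodic//; congr (_ + _).
  by apply: eq_bigr => i _; rewrite -addrA nat1r.
have Sn n s : S (s + n%:R) = S s.
  by elim: n => [|n IH]; rewrite ?addr0// -natr1 addrA S1.
have Sz (z : int) s : S (s + z%:~R) = S s.
  by case: z => n; [exact: Sn|rewrite NegzE mulrNz -[LHS](Sn n.+1) subrK].
rewrite -/(S t) -[t](subrK (Num.floor t)%:~R) Sz.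
have /andP[f1 f2] := mem_rg1_floor t.
rewrite -[RHS](H (t - (Num.floor t)%:~R)); last by apply/andP; split; lra.
apply: eq_bigr => k _; apply: periodize_id.
have : (k : nat)%:R + 1 <= N%:R :> R by rewrite natr1 ler_nat.
have : 0 <= (k : nat)%:R :> R by [].
by move=> *; apply/andP; split; lra.
Qed.

(** The sums of E(t + k) and of E(t + k - M) cancel except for the first M terms of the second,
    where E = 0, and the last M terms of the first, where E = 1 because N - M >= 2 M. *)
Lemma sum_step (E : R -> R) (M N : nat) (t : R) : (3 * M <= N)%N -> 0 <= t < 1 ->
  (forall s, s <= 0 -> E s = 0) -> (forall s, (2 * M)%:R <= s -> E s = 1) ->
  \sum_(k < N) (E (t + k%:R) - E (t + k%:R - M%:R)) = M%:R.
Proof.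
move=> MN /andP[t0 t1] E0 E1; rewrite sumrB.
have [n nE] : exists n, N = (M + n)%N by exists (N - M)%N; lia.
have -> : \sum_(k < N) E (t + k%:R - M%:R) = \sum_(k < n) E (t + k%:R).
  rewrite nE big_split_ord/= big1 ?add0r => [|k _].
    by apply: eq_bigr => k _; rewrite natrD; congr E; ring.
  apply: E0; have : (k : nat)%:R + 1 <= M%:R :> R by rewrite natr1 ler_nat.
  by move=> *; lra.
have -> : \sum_(k < N) E (t + k%:R) = \sum_(k < n) E (t + k%:R) + M%:R.
  rewrite nE addnC big_split_ord/=; congr (_ + _).
  rewrite (eq_bigr (fun=> 1)) ?sumr_const ?card_ord// => k _.
  apply: E1; rewrite natrD; have : (2 * M)%:R <= n%:R :> R by rewrite ler_nat; lia.
  have : 0 <= (k : nat)%:R :> R by [].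
  by move=> *; lra.
by rewrite addrAC subrr add0r.
Qed.

End SmoothReal.

Section Kernel.
Context {R : realType}.

(** The scaling of a density of width M for the normalized mean over a period N: height N / M,
    Lipschitz constant of order N / M^2. The sum over unit translates is exact, which later gives a
    partition of unity on the lattice. *)
Record is_kernel1 (C : R) (M N : nat) (g : R -> R) : Prop := IsKernel1 {
  kernel1_smooth : smooth1 g ;
  kernel1_periodic : forall t, g (t + N%:R) = g t ;
  kernel1_bound : forall t, 0 <= g t <= N%:R / M%:R ;
  kernel1_supp : forall t, 0 <= t <= N%:R -> (3 * M)%:R <= t -> g t = 0 ;
  kernel1_sum : forall t, \sum_(k < N) g (t + k%:R) = N%:R ;
  kernel1_lip : forall t s, `|g t - g s| <= C * N%:R / M%:R ^+ 2 * `|t - s| }.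

(** Both kernels needed have the form (N / M)(E(t) - E(t - M)) for a step E rising from 0 to 1 on
    [0, 2M], so that the sum over unit translates telescopes by [sum_step]. *)
Lemma is_kernel1_periodize (C : R) (M N : nat) (g g' E : R -> R) :
  (0 < M)%N -> (3 * M < N)%N -> smooth1 g -> (forall t, is_derive1_at t g (g' t)) ->
  (forall t, t <= 0 -> E t = 0) -> (forall t, (2 * M)%:R <= t -> E t = 1) ->
  (forall t, 0 <= E t - E (t - M%:R) <= 1) ->
  (forall t, g t = N%:R / M%:R * (E t - E (t - M%:R))) ->
  (forall t, `|g' t| <= C * N%:R / M%:R ^+ 2) ->
  is_kernel1 C M N (periodize N%:R g).
Proof.
move=> M0 MN sg dg E0 E1 E01 gE gC.
have N0 : (0 < N)%N by lia.
have N0' : 0 < N%:R :> R by rewrite ltr0n.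
have M0' : 0 < M%:R :> R by rewrite ltr0n.
have MN' : (3 * M)%:R < N%:R :> R by rewrite ltr_nat.
have g0 t : t <= 0 \/ (3 * M)%:R <= t -> g t = 0.
  rewrite gE => -[t0|t0]; first by rewrite !E0 ?subrr ?mulr0//; lra.
  have : (3 * M)%:R = (2 * M)%:R + M%:R :> R by rewrite -natrD; congr _%:R; lia.
  have : (2 * M)%:R <= (3 * M)%:R :> R by rewrite ler_nat; lia.
  by move=> *; rewrite !E1 ?subrr ?mulr0//; lra.
have g0' t : t < 0 \/ (3 * M)%:R < t -> g t = 0.
  by move=> [/ltW t0|/ltW t0]; apply: g0; [left|right].
have cN : (0 <= ((3 * M)%:R : R)) && (((3 * M)%:R : R) < N%:R) by rewrite MN' ler0n.
split.
- exact: smooth1_periodize cN sg g0'.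
- by move=> t; exact: periodize_periodic.
- move=> t; rewrite /periodize gE; have /andP[e0 e1] := E01 (t - N%:R * (Num.floor (t / N%:R))%:~R).
  have NM0 : 0 <= N%:R / M%:R :> R by exact: divr_ge0.
  by rewrite mulr_ge0//= ler_piMr.
- move=> t /andP[t0 tN] Mt; have [tN'|Nt] := ltP t N%:R.
    by rewrite periodize_id ?t0// g0//; right.
  have -> : t = 0 + N%:R by lra.
  by rewrite periodize_periodic// periodize_id ?lexx// g0//; left.
- apply: sum_periodize => // t t01; under eq_bigr do rewrite gE.
  by rewrite -mulr_sumr sum_step// ?divfK ?gt_eqF// ltnW.
- move=> t s; apply: (@derive_bound_lip _ _ (periodize N%:R g')) => [u|u].
    exact: periodize_derive cN dg g0'.
  exact: gC.
Qed.

(* H is the N-periodization of N/M times the second difference with step M of the primitive of a smooth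
   step, and K that of the corresponding first difference. *)
Lemma kernel1_exists : exists2 C : R, 0 < C & forall M N : nat,
  (0 < M)%N -> (3 * M < N)%N -> exists H K : R -> R,
  [/\ is_kernel1 C M N H, is_kernel1 C M N K &
    forall t, is_derive1_at t H (M%:R^-1 * (K t - K (t - M%:R)))].
Proof.
have [B [b [sB dB B0 B1 [b0 [C0 bC]]]]] := @smooth_step R.
have C00 : 0 <= C0 := le_trans (b0 0) (bC 0).
have Bh s t : s <= t -> B s <= B t by exact: derive_ge0_homo dB b0.
have Bge t : 0 <= B t.
  have [t0|t0] := leP t 0; first by rewrite B0.
  by rewrite -(B0 0)// Bh// ltW.
have Ble t : B t <= 1.
  have [t0|t0] := leP t 1; first by rewrite -(B1 1)// Bh.
  by rewrite B1// ltW.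
have [P dP P0] := primitive_left0 (smooth1_continuous sB) B0.
have sP : smooth1 P by exact: smooth1_prim dP sB.
(* Beyond 1 the primitive P has slope 1, hence P(t / M) - P(t / M - 1) equals 1 from t = 2M on. *)
have P1 t : 1 <= t -> P t - t = P 1 - 1.
  apply: (@derive0_cst_right _ (fun t => P t - t) (fun t => B t - 1)) => s.
    exact: (is_deriveB (dP s) (is_derive_id s 1)).
  by move=> s1; rewrite B1 ?subrr// ltW.
exists (C0 + 1); first by rewrite ltr_wpDl.
move=> M N M0 MN; have M0' : 0 < M%:R :> R by rewrite ltr0n.
have NM0 : 0 <= N%:R / M%:R :> R by exact: divr_ge0.
have NM1 : N%:R / M%:R ^+ 2 = M%:R^-1 * (N%:R / M%:R) :> R by field; rewrite gt_eqF.
pose w := M%:R^-1 : R; have w0 : 0 < w by rewrite invr_gt0.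
have wM : M%:R * w = 1 by rewrite mulfV// gt_eqF.
pose F t := B (t * w + 0).
pose k t := N%:R / M%:R * (B (t * w + 0) - B (t * w + -1)).
pose E t := P (t * w + 0) - P (t * w + -1).
pose h t := N%:R / M%:R * (E t - E (t * 1 + - M%:R)).
have dE t : is_derive1_at t E (w * (B (t * w + 0) - B (t * w + -1))).
  rewrite mulrC mulrBl; apply: is_deriveB; apply: is_derive_affine_arg; exact: dP.
have Ege t : 0 <= w * (B (t * w + 0) - B (t * w + -1)).
  by rewrite mulr_ge0 ?(ltW w0)// subr_ge0 Bh//; lra.
have Eh s t : s <= t -> E s <= E t by exact: derive_ge0_homo dE Ege.
have E0 t : t <= 0 -> E t = 0.
  move=> t0; have : t * w <= 0 by rewrite mulr_le0_ge0// ltW.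
  by move=> ?; rewrite /E !P0 ?subrr//; lra.
have tw t : (2 * M)%:R <= t -> 2 <= t * w.
  move=> t2; have := ler_wpM2r (ltW w0) t2.
  by rewrite natrM -mulrA wM mulr1.
have E1 t : (2 * M)%:R <= t -> E t = 1.
  move=> /tw t2; have h1 := P1 (t * w + 0); have h2 := P1 (t * w + -1).
  by rewrite /E; have := h1 ltac:(lra); have := h2 ltac:(lra); lra.
have E01 t : 0 <= E t <= 1.
  apply/andP; split.
    have [t0|t0] := leP t 0; first by rewrite E0.
    by rewrite -(E0 0)// Eh// ltW.
  have [t0|t0] := leP t (2 * M)%:R; first by rewrite -(E1 (2 * M)%:R)// Eh.
  by rewrite E1// ltW.
have sE : smooth1 E by apply: smooth1B; exact: smooth1_affine.
have sk : smooth1 k by apply: smooth1Z; apply: smooth1B; exact: smooth1_affine.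
have sh : smooth1 h by apply: smooth1Z; apply: smooth1B => //; exact: smooth1_affine.
have kE t : w * k t = N%:R / M%:R * (w * (B (t * w + 0) - B (t * w + -1))).
  by rewrite /k mulrCA.
have dh t : is_derive1_at t h (w * (k t - k (t - M%:R))).
  have := is_deriveB (dE t) (is_derive_affine_arg (a := 1) (c := - M%:R) (dE _)).
  move=> /(is_deriveZ (N%:R / M%:R)) dd; apply: is_derive_eq dd _.
  by rewrite !mulr1 /GRing.scale/= mulrBr -!kE mulrBr.
have k01 t : 0 <= k t <= N%:R / M%:R.
  have h1 := Bh (t * w + -1) (t * w + 0) ltac:(lra).
  have h2 := Bge (t * w + -1); have h3 := Ble (t * w + 0).
  by rewrite mulr_ge0 ?subr_ge0//= ler_piMr//; lra.
have FM t : F (t - M%:R) = B (t * w + -1).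
  by rewrite /F mulrBl wM addr0.
have F0 t : t <= 0 -> F t = 0.
  by move=> t0; rewrite /F B0// addr0 mulr_le0_ge0// ltW.
have F1 t : (2 * M)%:R <= t -> F t = 1.
  by move=> /tw t2; rewrite /F B1//; lra.
have C1 : 0 <= (C0 + 1) * N%:R / M%:R ^+ 2 by rewrite !mulr_ge0 ?invr_ge0 ?addr_ge0.
exists (periodize N%:R h), (periodize N%:R k); split.
- apply: (is_kernel1_periodize (E := E)) dh _ _ _ _ _ => //.
  + move=> t; have /andP[? ?] := E01 t; have /andP[? ?] := E01 (t - M%:R).
    by have := Eh (t - M%:R) t ltac:(lra); move=> ?; apply/andP; split; lra.
  + by move=> t; rewrite /h mulr1.
  + move=> t; rewrite normrM ger0_norm ?(ltW w0)// -mulrA NM1.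
    have kk : `|k t - k (t - M%:R)| <= N%:R / M%:R.
      have := k01 t; have := k01 (t - M%:R).
      by rewrite ler_norml => /andP[? ?] /andP[? ?]; apply/andP; split; lra.
    rewrite (@le_trans _ _ (w * (N%:R / M%:R)))//; first by rewrite ler_wpM2l// ltW.
    by rewrite ler_peMl ?mulr_ge0 ?(ltW w0)//; lra.
- apply: (is_kernel1_periodize (E := F) (g' := fun t => N%:R / M%:R * (b (t * w + 0) * w - b (t * w + -1) * w))) => //.
  + move=> t; apply: is_deriveZ; apply: is_deriveB; apply: is_derive_affine_arg; exact: dB.
  + move=> t; rewrite FM; have h1 := Bh (t * w + -1) (t * w + 0) ltac:(lra).
    have h2 := Bge (t * w + -1); have h3 := Ble (t * w + 0).
    by apply/andP; split; rewrite /F; lra.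
  + by move=> t; rewrite FM.
  + move=> t; rewrite -mulrBl normrM ger0_norm// normrM (ger0_norm (ltW w0)).
    have bb : `|b (t * w + 0) - b (t * w + -1)| <= C0 + 1.
      have := b0 (t * w + 0); have := b0 (t * w + -1).
      have := bC (t * w + 0); have := bC (t * w + -1).
      by move=> *; rewrite ler_norml; apply/andP; split; lra.
    have -> : (C0 + 1) * N%:R / M%:R ^+ 2 = N%:R / M%:R * ((C0 + 1) * w).
      by rewrite -mulrA NM1 /w; ring.
    by rewrite ler_wpM2l// ler_wpM2r// ltW.
- move=> t.
  have MN' : (3 * M)%:R < N%:R :> R by rewrite ltr_nat.
  have M3 : (3 * M)%:R = (2 * M)%:R + M%:R :> R by rewrite -natrD; congr _%:R; lia.
  have N0' : 0 < N%:R :> R by rewrite ltr0n; lia.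
  have k0 s : s <= 0 -> k s = 0.
    move=> s0; have : s * w <= 0 by rewrite mulr_le0_ge0// ltW.
    by move=> ?; rewrite /k !B0 ?subrr ?mulr0//; lra.
  have k2 s : (2 * M)%:R <= s -> k s = 0.
    by move=> /tw s2; rewrite /k !B1 ?subrr ?mulr0//; lra.
  have h0 s : s < 0 \/ (3 * M)%:R < s -> h s = 0.
    move=> [s0|s3]; first by rewrite /h !E0 ?subrr ?mulr0//; lra.
    by rewrite /h mulr1 !E1 ?subrr ?mulr0//; lra.
  have cN : (0 <= ((3 * M)%:R : R)) && (((3 * M)%:R : R) < N%:R) by rewrite MN' ler0n.
  have := @periodize_derive _ _ _ _ _ t cN dh h0.
  have [q [q0 qN ->]] := periodize_floor (fun s => w * (k s - k (s - M%:R))) t N0'.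
  move=> dd; apply: is_derive_eq dd _; congr (_ * (_ - _)).
    by rewrite (@periodize_at _ _ _ _ q)// q0.
  set r := t - _ in q0 qN *.
  (* When r < M the shift by M falls into the previous period; there the periodized k is 0 because N
     > 3M, and k (r - M) is 0 as well. *)
  have [rM|rM] := leP M%:R r.
    rewrite (@periodize_at _ _ _ _ q)//; first by congr k; rewrite /r; ring.
    by move: q0 qN rM; rewrite /r => *; apply/andP; split; lra.
  rewrite k0; last by lra.
  rewrite (@periodize_at _ _ _ _ (q - 1)) ?intrB//.
    by rewrite k2//; move: q0 qN rM; rewrite /r => *; lra.
  by move: q0 qN rM; rewrite /r => *; apply/andP; split; lra.
Qed.

End Kernel.

(** * Cauchy-Schwarz inequalities from a discriminant *)

Section QuadraticDiscriminant.
Context {R : realType}.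

(** The optimal choice is l = T / S; when S = 0, a linear function of l bounded above must vanish,
    as l = (Q + 1) / T shows. Cauchy-Schwarz, the near-orthogonality of near-minimizers and the
    eigenvector equation all reduce to this. *)
Lemma quadratic_discriminant (T Q S : R) : 0 <= S ->
  (forall l, 2 * l * T <= Q + l ^+ 2 * S) -> T ^+ 2 <= S * Q.
Proof.
move=> S0 H; have [S1|S1] := ltP 0 S.
  have := H (T / S); have -> : 2 * (T / S) * T = 2 * (T ^+ 2 / S) by field; rewrite gt_eqF.
  have -> : (T / S) ^+ 2 * S = T ^+ 2 / S by field; rewrite gt_eqF.
  by move=> h; rewrite -ler_pdivrMl// mulrC; lra.
have {S1}S0 : S = 0 by lra.
rewrite S0 mul0r; have [->|T0] := eqVneq T 0; first by rewrite expr0n.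
have := H ((Q + 1) / T); rewrite S0 mulr0 addr0.
have -> : 2 * ((Q + 1) / T) * T = 2 * (Q + 1) by field.
have := H 0; rewrite S0; lra.
Qed.

Lemma sqrD_le2 (a b : R) : (a + b) ^+ 2 <= 2 * (a ^+ 2 + b ^+ 2).
Proof. by have := sqr_ge0 (a - b); rewrite sqrrB sqrrD; lra. Qed.

Lemma sqrB_le2 (a b : R) : (a - b) ^+ 2 <= 2 * (a ^+ 2 + b ^+ 2).
Proof. by rewrite -[b ^+ 2]sqrrN; exact: sqrD_le2. Qed.

Lemma sum_sqr_CS (I : finType) (u v : I -> R) :
  (\sum_i u i * v i) ^+ 2 <= (\sum_i u i ^+ 2) * \sum_i v i ^+ 2.
Proof.
apply: quadratic_discriminant; first by apply: sumr_ge0 => i _; exact: sqr_ge0.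
move=> s; rewrite !mulr_sumr -big_split/=; apply: ler_sum => i _.
by have := sqr_ge0 (v i - s * u i); rewrite sqrrB exprMn => h; lra.
Qed.

Lemma weighted_young (c w l : R) : 2 * l * (c * w) <= `|c| * w ^+ 2 + l ^+ 2 * `|c|.
Proof.
have -> : 2 * l * (c * w) = c * (2 * l * w) by ring.
have -> : `|c| * w ^+ 2 + l ^+ 2 * `|c| = `|c| * (w ^+ 2 + l ^+ 2) by ring.
rewrite (le_trans (ler_norm _))// normrM ler_wpM2l// ler_norml.
have h1 : 0 <= (w - l) ^+ 2 := sqr_ge0 _.
have h2 : 0 <= (w + l) ^+ 2 := sqr_ge0 _.
by rewrite sqrrB in h1; rewrite sqrrD in h2; apply/andP; split; lra.
Qed.

Lemma sum_CS (I : finType) (c w : I -> R) :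
  (\sum_i c i * w i) ^+ 2 <= (\sum_i `|c i|) * \sum_i `|c i| * w i ^+ 2.
Proof.
apply: quadratic_discriminant => [|l]; first exact: sumr_ge0.
by rewrite !mulr_sumr -big_split; apply: ler_sum => i _; exact: weighted_young.
Qed.

Lemma mean_CS {d} (L : R) (c w : 'rV[R]_d -> R) : 0 < L -> buc c -> buc w ->
  (mean L (fun x => c x * w x)) ^+ 2 <=
  mean L (fun x => `|c x|) * mean L (fun x => `|c x| * w x ^+ 2).
Proof.
move=> L0 bc bw; have bn := buc_norm bc; have bw2 := buc_expr 2 bw.
apply: quadratic_discriminant => [|l]; first exact: mean_ge0.
rewrite -!meanZ//; last exact: bucM.
rewrite -meanD//; [|exact: bucM|by apply: bucM bn; exact: buc_cst].
apply: le_mean => // [||x]; last exact: weighted_young.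
- by apply: bucM (buc_cst _) _; exact: bucM.
- by apply: bucD; apply: bucM => //; exact: buc_cst.
Qed.

End QuadraticDiscriminant.

(** * Averages over lattice translates *)

Section CellAverage.
Context {R : realType} {d : nat}.
Notation pt := 'rV[R]_d.
Notation e_ k := (ms_ebasis R k).
Implicit Types (F G : pt -> R) (x y z : pt) (N : nat).

Definition lattice N (k : {ffun 'I_d -> 'I_N}) : pt := \row_i (k i : nat)%:R.

(* The lattice average turns N-periodic functions into 1-periodic ones. *)
Definition cavg N F z : R :=
  (N%:R^-1) ^+ d * \sum_(k : {ffun 'I_d -> 'I_N}) F (z + lattice k).

(** Distributivity reduces the partition of unity of a product kernel to one-dimensional sums. *)
Lemma cavg_prod N (g : 'I_d -> R -> R) z :
  cavg N (fun x => \prod_i g i (x ord0 i)) z =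
  \prod_i (N%:R^-1 * \sum_(j < N) g i (z ord0 i + (j : nat)%:R)).
Proof.
rewrite /cavg big_split/= prodr_const card_ord; congr (_ * _).
rewrite bigA_distr_bigA/=; apply: eq_bigr => k _; apply: eq_bigr => i _.
by rewrite !mxE.
Qed.

Lemma cavg_periodic N F : (0 < N)%N -> ms_periodic N%:R F -> ms_periodic 1 (cavg N F).
Proof.
case: N => // N _ pF z i; rewrite scale1r; congr (_ * _).
(* A unit shift in direction i permutes the translates cyclically; the index that wraps around is
   corrected by a full period N of F. *)
pose s (k : {ffun 'I_d -> 'I_N.+1}) := [ffun j => if j == i then ordS (k j) else k j].
have s_inj : injective s.
  move=> k k' /ffunP E; apply/ffunP => j; have := E j; rewrite !ffunE.
  by case: eqP => // _ /ordS_inj.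
rewrite [RHS](reindex_inj s_inj)/=; apply: eq_bigr => k _.
have [lt|ge] := ltnP (k i).+1 N.+1.
  congr F; apply/rowP => j; rewrite !mxE ffunE; case: (eqVneq j i) => [->|ji].
    by rewrite /= modn_small// -addrA nat1r.
  by rewrite addr0.
rewrite -[RHS](pF _ i); congr F; apply/rowP => j; rewrite !mxE ffunE.
case: (eqVneq j i) => [->|ji]; last by rewrite mulr0 !addr0.
have -> : ordS (k i) = 0%N :> nat.
  by rewrite /= (_ : (k i).+1 = N.+1) ?modnn//; apply/eqP; rewrite eqn_leq ge ltn_ord.
have kN : (k i : nat) = N by apply/eqP; rewrite eqn_leq -ltnS ltn_ord.
by rewrite kN mulr1 addr0 -addrA nat1r.
Qed.

Lemma buc_cavg N F : buc F -> buc (cavg N F).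
Proof.
by move=> bF; apply: bucM (buc_cst _) _; apply: buc_sum => k _; exact: buc_shift.
Qed.

(** A 1-periodic function has the same mean over the unit cell and over the torus of size N, and
    there all N^d translates of F have the same mean. *)
Lemma mean_cavg N F : (0 < N)%N -> buc F -> ms_periodic N%:R F ->
  mean 1 (cavg N F) = mean N%:R F.
Proof.
move=> N0 bF pF; have N0' : 0 < N%:R :> R by rewrite ltr0n.
rewrite -(mean_periods N0 (buc_cavg N bF)); last exact: cavg_periodic.
have bFs k : buc (fun x => F (x + lattice (N := N) k)) by exact: buc_shift.
rewrite meanZ//; last by apply: buc_sum => k _.
rewrite mean_sum//; under eq_bigr do rewrite mean_shift//.
rewrite sumr_const card_ffun !card_ord -[X in _ * X]mulr_natl natrX mulrA -exprMn.
by rewrite mulVf ?expr1n ?mul1r// gt_eqF.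
Qed.

Lemma cavgM_periodic N F G z : ms_periodic 1 G ->
  cavg N (fun x => G x * F x) z = G z * cavg N F z.
Proof.
move=> pG; rewrite /cavg mulrCA; congr (_ * _); rewrite mulr_sumr.
apply: eq_bigr => k _; congr (_ * _).
rewrite -(periodic_lattice z (fun i => Posz (k i)) pG); congr (G (_ + _)).
Qed.

Lemma cavgD N F G z : cavg N (fun x => F x + G x) z = cavg N F z + cavg N G z.
Proof. by rewrite /cavg big_split mulrDr. Qed.

Lemma cavgZ N F (c : R) z : cavg N (fun x => c * F x) z = c * cavg N F z.
Proof. by rewrite /cavg [RHS]mulrCA; congr (_ * _); rewrite mulr_sumr. Qed.

Lemma cavgB N F G z : cavg N (fun x => F x - G x) z = cavg N F z - cavg N G z.
Proof. by rewrite /cavg sumrB mulrBr. Qed.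

Lemma cavg_sum (I : finType) N (H : I -> pt -> R) z :
  cavg N (fun x => \sum_i H i x) z = \sum_i cavg N (H i) z.
Proof. by rewrite /cavg exchange_big/= mulr_sumr. Qed.

Lemma cavg_shift N F z y : cavg N (fun x => F (x + y)) z = cavg N F (z + y).
Proof. by congr (_ * _); apply: eq_bigr => k _; rewrite addrAC. Qed.

Lemma cavg_CS N (c w : pt -> R) z : (cavg N (fun x => c x * w x) z) ^+ 2 <=
  cavg N (fun x => `|c x|) z * cavg N (fun x => `|c x| * w x ^+ 2) z.
Proof.
rewrite /cavg exprMn [leRHS]mulrACA -[X in _ <= X * _]expr2 ler_wpM2l ?sqr_ge0//.
exact: sum_CS.
Qed.

Lemma smooth_cavg N F : ms_smooth F -> ms_smooth (cavg N F).
Proof.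
by move=> sF; apply: smoothZ; apply: smooth_sum => k; exact: smooth_shift.
Qed.

Lemma pd_cavg N F i z : ms_smooth F -> pd i (cavg N F) z = cavg N (pd i F) z.
Proof.
move=> sF; rewrite pdZ; last by apply: smooth_sum => k; exact: smooth_shift.
rewrite pd_sum => [|k]; last exact: smooth_shift.
by congr (_ * _); apply: eq_bigr => k _; rewrite pd_shift.
Qed.

End CellAverage.

Lemma prod_diff_le {R : realType} (I : Type) (r : seq I) (a b : I -> R) (B e : R) :
  0 <= B -> 0 <= e -> (forall i, `|a i| <= B) -> (forall i, `|b i| <= B) ->
  (forall i, `|a i - b i| <= e * B) ->
  `|\prod_(i <- r) a i - \prod_(i <- r) b i| <= (size r)%:R * e * B ^+ size r.
Proof.
move=> B0 e0 aB bB abB; elim: r => [|i r IH].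
  by rewrite !big_nil subrr normr0 mul0r mul0r.
rewrite !big_cons.
have pB : `|\prod_(j <- r) b j| <= B ^+ size r.
  rewrite normr_prod; elim: r {IH} => [|j r IH]; first by rewrite big_nil expr0.
  by rewrite big_cons exprS ler_pM// prodr_ge0.
have -> : a i * \prod_(j <- r) a j - b i * \prod_(j <- r) b j =
  a i * (\prod_(j <- r) a j - \prod_(j <- r) b j) + (a i - b i) * \prod_(j <- r) b j by ring.
rewrite (le_trans (ler_normD _ _))// !normrM /=.
apply: (le_trans (lerD (ler_pM _ _ (aB i) IH) (ler_pM _ _ (abB i) pB))) => //.
by rewrite exprS -natr1; rewrite le_eqVlt; apply/orP; left; apply/eqP; ring.
Qed.

Lemma sum_indicator_lt {R : realType} m N : (m <= N)%N ->
  \sum_(j < N) (if (j < m)%N then 1 else 0) = m%:R :> R.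
Proof.
move=> mN; have [n ->] : exists n, N = (m + n)%N by exists (N - m)%N; lia.
rewrite big_split_ord/= [X in _ + X]big1 ?addr0 => [|j _]; last by rewrite ltnNge leq_addr.
by rewrite (eq_bigr (fun=> 1)) ?sumr_const ?card_ord// => j _; rewrite ltn_ord.
Qed.

(** * Product kernels in dimension d *)

Section ProductKernel.
Context {R : realType} {d : nat}.
Notation pt := 'rV[R]_d.
Notation e_ k := (ms_ebasis R k).

Lemma pd_coord (h h' : R -> R) (i k : 'I_d) : (forall t, is_derive1_at t h (h' t)) ->
  (forall x : pt, differentiable (fun x : pt => h (x ord0 i)) x) /\
  pd k (fun x : pt => h (x ord0 i)) = fun x => if k == i then h' (x ord0 i) else 0.
Proof.
move=> dh.
have df (x : pt) : differentiable (fun x : pt => h (x ord0 i)) x.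
  apply: (@differentiable_comp _ _ _ _ (fun x : pt => x ord0 i) h).
    exact: differentiable_coord.
  by apply/derivable1_diffP; case: (dh (x ord0 i)).
split=> //; apply/funext => x.
have := is_derive_line x (e_ k) 0 df; rewrite scale0r addr0.
rewrite (bigD1 k)//= mxE eqxx mul1r big1 ?addr0 => [|j jk]; last first.
  by rewrite mxE (negbTE jk) mul0r.
move=> /is_derive1_at_unique; apply.
case: (eqVneq k i) => [->|ki].
  rewrite (_ : (fun s => _) = fun s => h (s + x ord0 i)).
    by apply: is_derive_shift_arg; rewrite add0r.
  by apply/funext => s; rewrite !mxE eqxx mulr1 addrC.
rewrite (_ : (fun s => _) = fun s => h (x ord0 i)); first exact: is_derive_cst.
by apply/funext => s; rewrite !mxE eq_sym (negbTE ki) mulr0 addr0.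
Qed.

Lemma smooth_coord (h : R -> R) (i : 'I_d) : smooth1 h ->
  ms_smooth (fun x : pt => h (x ord0 i)).
Proof.
move=> sh; apply: (smooth_coind (P := fun f => exists2 h, smooth1 h &
  f = fun x : pt => h (x ord0 i))); last by exists h.
move=> _ [{sh}h sh ->]; have [h' dh sh'] := smooth1_deriv sh.
split=> [|k]; first by case: (pd_coord i i dh).
have [_ ->] := pd_coord i k dh; case: eqP => _; first by exists h'.
by exists (fun=> 0) => //; apply: smooth1_closureP; exact: smooth1_cst.
Qed.

Definition prodk (g : 'I_d -> R -> R) (x : pt) : R := \prod_i g i (x ord0 i).

Variables (C : R) (M N : nat) (g : 'I_d -> R -> R).
Hypotheses (C0 : 0 < C) (M0 : (0 < M)%N) (MN : (3 * M < N)%N)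
  (Hg : forall i, is_kernel1 C M N (g i)).

Let N0 : (0 < N)%N. Proof. by lia. Qed.

Lemma prodk_smooth : ms_smooth (prodk g).
Proof. by apply: smooth_prod => i; apply: smooth_coord; exact: kernel1_smooth (Hg i). Qed.

Lemma prodk_periodic : ms_periodic N%:R (prodk g).
Proof.
move=> x k; apply: eq_bigr => i _; rewrite !mxE; case: eqP => _.
  by rewrite mulr1 (kernel1_periodic (Hg i)).
by rewrite mulr0 addr0.
Qed.

Lemma prodk_ge0 x : 0 <= prodk g x.
Proof. by apply: prodr_ge0 => i _; case/andP: (kernel1_bound (Hg i) (x ord0 i)). Qed.

Lemma prodk_supp (x : pt) : (forall j, 0 <= x ord0 j <= N%:R) -> prodk g x != 0 ->
  forall j, x ord0 j <= (3 * M)%:R.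
Proof.
move=> xN nz j; rewrite leNgt; apply/negP => jM; move/negP: nz; apply.
rewrite /prodk (bigD1 j)//= (kernel1_supp (Hg j))// ?mul0r//; exact: ltW.
Qed.

Lemma cavg_prodk z : cavg N (prodk g) z = 1.
Proof.
rewrite cavg_prod big1// => i _; rewrite (kernel1_sum (Hg i)) mulVf//.
by rewrite pnatr_eq0 -lt0n.
Qed.

(** Only the (3M)^d lattice points with all k_i < 3M contribute, and the kernel has height (N /
    M)^d: the product N^(-d) (N / M)^d (3M)^d = 3^d is free of M and N. The Lipschitz bound of one
    factor supplies C / M, and d counts the factors replaced one by one. *)
Lemma prodk_lip (z z' : pt) : (forall i, 0 <= z ord0 i <= 1) -> (forall i, 0 <= z' ord0 i <= 1) ->
  N%:R^-1 ^+ d * \sum_(k : {ffun 'I_d -> 'I_N})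
    `|prodk g (z + lattice k) - prodk g (z' + lattice k)| <= d%:R * 3 ^+ d * C / M%:R.
Proof.
move=> z01 z'01; have M0' : 0 < M%:R :> R by rewrite ltr0n.
have N0' : 0 < N%:R :> R by rewrite ltr0n.
pose B : R := N%:R / M%:R; have B0 : 0 < B by exact: divr_gt0.
have gB i t : `|g i t| <= B.
  by have /andP[h1 h2] := kernel1_bound (Hg i) t; rewrite ger0_norm.
have key (k : {ffun 'I_d -> 'I_N}) : `|prodk g (z + lattice k) - prodk g (z' + lattice k)| <=
    d%:R * (C / M%:R) * B ^+ d * \prod_i (if (k i < 3 * M)%N then 1 else 0).
  case: (boolP [forall i, (k i < 3 * M)%N]) => [/forallP kM|].
    rewrite (eq_bigr (fun=> 1)) => [|i _]; last by rewrite kM.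
    rewrite big1_eq mulr1 /prodk.
    have sd : size (index_enum 'I_d) = d by rewrite -[RHS]card_ord cardT enumT.
    have := @prod_diff_le R 'I_d (index_enum 'I_d) (fun i => g i ((z + lattice k) ord0 i))
      (fun i => g i ((z' + lattice k) ord0 i)) B (C / M%:R).
    rewrite sd; apply => //; try exact: ltW.
      by rewrite divr_ge0// ltW.
    move=> i; rewrite (le_trans (kernel1_lip (Hg i) _ _))// !mxE.
    have -> : C * N%:R / M%:R ^+ 2 = C / M%:R * B by rewrite /B; field; rewrite gt_eqF.
    rewrite ler_piMr ?mulr_ge0 ?invr_ge0 ?(ltW B0) ?(ltW C0)//.
    have -> : z ord0 i + (k i)%:R - (z' ord0 i + (k i)%:R) = z ord0 i - z' ord0 i by ring.
    have := z01 i; have := z'01 i; rewrite ler_norml => /andP[? ?] /andP[? ?].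
    by apply/andP; split; lra.
  rewrite negb_forall => /existsP[i]; rewrite -leqNgt => iM.
  have zero (y : pt) : (forall i, 0 <= y ord0 i <= 1) -> prodk g (y + lattice k) = 0.
    move=> y01; rewrite /prodk (bigD1 i)//= (kernel1_supp (Hg i)) ?mul0r// !mxE.
      have /andP[h1 h2] := y01 i; have : (k i : nat)%:R + 1 <= N%:R :> R by rewrite natr1 ler_nat ltn_ord.
      have : 0 <= (k i : nat)%:R :> R by [].
      by move=> *; apply/andP; split; lra.
    have /andP[h1 h2] := y01 i; have : (3 * M)%:R <= (k i : nat)%:R :> R by rewrite ler_nat.
    by move=> *; lra.
  rewrite !zero// subrr normr0 mulr_ge0//.
    by rewrite !mulr_ge0 ?invr_ge0 ?exprn_ge0 ?(ltW B0) ?(ltW C0).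
  by apply: prodr_ge0 => j _; case: ifP.
apply: (@le_trans _ _ (N%:R^-1 ^+ d * \sum_(k : {ffun 'I_d -> 'I_N})
    d%:R * (C / M%:R) * B ^+ d * \prod_i (if (k i < 3 * M)%N then 1 else 0))).
  by rewrite ler_wpM2l ?exprn_ge0 ?invr_ge0//; apply: ler_sum.
rewrite -mulr_sumr.
have -> : \sum_(k : {ffun 'I_d -> 'I_N}) \prod_i (if (k i < 3 * M)%N then 1 else 0) =
    (3 * M)%:R ^+ d :> R.
  rewrite -(bigA_distr_bigA (fun (i : 'I_d) (j : 'I_N) => if (j < 3 * M)%N then 1 else 0))/=.
  rewrite (eq_bigr (fun=> (3 * M)%:R)) ?prodr_const ?card_ord// => i _.
  by rewrite sum_indicator_lt// ltnW.
have -> : N%:R^-1 ^+ d * (d%:R * (C / M%:R) * B ^+ d * (3 * M)%:R ^+ d) =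
   d%:R * (C / M%:R) * ((N%:R^-1 * B * (3 * M)%:R) ^+ d).
  by rewrite !exprMn; ring.
have -> : N%:R^-1 * B * (3 * M)%:R = 3 :> R.
  by rewrite /B natrM; field; rewrite !gt_eqF.
by rewrite le_eqVlt; apply/orP; left; apply/eqP; ring.
Qed.

End ProductKernel.

Section KernelExistence.
Context {R : realType} {d : nat}.
Notation pt := 'rV[R]_d.
Notation e_ k := (ms_ebasis R k).

Definition box (L : R) (x : pt) := forall j, 0 <= x ord0 j <= L.

(* A kernel of width M on the torus of size N whose unit lattice translates form a partition of unity;
   the constant C of [bump_lip] must not depend on M and N. *)
Record is_bump (C : R) (M N : nat) (g : pt -> R) : Prop := IsBump {
  bump_smooth : ms_smooth g ;
  bump_periodic : ms_periodic N%:R g ;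
  bump_ge0 : forall x, 0 <= g x ;
  bump_supp : forall x, box N%:R x -> g x != 0 -> box (3 * M)%:R x ;
  bump_cavg : forall z, cavg N g z = 1 ;
  bump_lip : forall z z', box 1 z -> box 1 z' -> N%:R^-1 ^+ d *
    \sum_(k : {ffun 'I_d -> 'I_N}) `|g (z + lattice k) - g (z' + lattice k)| <= C / M%:R }.

(** Phi is the product of the one-dimensional H over all coordinates; [K i] has K instead of H in
    the i-th factor, the only one on which the derivative in direction i acts. *)
Lemma bump_exists : exists2 C : R, 0 <= C & forall M N : nat,
  (0 < M)%N -> (3 * M < N)%N -> exists (Phi : pt -> R) (K : 'I_d -> pt -> R),
  [/\ is_bump C M N Phi, forall i, is_bump C M N (K i) &
    forall i x, pd i Phi x = M%:R^-1 * (K i x - K i (x - M%:R *: e_ i))].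
Proof.
have [C C0 HC] := @kernel1_exists R; exists (d%:R * 3 ^+ d * C).
  by rewrite mulr_ge0 ?mulr_ge0 ?exprn_ge0// ltW.
move=> M N M0 MN; have [H [K [kH kK dH]]] := HC M N M0 MN.
have bump (g : 'I_d -> R -> R) : (forall i, is_kernel1 C M N (g i)) ->
    is_bump (d%:R * 3 ^+ d * C) M N (prodk g).
  move=> kg; split.
  - exact: prodk_smooth kg.
  - exact: prodk_periodic kg.
  - exact: prodk_ge0 kg.
  - by move=> x xN nz j; rewrite (prodk_supp kg xN nz j); have /andP[->] := xN j.
  - exact: cavg_prodk kg.
  - by move=> z z' z01 z'01; exact: prodk_lip kg _ _ z01 z'01.
pose gi i (j : 'I_d) := if j == i then K else H.
exists (prodk (fun=> H)), (fun i => prodk (gi i)); split.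
- exact: bump.
- by move=> i; apply: bump => j; rewrite /gi; case: eqP.
move=> i x.
have sP : ms_smooth (prodk (fun _ : 'I_d => H)) := prodk_smooth (fun=> kH).
have := is_derive_line x (e_ i) 0 (fun z => smooth_diff z sP); rewrite scale0r addr0.
rewrite (bigD1 i)//= mxE eqxx mul1r big1 ?addr0 => [|j jk]; last first.
  by rewrite mxE (negbTE jk) mul0r.
move=> /is_derive1_at_unique; apply.
pose c := \prod_(j < d | j != i) H (x ord0 j).
have KE (y : pt) : (forall j, j != i -> y ord0 j = x ord0 j) -> prodk (gi i) y = K (y ord0 i) * c.
  move=> yx; rewrite /prodk (bigD1 i)//= /gi eqxx; congr (_ * _).
  by apply: eq_bigr => j ji; rewrite (negbTE ji) yx.
have HE s : prodk (fun=> H) (x + s *: e_ i) = H (s + x ord0 i) * c.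
  rewrite /prodk (bigD1 i)//= !mxE eqxx mulr1 addrC; congr (_ * _).
  by apply: eq_bigr => j ji; rewrite !mxE (negbTE ji) mulr0 addr0.
rewrite (_ : (fun s => _) = fun s => H (s + x ord0 i) * c); last by apply/funext.
rewrite !KE => [|j ji|//]; last by rewrite !mxE (negbTE ji) mulr0 subr0.
rewrite !mxE eqxx mulr1 -mulrBl mulrA.
have h := @is_derive_shift_arg _ H 0 (x ord0 i) (M%:R^-1 * (K (x ord0 i) - K (x ord0 i - M%:R))).
rewrite add0r in h; have := is_deriveZ c (h (dH _)).
move=> h2; rewrite (_ : (fun s => _) = c \*: (fun t => H (t + x ord0 i))).
  by apply: is_derive_eq h2 _; rewrite /GRing.scale/= mulrC.
by apply/funext => s; rewrite /= /GRing.scale/= mulrC.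
Qed.

End KernelExistence.

(** * Extreme eigenvalues and the effective quadratic form *)

Section Rayleigh.
Context {R : realType} {d : nat}.
Notation pt := 'rV[R]_d.
Implicit Types (l x u v w : pt) (A : 'M[R]_d).

Definition sqn x : R := \sum_k x ord0 k ^+ 2.

Lemma sqn_ge0 x : 0 <= sqn x.
Proof. by apply: sumr_ge0 => k _; exact: sqr_ge0. Qed.

Lemma enorm_sqr x : ms_enorm x ^+ 2 = sqn x.
Proof. by rewrite sqr_sqrtr// sqn_ge0. Qed.

Lemma sqnZ (a : R) x : sqn (a *: x) = a ^+ 2 * sqn x.
Proof. by rewrite /sqn mulr_sumr; apply: eq_bigr => k _; rewrite !mxE exprMn. Qed.

Lemma sqn0 : sqn 0 = 0.
Proof. by rewrite /sqn big1// => k _; rewrite mxE expr0n. Qed.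

Lemma sqn_gt0 x : x != 0 -> 0 < sqn x.
Proof.
move=> x0; rewrite lt_neqAle sqn_ge0 andbT eq_sym; apply: contra x0.
move=> /eqP/psumr_eq0P H; apply/eqP/rowP => k; rewrite mxE.
by apply/eqP; rewrite -sqrf_eq0; apply/eqP; apply: H => // i _; exact: sqr_ge0.
Qed.

Lemma sqn_ebasis k : sqn (ms_ebasis R k) = 1.
Proof.
rewrite /sqn (bigD1 k)//= mxE eqxx expr1n big1 ?addr0// => i ik.
by rewrite mxE (negbTE ik) expr0n.
Qed.

Definition mxform A (x y : pt) : R := (x *m A *m y^T) ord0 ord0.

Lemma mxformE A x y : mxform A x y = \sum_i \sum_j x ord0 i * A i j * y ord0 j.
Proof.
rewrite /mxform mxE exchange_big; apply: eq_bigr => j _ /=.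
by rewrite !mxE mulr_suml; apply: eq_bigr => i _.
Qed.

Lemma mxform_sym A x y : A^T = A -> mxform A x y = mxform A y x.
Proof.
move=> sA; rewrite !mxformE exchange_big; apply: eq_bigr => i _; apply: eq_bigr => j _.
by rewrite -{1}sA mxE; ring.
Qed.

Lemma mxform_line A x y (t : R) : A^T = A -> mxform A (x + t *: y) (x + t *: y) =
  mxform A x x + 2 * t * mxform A x y + t ^+ 2 * mxform A y y.
Proof.
move=> sA; rewrite /mxform linearD linearZ/= !mulmxDl !mulmxDr.
rewrite -!scalemxAl -!scalemxAr !mxE -/(mxform A x y) -/(mxform A y x).
have := mxform_sym x y sA; rewrite /mxform !mxE => ->; ring.
Qed.

Lemma mxform1 x y : mxform 1%:M x y = \sum_i x ord0 i * y ord0 i.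
Proof. by rewrite /mxform mulmx1 mxE; apply: eq_bigr => i _; rewrite mxE. Qed.

Lemma sqn_form x : sqn x = mxform 1%:M x x.
Proof. by rewrite mxform1; apply: eq_bigr => i _. Qed.

Lemma sqn_line x y (t : R) :
  sqn (x + t *: y) = sqn x + 2 * t * (\sum_i x ord0 i * y ord0 i) + t ^+ 2 * sqn y.
Proof. by rewrite !sqn_form mxform_line ?trmx1// (mxform1 x y). Qed.

Lemma mxform_continuous A : continuous (fun x => mxform A x x).
Proof.
under [X in continuous X]funext do rewrite mxformE.
have cs (I : Type) (r : seq I) (H : I -> pt -> R) : (forall i, continuous (H i)) ->
    continuous (fun x => \sum_(i <- r) H i x).
  move=> cH; elim: r => [|i r IH].
    by under [X in continuous X]funext do rewrite big_nil; exact: cst_continuous.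
  under [X in continuous X]funext do rewrite big_cons.
  by move=> x; exact: cvgD (cH i x) (IH x).
apply: (cs _ _ (fun i x => \sum_j x ord0 i * A i j * x ord0 j)) => i.
apply: (cs _ _ (fun j x => x ord0 i * A i j * x ord0 j)) => j x.
have c k : {for x, continuous (fun y : pt => y ord0 k)} := @coord_continuous R 1 d ord0 k x.
exact: cvgM (cvgM (c i) (cvg_cst _)) (c j).
Qed.

(** The minimum m of the form on the compact unit sphere is an eigenvalue: the form minus m times
    the squared norm is nonnegative and vanishes at the minimizer v, so its first variation at v is
    0 in every basis direction. *)
Lemma rayleigh_min A : A^T = A -> (0 < d)%N -> exists2 m : R, eigenvalue A m &
  forall l, m * sqn l <= mxform A l l.
Proof.
move=> sA d0; pose S : set pt := [set x | sqn x = 1].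
have cS : compact S.
  apply: bounded_closed_compact.
    exists 1; split=> // B B1 x Sx; apply: rV_norm_le => [|i]; first by lra.
    have : x ord0 i ^+ 2 <= 1.
      rewrite -Sx /sqn (bigD1 i)//= lerDl; apply: sumr_ge0 => j _; exact: sqr_ge0.
    rewrite -real_normK ?num_real// => h; apply: ltW; apply: le_lt_trans B1.
    by rewrite -(@ler_pXn2r _ 2)// ?nnegrE// expr1n.
  rewrite (_ : S = (fun x => sqn x) @^-1` [set 1])//.
  apply: preimage_closed; last exact: closed_eq.
  move=> x _; rewrite (_ : sqn = fun x => mxform 1%:M x x); first exact: mxform_continuous.
  by apply/funext => y; exact: sqn_form.
have S0 : S !=set0 by exists (ms_ebasis R (Ordinal d0)); exact: sqn_ebasis.
have [v vS vmin] := @EVT_min_rV R d (fun x => mxform A x x) S S0 cS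
  (continuous_subspaceT (@mxform_continuous A)).
rewrite inE in vS; pose m := mxform A v v.
have Hm l : m * sqn l <= mxform A l l.
  have [->|l0] := eqVneq l 0; first by rewrite sqn0 mulr0 /mxform mul0mx mul0mx mxE.
  have sl := sqn_gt0 l0; pose c := (Num.sqrt (sqn l))^-1.
  have c2 : c ^+ 2 = (sqn l)^-1 by rewrite exprVn sqr_sqrtr// ltW.
  have := vmin (c *: l); rewrite inE /S/= sqnZ c2 mulVf ?gt_eqF// => /(_ erefl).
  rewrite /m {2}/mxform linearZ/= -scalemxAl -scalemxAr -scalemxAl !mxE.
  rewrite mulrA -expr2 c2 -ler_pdivlMr// mulrC.
  by rewrite /mxform !mxE.
exists m => //; apply/eigenvalueP; exists v; last first.
  by apply: contra_eq_neq vS => ->; rewrite sqn0 eq_sym oner_eq0.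
apply/rowP => j; rewrite [RHS]mxE.
pose w := ms_ebasis R j.
have sumw (x : pt) : \sum_i x ord0 i * w ord0 i = x ord0 j.
  rewrite (bigD1 j)//= mxE eqxx mulr1 big1 ?addr0// => i ij.
  by rewrite mxE (negbTE ij) mulr0.
have vAw : mxform A v w = (v *m A) ord0 j.
  by rewrite /mxform mxE -[RHS]sumw; apply: eq_bigr => i _; rewrite [w^T _ _]mxE.
pose T := - (mxform A v w - m * v ord0 j); pose Sw := mxform A w w - m * sqn w.
suff : T ^+ 2 <= Sw * 0.
  rewrite mulr0 => h; have : T ^+ 2 == 0 by rewrite eq_le h sqr_ge0.
  by rewrite sqrf_eq0 /T oppr_eq0 subr_eq0 vAw => /eqP.
apply: quadratic_discriminant => [|t]; first by rewrite subr_ge0.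
have := Hm (v + t *: w); rewrite mxform_line// sqn_line sumw vS -/m /T /Sw.
by rewrite -subr_ge0 => h; rewrite -subr_ge0; move: h; congr (0 <= _); ring.
Qed.

Lemma eigen_form A a : eigenvalue A a -> exists2 u, 0 < sqn u & mxform A u u = a * sqn u.
Proof.
move=> /eigenvalueP[u uA u0]; exists u; first exact: sqn_gt0.
by rewrite sqn_form mxform1 /mxform uA -scalemxAl !mxE; congr (_ * _); apply: eq_bigr => i _; rewrite !mxE.
Qed.

(** The infimum is below the eigenvalue m only once the set of eigenvalues is known to be bounded
    below; the Rayleigh bound at eigenvectors shows this. *)
Lemma lambda_min_le A l : A^T = A -> (0 < d)%N -> ms_lambda_min A * sqn l <= mxform A l l.
Proof.
move=> sA d0; have [m em Hm] := rayleigh_min sA d0.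
apply: le_trans (Hm l); rewrite ler_wpM2r ?sqn_ge0//; apply: ge_inf => //.
exists m => a /= /eigen_form[u u0 uE]; have := Hm u.
by rewrite uE ler_pM2r.
Qed.

Lemma lambda_max_ge A l : A^T = A -> (0 < d)%N -> mxform A l l <= ms_lambda_max A * sqn l.
Proof.
move=> sA d0; have sNA : (- A)^T = - A by rewrite linearN/= sA.
have formN x : mxform (- A) x x = - mxform A x x.
  by rewrite /mxform mulmxN mulNmx mxE.
have [m em Hm] := rayleigh_min sNA d0.
have eN : eigenvalue A (- m).
  have /eigenvalueP[v vA v0] := em; apply/eigenvalueP; exists v => //.
  by rewrite scaleNr -vA mulmxN opprK.
have h1 : mxform A l l <= (- m) * sqn l.
  by have := Hm l; rewrite formN mulNr lerNr.
apply: le_trans h1 _; rewrite ler_wpM2r ?sqn_ge0//; apply: ub_le_sup => //.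
exists (- m) => a /= /eigen_form[u u0 uE]; have := Hm u.
by rewrite formN uE -mulNr ler_pM2r// lerNr.
Qed.

Lemma lambda_min_ge0 A : A^T = A -> (0 < d)%N -> (forall l, 0 <= mxform A l l) ->
  0 <= ms_lambda_min A.
Proof.
move=> sA d0 H; have [m em _] := rayleigh_min sA d0.
apply: lb_le_inf; first by exists m.
by move=> a /= /eigen_form[u u0 uE]; have := H u; rewrite uE pmulr_lge0.
Qed.

End Rayleigh.

Ltac buc_tac := repeat first
  [ match goal with
    | H : buc _ |- _ => simple apply H
    | H : forall _, buc _ |- _ => simple apply H
    | H : forall _ _, buc _ |- _ => simple apply H
    end
  | exact: buc_cst
  | lazymatch goal with
    | |- buc (fun x => @?F x + - @?G x) => apply: (@bucB _ _ F G)
    | |- buc (fun x => @?F x + @?G x) => apply: (@bucD _ _ F G)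
    | |- buc (fun x => @?F x * @?G x) => apply: (@bucM _ _ F G)
    | |- buc (fun x => - @?F x) => apply: (@bucN _ _ F)
    | |- buc (fun x => @?F x ^+ ?n) => apply: (@buc_expr _ _ F n)
    | |- buc (fun x => `|@?F x|) => apply: (@buc_norm _ _ F)
    | |- buc (fun x => \big[_/_]_(i <- _ | _) _) => apply: buc_sum => ? _
    end ].

(** * Energies, near-minimizers and the parallelogram law *)

Section Energy.
Context {R : realType} {d : nat}.
Notation pt := 'rV[R]_d.
Notation e_ k := (ms_ebasis R k).
Implicit Types (f h : pt -> R) (x l : pt) (L : R) (k : 'I_d) (U a : pt -> R).

Definition test L f := ms_smooth f /\ ms_periodic L f.

Definition weight U x : R := expR (- 2 * U x).

Definition field l f k x : R := l ord0 k - pd k f x.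

(** The field is jointly linear in the pair (l, f); this is the symmetric bilinear form on such
    pairs whose diagonal is [energy]. *)
Definition cross L a l f l' h : R :=
  mean L (fun x => (\sum_k field l f k x * field l' h k x) * a x).

Definition energy L a l f : R := mean L (fun x => (\sum_k field l f k x ^+ 2) * a x).

Lemma crossC L a l f l' h : cross L a l f l' h = cross L a l' h l f.
Proof.
rewrite /cross; congr mean; apply/funext => y; congr (_ * _).
by apply: eq_bigr => k _; rewrite mulrC.
Qed.

Lemma cross_energy L a l f : cross L a l f l f = energy L a l f.
Proof. by rewrite /cross /energy; congr mean. Qed.

Lemma weight_buc U : buc U -> buc (weight U).
Proof. by move=> bU; apply: buc_expR; buc_tac. Qed.

Lemma weight_gt0 U x : 0 < weight U x.
Proof. exact: expR_gt0. Qed.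

Lemma mean_weight_gt0 L U : 0 < L -> buc U -> 0 < mean L (weight U).
Proof.
move=> L0 bU; have [B B0 HB] := buc_bound bU.
apply: (@lt_le_trans _ _ (expR (- 2 * B))); first exact: expR_gt0.
rewrite -[leLHS](mean_cst (d := d) _ L0); apply: le_mean => //; first exact: buc_cst.
  exact: weight_buc.
move=> x; rewrite ler_expR ler_nM2l ?oppr_lt0//.
exact: le_trans (ler_norm _) (HB x).
Qed.

Lemma eff_qform_energy L U l : 0 < L -> ms_eff_qform L U l =
  inf [set energy L (weight U) l f / mean L (weight U) | f in test L].
Proof.
move=> L0; rewrite /ms_eff_qform; congr (inf _).
suff E f : ms_cube_int L (fun x => ms_enorm (l - ms_grad f x) ^+ 2 * expR (- 2 * U x)) /
    ms_cube_int L (fun x => expR (- 2 * U x)) = energy L (weight U) l f / mean L (weight U).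
  by apply/seteqP; split=> _ [f tf <-]; exists f.
rewrite !mean_int// invfM mulrACA mulfV ?mul1r ?gt_eqF ?exprn_gt0//.
congr (mean _ _ / _); apply/funext => x; rewrite enorm_sqr.
by congr (_ * _); apply: eq_bigr => k _; rewrite !mxE.
Qed.

Lemma test_pd_buc L f k : 0 < L -> test L f -> buc (pd k f).
Proof. by move=> L0 [sf pf]; exact: smooth_pd_buc L0 sf pf. Qed.

Lemma test_buc L f : 0 < L -> test L f -> buc f.
Proof. by move=> L0 [sf pf]; exact: smooth_buc L0 sf pf. Qed.

Lemma field_buc L l f k : 0 < L -> test L f -> buc (field l f k).
Proof. by move=> L0 tf; apply: bucB; [exact: buc_cst|exact: test_pd_buc tf]. Qed.

Lemma field_periodic L l f k : ms_periodic L f -> ms_periodic L (field l f k).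
Proof. by move=> pf x i; rewrite /field (periodic_pd _ pf). Qed.

Lemma test_cst L (c : R) : test L (fun _ : pt => c).
Proof. by split; first exact: smooth_cst. Qed.

Lemma testD L f h : test L f -> test L h -> test L (fun x => f x + h x).
Proof.
move=> [sf pf] [sh ph]; split; first exact: smoothD.
by move=> x k; rewrite pf ph.
Qed.

Lemma testZ L (c : R) f : test L f -> test L (fun x => c * f x).
Proof. by move=> [sf pf]; split; [exact: smoothZ|move=> x k; rewrite pf]. Qed.

Lemma test_sum L (I : Type) (r : seq I) (H : I -> pt -> R) : (forall i, test L (H i)) ->
  test L (fun x => \sum_(i <- r) H i x).
Proof.
move=> tH; split; first by apply: smooth_sum => i; case: (tH i).
by move=> x k; apply: eq_bigr => i _; case: (tH i) => _ ->.
Qed.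

Lemma field_lin l l' f h (s : R) k x : ms_smooth f -> ms_smooth h ->
  field (l + s *: l') (fun x => f x + s * h x) k x = field l f k x + s * field l' h k x.
Proof.
move=> sf sh; rewrite /field differentiable_pdD; last 2 first.
- exact: smooth_diff.
- by apply: smooth_diff; exact: smoothZ.
by rewrite pdZ// !mxE; ring.
Qed.

Lemma field_sum (I : finType) (c : I -> R) (l : I -> pt) (f : I -> pt -> R) k x :
  (forall i, ms_smooth (f i)) ->
  field (\sum_i c i *: l i) (fun x => \sum_i c i * f i x) k x =
  \sum_i c i * field (l i) (f i) k x.
Proof.
move=> sf; rewrite /field pd_sum => [|i]; last exact: smoothZ.
rewrite summxE -sumrB; apply: eq_bigr => i _.
by rewrite pdZ// mxE mulrBr.
Qed.

Lemma energy_ge0 L a l f : 0 < L -> buc a -> (forall x, 0 <= a x) -> test L f ->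
  0 <= energy L a l f.
Proof.
move=> L0 ba a0 tf; have bf k := field_buc l k L0 tf.
apply: mean_ge0 => //; first by buc_tac.
by move=> x; rewrite mulr_ge0//; apply: sumr_ge0 => k _; exact: sqr_ge0.
Qed.

Lemma energy_line L a l f l' h (s : R) : 0 < L -> buc a -> test L f -> test L h ->
  energy L a (l + s *: l') (fun x => f x + s * h x) =
  energy L a l f + 2 * s * cross L a l f l' h + s ^+ 2 * energy L a l' h.
Proof.
move=> L0 ba tf th; have bf k := field_buc l k L0 tf.
have bh k := field_buc l' k L0 th.
rewrite /energy /cross -!meanZ//; try by buc_tac.
rewrite -!meanD//; try by buc_tac.
congr mean; apply/funext => x.
rewrite 2!mulrA -!mulrDl; congr (_ * _); rewrite !mulr_sumr -!big_split/=.
by apply: eq_bigr => k _; rewrite field_lin; [ring|exact: tf.1|exact: th.1].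
Qed.

Lemma cross_suml L a (I : finType) (c : I -> R) (l : I -> pt) (f : I -> pt -> R) l' h :
  0 < L -> buc a -> (forall i, test L (f i)) -> test L h ->
  cross L a (\sum_i c i *: l i) (fun x => \sum_i c i * f i x) l' h =
  \sum_i c i * cross L a (l i) (f i) l' h.
Proof.
move=> L0 ba tf th; have bf i k := field_buc (l i) k L0 (tf i).
have bh k := field_buc l' k L0 th.
have bs i : buc (fun x => (\sum_k field (l i) (f i) k x * field l' h k x) * a x) by buc_tac.
have E i : c i * cross L a (l i) (f i) l' h =
    mean L (fun x => c i * ((\sum_k field (l i) (f i) k x * field l' h k x) * a x)).
  by rewrite meanZ.
rewrite (eq_bigr _ (fun i _ => E i)) {1}/cross -mean_sum//; last by move=> i; buc_tac.
congr mean; apply/funext => x; under [RHS]eq_bigr do rewrite mulrA.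
rewrite -mulr_suml; congr (_ * _).
under [RHS]eq_bigr do rewrite mulr_sumr.
rewrite exchange_big; apply: eq_bigr => k _.
rewrite field_sum => [|i]; last exact: (tf i).1.
by rewrite mulr_suml; apply: eq_bigr => i _; rewrite mulrA.
Qed.

Lemma amgm_sqr (a c t : R) : 0 <= a -> 0 <= c -> t ^+ 2 <= a * c -> - (2 * t) <= a + c.
Proof.
move=> a0 c0 h; have h1 : (2 * t) ^+ 2 <= (a + c) ^+ 2.
  by have := sqr_ge0 (a - c); rewrite sqrrB sqrrD exprMn => hh; lra.
have h0 : 0 <= a + c by rewrite addr_ge0.
have : `|2 * t| <= a + c by rewrite -(@ler_pXn2r _ 2)// ?nnegrE// real_normK ?num_real.
by rewrite ler_norml => /andP[]; lra.
Qed.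

Section QForm.
Variables (L : R) (U : pt -> R).
Hypotheses (L0 : 0 < L) (bU : buc U).
Notation q := (ms_eff_qform L U).
Notation E := (energy L (weight U)).
Notation Z := (mean L (weight U)).

Let ba : buc (weight U). Proof. exact: weight_buc. Qed.
Let a0 x : 0 <= weight U x. Proof. exact: ltW (weight_gt0 U x). Qed.
Let Z0 : 0 < Z. Proof. exact: mean_weight_gt0. Qed.

Lemma qform_inf l : has_inf [set E l f / Z | f in test L].
Proof.
split; first by exists (E l (fun=> 0) / Z), (fun=> 0) => //; exact: test_cst.
exists 0 => _ [f tf <-]; rewrite divr_ge0 ?(ltW Z0)//; exact: energy_ge0.
Qed.

Lemma qform_le l f : test L f -> Z * q l <= E l f.
Proof.
move=> tf; rewrite eff_qform_energy// mulrC -ler_pdivlMr//.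
by apply: ge_inf; [case: (qform_inf l)|exists f].
Qed.

Lemma qform_near l (e : R) : 0 < e -> exists2 f, test L f & E l f < Z * (q l + e).
Proof.
move=> e0; have [_ [f tf <-]] := inf_adherent e0 (qform_inf l).
rewrite -eff_qform_energy// => h; exists f => //.
by rewrite mulrC -ltr_pdivrMr.
Qed.

Lemma qform_ge0 l : 0 <= q l.
Proof.
rewrite eff_qform_energy//; apply: lb_le_inf; first by case: (qform_inf l).
by move=> _ [f tf <-]; rewrite divr_ge0 ?(ltW Z0)//; exact: energy_ge0.
Qed.

Lemma le_qform l (c : R) : (forall f, test L f -> Z * c <= E l f) -> c <= q l.
Proof.
move=> H; rewrite eff_qform_energy//; apply: lb_le_inf; first by case: (qform_inf l).
by move=> _ [f tf <-]; rewrite ler_pdivlMr// mulrC H.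
Qed.

Lemma qform_le_sqn l : q l <= sqn l.
Proof.
have := qform_le l (test_cst L 0); rewrite (_ : E l _ = Z * sqn l) ?ler_pM2l//.
rewrite /energy [in RHS]mulrC -meanZ//; congr mean; apply/funext => x.
by congr (_ * _); apply: eq_bigr => k _; rewrite /field pd_cst subr0.
Qed.

(* The near-minimizers of the basis vectors are nearly orthogonal to all gradients, hence their linear
   combinations are near-minimizers for every l. *)
Lemma near_minimizers (e : R) : 0 < e -> exists2 chi : 'I_d -> pt -> R,
  (forall i, test L (chi i) /\ mean L (chi i) = 0) &
  forall l, E l (fun x => \sum_i l ord0 i * chi i x) <= Z * (q l + e * sqn l).
Proof.
move=> e0; have eta0 : 0 < e / (d%:R + 1) by rewrite divr_gt0// ltr_wpDl.
set eta := e / (d%:R + 1) in eta0.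
have /choice[chi0 Hchi0] : forall i : 'I_d, exists f, test L f /\ E (e_ i) f <= Z * (q (e_ i) + eta).
  by move=> i; have [f tf /ltW h] := qform_near (e_ i) eta0; exists f.
(* Subtracting the mean changes no field and prepares the Poincare inequality. *)
pose chi i x := chi0 i x + - mean L (chi0 i).
have tchi i : test L (chi i) by apply: testD; [exact: (Hchi0 i).1|exact: test_cst].
have Echi i : E (e_ i) (chi i) <= Z * (q (e_ i) + eta).
  rewrite (_ : E _ _ = E (e_ i) (chi0 i)); first exact: (Hchi0 i).2.
  congr mean; apply/funext => x; congr (_ * _); apply: eq_bigr => k _.
  rewrite /field differentiable_pdD ?pd_cst ?addr0//.
  by apply: smooth_diff; exact: (Hchi0 i).1.1.
exists chi => [i|l].
  split=> //; rewrite meanD//; [|exact: test_buc (Hchi0 i).1|exact: buc_cst].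
  by rewrite mean_cst// subrr.
(* First variation: adding s h to [chi i] cannot bring the energy below Z q(e_i), from which it
   starts within Z eta, whatever the sign and size of s. *)
have orth i h : test L h ->
    cross L (weight U) (e_ i) (chi i) 0 h ^+ 2 <= E 0 h * (Z * eta).
  move=> th; rewrite -sqrrN; apply: quadratic_discriminant; first exact: energy_ge0.
  move=> s; have := qform_le (e_ i) (testD (tchi i) (testZ s th)).
  have := energy_line (e_ i) 0 s L0 ba (tchi i) th.
  rewrite scaler0 addr0 => -> h1; have h2 := Echi i.
  by rewrite mulrDr in h2; lra.
pose chil x := \sum_i l ord0 i * chi i x.
have tl : test L chil by apply: test_sum => i; exact: testZ.
suff key (t : R) : 0 < t -> E l chil <= Z * (q l + t) + Z * (e * sqn l).
  rewrite mulrDr; apply/ler_addgt0Pr => t t0.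
  have tZ : 0 < t / Z by exact: divr_gt0.
  have := key _ tZ; rewrite mulrDr mulrCA mulfV ?gt_eqF// mulr1 => h.
  by apply: le_trans h _; rewrite addrAC.
(* Comparison with a near-minimizer h for l itself: the cross term between chil and h - chil is
   small by near-orthogonality, up to a part absorbed by the energy of h - chil. The d contributions
   explain eta = e / (d + 1). *)
move=> t0; have [h th /ltW hE] := qform_near l t0.
pose k x := h x + (-1) * chil x.
have tk : test L k by apply: testD => //; exact: testZ.
have Ek : E l h = E l chil + 2 * cross L (weight U) l chil 0 k + E 0 k.
  have := energy_line l 0 1 L0 ba tl tk; rewrite scaler0 addr0 mulr1 expr1n mul1r => <-.
  by congr energy; apply/funext => y; rewrite mul1r /k mulN1r addrC subrK.
have Ek0 : 0 <= E 0 k by exact: energy_ge0.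
set T := cross _ _ _ _ _ _ in Ek.
have TE : T = \sum_i l ord0 i * cross L (weight U) (e_ i) (chi i) 0 k.
  by rewrite /T [in LHS](row_ebasis l) cross_suml// -row_ebasis.
have T2 : T ^+ 2 <= E 0 k * (Z * (e * sqn l)).
  rewrite TE; apply: (@le_trans _ _ (sqn l * \sum_(i < d) cross L (weight U) (e_ i) (chi i) 0 k ^+ 2)).
    exact: sum_sqr_CS.
  apply: (@le_trans _ _ (sqn l * \sum_(i < d) E 0 k * (Z * eta))).
    by rewrite ler_wpM2l ?sqn_ge0//; apply: ler_sum => i _; exact: orth.
  rewrite sumr_const card_ord -[X in _ * X]mulr_natl.
  have -> : sqn l * (d%:R * (E 0 k * (Z * eta))) = (E 0 k * Z * sqn l) * (d%:R * eta) by ring.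
  have -> : E 0 k * (Z * (e * sqn l)) = (E 0 k * Z * sqn l) * e by ring.
  rewrite ler_wpM2l//; first by rewrite mulr_ge0 ?sqn_ge0// mulr_ge0 // (ltW Z0).
  rewrite /eta mulrCA ler_piMr ?(ltW e0)// ler_pdivrMr ?mul1r ?lerDl//.
set c := Z * (e * sqn l) in T2 *.
have c0 : 0 <= c by exact: mulr_ge0 (ltW Z0) (mulr_ge0 (ltW e0) (sqn_ge0 _)).
move: Ek hE (amgm_sqr Ek0 c0 T2); rewrite mulrDr.
by move: (energy _ _ l h) (energy _ _ l chil) (energy _ _ 0 k) => u v w; lra.
Qed.

End QForm.

Lemma dist_subD (a b a' b' m : R) : `|a - b| <= m -> `|a' - b'| <= m ->
  `|a - a' - (b - b')| <= 2 * m.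
Proof.
move=> h h'; have -> : a - a' - (b - b') = (a - b) - (a' - b') by ring.
by apply: le_trans (ler_normB _ _) _; rewrite mulr2n mulrDl mul1r lerD.
Qed.

(** The matrix comes from polarization, so the infimum must be shown to be quadratic in l. The
    energy D of the linear combinations of near-minimizers is exactly quadratic and within eta |x|^2
    of q at every x; the polarized entries are then off by at most 2 eta, with eta arbitrary. *)
Lemma qform_mx L U l : 0 < L -> buc U -> mxform (ms_eff_diff L U) l l = ms_eff_qform L U l.
Proof.
move=> L0 bU; have Z0 := mean_weight_gt0 L0 bU; set q := ms_eff_qform L U.
apply/eqP; rewrite -subr_eq0 -normr_le0; apply/ler_addgt0Pr => e e0; rewrite add0r.
pose S := \sum_(i < d) \sum_(j < d) `|l ord0 i| * `|l ord0 j|.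
have S0 : 0 <= S by apply: sumr_ge0 => i _; apply: sumr_ge0 => j _; exact: mulr_ge0.
(* 2 eta S will bound the error from the matrix entries, and eta sqn l the error of D at l. *)
pose eta := e / (2 * S + sqn l + 1).
have D0 : 0 < 2 * S + sqn l + 1 by have := sqn_ge0 l; lra.
have eta0 : 0 < eta by exact: divr_gt0.
have [chi Hchi Emin] := near_minimizers L0 bU eta0.
set Z := mean L (weight U) in Z0 Emin.
have ba := weight_buc bU.
have tchi i := (Hchi i).1.
pose B i j := cross L (weight U) (e_ i) (chi i) (e_ j) (chi j) / Z.
pose D x := energy L (weight U) x (fun y => \sum_i x ord0 i * chi i y) / Z.
have DE x : D x = \sum_i \sum_j x ord0 i * x ord0 j * B i j.
  have tx : test L (fun y => \sum_i x ord0 i * chi i y) by apply: test_sum => i; exact: testZ.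
  rewrite /D -cross_energy [X in cross _ _ X _ _ _]row_ebasis cross_suml// mulr_suml.
  apply: eq_bigr => i _; rewrite crossC [X in cross _ _ X]row_ebasis cross_suml//.
  rewrite mulr_sumr mulr_suml; apply: eq_bigr => j _.
  by rewrite crossC /B; ring.
have qD x : `|q x - D x| <= eta * sqn x.
  have h1 : q x <= D x.
    rewrite ler_pdivlMr// mulrC; apply: qform_le => //.
    by apply: test_sum => i; exact: testZ.
  have h2 : D x <= q x + eta * sqn x by rewrite ler_pdivrMr// mulrC.
  by rewrite ler_norml; apply/andP; split; have := sqn_ge0 x; nra.
have DB i j : (D (e_ i + e_ j) - D (e_ i - e_ j)) / 4 = B i j.
  have Bsym i' j' : B i' j' = B j' i'.
    by rewrite /B crossC.
  have pick (s : R) : D (e_ i + s *: e_ j) = B i i + 2 * s * B i j + s ^+ 2 * B j j.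
    have tij k : test L (chi k) := tchi k.
    rewrite /D.
    have -> : (fun y => \sum_k (e_ i + s *: e_ j) ord0 k * chi k y) = fun y => chi i y + s * chi j y.
      apply/funext => y; under eq_bigr do rewrite !mxE mulrDl.
      rewrite big_split/=; congr (_ + _).
        rewrite (bigD1 i)//= eqxx mul1r big1 ?addr0// => k ki.
        by rewrite (negbTE ki) mul0r.
      rewrite (bigD1 j)//= eqxx mulr1 big1 ?addr0// => k ki.
      by rewrite (negbTE ki) mulr0 mul0r.
    rewrite energy_line//.
    by rewrite -!cross_energy /B !mulrDl !mulrA.
  have := pick 1; have := pick (-1); rewrite scaleN1r scale1r => -> ->.
  by move: (B i i) (B i j) (B j j) => u v w; clear; field.
have sq4 (i j : 'I_d) (s : R) : s ^+ 2 = 1 -> sqn (e_ i + s *: e_ j) <= 4.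
  move=> s1; rewrite sqn_line !sqn_ebasis s1 mul1r.
  have : \sum_k e_ i ord0 k * e_ j ord0 k = (i == j)%:R.
    rewrite (bigD1 i)//= !mxE eqxx mul1r big1 ?addr0 => [|k ki]; last by rewrite !mxE (negbTE ki) mul0r.
    by case: eqP.
  move=> ->; have : s <= 1.
    by have := sqr_ge0 (s - 1); rewrite sqrrB expr1n mulr1 s1; lra.
  by case: eqP => _; rewrite ?mulr1 ?mulr0; lra.
have BD i j : `|ms_eff_diff L U i j - B i j| <= 2 * eta.
  rewrite mxE -DB -mulrBl normrM [`|4^-1|]ger0_norm ?invr_ge0// ler_pdivrMr//.
  have s1 := sq4 i j 1 (expr1n _ _); rewrite scale1r in s1.
  have s2 := sq4 i j (-1) ltac:(by rewrite sqrrN expr1n); rewrite scaleN1r in s2.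
  have e1 : `|q (e_ i + e_ j) - D (e_ i + e_ j)| <= eta * 4.
    by apply: le_trans (qD _) _; rewrite ler_pM2l.
  have e2 : `|q (e_ i - e_ j) - D (e_ i - e_ j)| <= eta * 4.
    by apply: le_trans (qD _) _; rewrite ler_pM2l.
  by rewrite -mulrA; exact: dist_subD e1 e2.
have h3 : `|mxform (ms_eff_diff L U) l l - D l| <= 2 * eta * S.
  rewrite mxformE DE -sumrB (le_trans (ler_norm_sum _ _ _))// /S mulr_sumr.
  apply: ler_sum => i _; rewrite -sumrB (le_trans (ler_norm_sum _ _ _))// mulr_sumr.
  apply: ler_sum => j _.
  have -> : l ord0 i * ms_eff_diff L U i j * l ord0 j - l ord0 i * l ord0 j * B i j =
    (ms_eff_diff L U i j - B i j) * (l ord0 i * l ord0 j) by ring.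
  by rewrite normrM ler_pM// normrM.
have h4 := qD l.
rewrite (le_trans (ler_distD (D l) _ _))// (distrC (D l)).
apply: (le_trans (lerD h3 h4)).
have -> : 2 * eta * S + eta * sqn l = eta * (2 * S + sqn l) by ring.
by rewrite /eta mulrAC ler_pdivrMr// ler_pM2l//; lra.
Qed.

Lemma qformN L U l : 0 < L -> buc U -> ms_eff_qform L U (- l) = ms_eff_qform L U l.
Proof.
by move=> L0 bU; rewrite -!qform_mx// /mxform linearN/= mulNmx mulNmx mulmxN opprK.
Qed.

Lemma eff_diff_sym L U : 0 < L -> buc U -> (ms_eff_diff L U)^T = ms_eff_diff L U.
Proof.
move=> L0 bU; apply/matrixP => i j; rewrite [LHS]mxE [LHS]mxE [RHS]mxE.
have E1 : e_ j - e_ i = - (e_ i - e_ j) by rewrite opprB.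
have E2 : e_ j + e_ i = e_ i + e_ j by rewrite addrC.
by rewrite E1 E2 qformN.
Qed.

End Energy.

(** * Shift, Poincare and kernel estimates *)

Section Shifts.
Context {R : realType} {d : nat}.
Notation pt := 'rV[R]_d.
Implicit Types (f F W chi : pt -> R) (x y l : pt) (L delta : R).

Definition slow (c delta : R) W := forall x y, `|y| <= c -> `|W (x + y) - W x| <= delta.

Lemma weight_slow W delta x y : `|W (x + y) - W x| <= delta ->
  weight W x <= expR (2 * delta) * weight W (x + y).
Proof.
by move=> h; rewrite /weight -expRD ler_expR; move: h; rewrite ler_norml => /andP[]; lra.
Qed.

Lemma weight_periodic L W : ms_periodic L W -> ms_periodic L (weight W).
Proof. by move=> pW x k; rewrite /weight pW. Qed.

(** By translation invariance the shift moves from F to the weight, which changes by a factor of at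
    most exp(2 delta). *)
Lemma mean_weight_shift L W F y delta : 0 < L -> buc W -> ms_periodic L W ->
  buc F -> ms_periodic L F -> (forall x, 0 <= F x) ->
  (forall x, `|W (x + y) - W x| <= delta) ->
  mean L (fun x => F (x + y) * weight W x) <=
  expR (2 * delta) * mean L (fun x => F x * weight W x).
Proof.
move=> L0 bW pW bF pF F0 HW; have bw := weight_buc bW.
have bFw : buc (fun x => F x * weight W x) by buc_tac.
rewrite -(@mean_shift _ _ L (fun x => F x * weight W x) y)//; last first.
  by move=> x k; rewrite pF weight_periodic.
rewrite -meanZ//; last exact: (buc_shift y bFw).
apply: le_mean => //.
- by apply: bucM => //; exact: buc_shift.
- by apply: bucM (buc_cst _) _; exact: (buc_shift y bFw).
- by move=> x; rewrite mulrCA ler_wpM2l//; exact: weight_slow.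
Qed.

Lemma line_Riemann f (th : pt) y m (s eta : R) : (forall z, differentiable f z) ->
  (0 < m)%N ->
  (forall z z', `|z - z'| <= s -> `|\sum_k th ord0 k * pd k f z - \sum_k th ord0 k * pd k f z'| <= eta) ->
  `|th| <= m%:R * s ->
  `|f (y + th) - f y - m%:R^-1 * \sum_(i < m) \sum_k th ord0 k * pd k f (y + (i%:R / m%:R) *: th)| <= eta.
Proof.
move=> df m0 HG hs; have mp : 0 < m%:R :> R by rewrite ltr0n.
pose g i := f (y + (i%:R / m%:R) *: th).
have -> : f (y + th) - f y = \sum_(i < m) (g i.+1 - g i).
  by rewrite -(big_mkord xpredT (fun i => g i.+1 - g i)) telescope_sumr// /g mul0r scale0r addr0 divff ?gt_eqF// scale1r.
rewrite mulr_sumr -sumrB (le_trans (ler_norm_sum _ _ _))//.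
apply: (@le_trans _ _ (\sum_(i < m) m%:R^-1 * eta)); last first.
  by rewrite sumr_const card_ord -[leLHS]mulr_natl mulrA divff ?gt_eqF// mul1r.
apply: ler_sum => i _.
have [c /andP[c0 c1] E] := line_MVT (y + (i%:R / m%:R) *: th) (m%:R^-1 *: th) df.
have -> : g i.+1 - g i = m%:R^-1 * \sum_k th ord0 k * pd k f (y + (i%:R / m%:R) *: th + c *: (m%:R^-1 *: th)).
  rewrite mulr_sumr; under [RHS]eq_bigr do rewrite mulrA.
  rewrite /g; have -> : y + (i.+1%:R / m%:R) *: th = y + (i%:R / m%:R) *: th + m%:R^-1 *: th.
    by rewrite -addrA -scalerDl -[i.+1]addn1 natrD mulrDl mul1r.
  by rewrite E; apply: eq_bigr => k _; rewrite mxE.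
rewrite -mulrBr normrM ger0_norm ?invr_ge0 ?ler0n// ler_wpM2l ?invr_ge0 ?ler0n//.
apply: HG; rewrite addrC addKr scalerA normrZ ger0_norm ?mulr_ge0 ?invr_ge0 ?ler0n//.
rewrite -mulrA (le_trans (ler_piMl _ c1)) ?mulr_ge0 ?invr_ge0 ?ler0n//.
by rewrite mulrC ler_pdivrMr// mulrC.
Qed.

(* The increment over th is the mean of the field along the segment, and W hardly changes along it. *)
Lemma shift_energy L W f l (th : pt) delta : 0 < L -> buc W -> ms_periodic L W ->
  test L f -> slow `|th| delta W ->
  mean L (fun y => (\sum_k th ord0 k * l ord0 k - (f (y + th) - f y)) ^+ 2 * weight W y) <=
  sqn th * (expR (2 * delta) * energy L (weight W) l f).
Proof.
move=> L0 bW pW tf sl; have bw := weight_buc bW.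
have bpd k := test_pd_buc k L0 tf; have bf := test_buc L0 tf.
have bv k := field_buc l k L0 tf.
set c0 := \sum_k _; pose D y := c0 - (f (y + th) - f y).
pose G y := \sum_k th ord0 k * pd k f y.
have bG : buc G by rewrite /G; buc_tac.
have bD : buc D by apply: bucB (buc_cst _) _; apply: bucB => //; exact: buc_shift.
have Gv y : c0 - G y = \sum_k th ord0 k * field l f k y.
  by rewrite /c0 /G -sumrB; apply: eq_bigr => k _; rewrite -mulrBr.
have bv2 : buc (fun x => \sum_k field l f k x ^+ 2) by buc_tac.
have [B B0 HB] : exists2 B : R, 0 < B & forall y, `|c0 - G y| <= B.
  by apply: buc_bound; buc_tac.
set E := energy _ _ _ _; set Om := mean L (weight W).
have Om0 : 0 < Om by exact: mean_weight_gt0.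
set RHS := sqn th * _.
(* A Riemann sum of the field along the segment replaces the increment up to eta; squaring turns
   this into (2 B + 1) eta, because the sum is bounded by B and eta <= 1. *)
suff key eta : 0 < eta -> eta <= 1 ->
    mean L (fun y => D y ^+ 2 * weight W y) <= RHS + (2 * B + 1) * eta * Om.
  apply/ler_addgt0Pr => e e0.
  have K0 : 0 < (2 * B + 1) * Om by apply: mulr_gt0 => //; lra.
  have m0 : 0 < Num.min 1 (e / ((2 * B + 1) * Om)).
    by rewrite lt_min ltr01 divr_gt0.
  apply: le_trans (key _ m0 _) _; first by rewrite ge_min lexx.
  rewrite lerD2l mulrAC mulrC -ler_pdivlMr// ge_min lexx orbT//.
move=> eta0 eta1; have [s s0 Hs] := bG.2 _ eta0.
pose m := (Num.truncn (`|th| / s)).+1.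
have ms : `|th| <= m%:R * s by rewrite -ler_pdivrMr// ltW// truncnS_gt.
have mp : 0 < m%:R :> R by rewrite ltr0n.
pose v i y := c0 - G (y + (i%:R / m%:R) *: th).
pose A y := m%:R^-1 * \sum_(i < m) v i y.
have bvi i : buc (v i) by apply: bucB (buc_cst _) _; exact: buc_shift.
have bA : buc A by rewrite /A; buc_tac.
have DA y : `|D y - A y| <= eta.
  have := @line_Riemann f th y m s eta (fun z => smooth_diff z tf.1) isT Hs ms.
  rewrite -[X in `|X|]opprK normrN; congr (`|_| <= _).
  rewrite /D /A /v sumrB sumr_const card_ord -[c0 *+ m]mulr_natl mulrBr mulrA.
  rewrite mulVf ?gt_eqF// mul1r /G; move: (_ * \sum_(i < m) _) => S; ring.
have AB y : `|A y| <= B.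
  rewrite /A normrM ger0_norm ?invr_ge0 ?ler0n// mulrC ler_pdivrMr//.
  apply: le_trans (ler_norm_sum _ _ _) _.
  apply: (@le_trans _ _ (\sum_(i < m) B)); first by apply: ler_sum => i _; exact: HB.
  by rewrite sumr_const card_ord mulr_natr.
have D2 y : D y ^+ 2 <= A y ^+ 2 + (2 * B + 1) * eta.
  have := DA y; have := AB y; move: (D y) (A y) => u t ht hu.
  have h1 : `|(u - t) * (2 * t + (u - t))| <= eta * (2 * B + 1).
    rewrite normrM ler_pM// (le_trans (ler_normD _ _))// lerD// ?(le_trans hu)//.
    by rewrite normrM ger0_norm// ler_pM2l.
  have := le_trans (ler_norm _) h1; have -> : (u - t) * (2 * t + (u - t)) = u ^+ 2 - t ^+ 2 by ring.
  by lra.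
have A2 y : A y ^+ 2 <= m%:R^-1 * \sum_(i < m) v i y ^+ 2.
  have := sum_sqr_CS (fun _ : 'I_m => 1) (fun i => v i y).
  rewrite (eq_bigr (fun i : 'I_m => v i y)) => [|i _]; last by rewrite mul1r.
  rewrite expr1n sumr_const card_ord /A exprMn => h.
  apply: (@le_trans _ _ (m%:R^-1 ^+ 2 * (m%:R * \sum_(i < m) v i y ^+ 2))).
    by rewrite ler_wpM2l ?exprn_ge0 ?invr_ge0 ?ler0n.
  by rewrite expr2 -mulrA [X in _ * X]mulrA mulVf ?gt_eqF// mul1r.
have v2 i y : v i y ^+ 2 <= sqn th * \sum_k field l f k (y + (i%:R / m%:R) *: th) ^+ 2.
  by rewrite /v Gv; exact: sum_sqr_CS.
apply: (@le_trans _ _ (mean L (fun y => (m%:R^-1 * \sum_(i < m) (sqn th *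
    ((\sum_k field l f k (y + (i%:R / m%:R) *: th) ^+ 2) * weight W y)))
    + (2 * B + 1) * eta * weight W y))).
  have bsh (i : 'I_m) : buc (fun y => \sum_k field l f k (y + (i%:R / m%:R) *: th) ^+ 2).
    exact: (buc_shift _ bv2).
  apply: le_mean; [exact: L0|by buc_tac|by buc_tac|move=> y].
  apply: (@le_trans _ _ ((m%:R^-1 * (\sum_(i < m) v i y ^+ 2) + (2 * B + 1) * eta) * weight W y)).
    by rewrite ler_wpM2r ?(ltW (weight_gt0 _ _))// (le_trans (D2 y))// lerD2r.
  rewrite mulrDl lerD2r -mulrA ler_wpM2l ?invr_ge0 ?ler0n// mulr_suml.
  by apply: ler_sum => i _; rewrite mulrA ler_wpM2r ?(ltW (weight_gt0 _ _)).
have bsh (i : 'I_m) : buc (fun y => \sum_k field l f k (y + (i%:R / m%:R) *: th) ^+ 2).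
  exact: (buc_shift _ bv2).
rewrite meanD; [|exact: L0|by buc_tac|by buc_tac].
rewrite [X in _ + X <= _](meanZ _ L0 bw) lerD2r meanZ; [|exact: L0|by buc_tac].
rewrite mean_sum; [|exact: L0|by move=> i; buc_tac].
rewrite mulrC ler_pdivrMr//.
apply: (@le_trans _ _ (\sum_(i < m) RHS)); last by rewrite sumr_const card_ord mulr_natr.
apply: ler_sum => i _; rewrite meanZ; [|exact: L0|by buc_tac].
rewrite ler_wpM2l ?sqn_ge0//.
apply: (@mean_weight_shift L W (fun y => \sum_k field l f k y ^+ 2)) => //.
- by move=> x k; apply: eq_bigr => j _; rewrite (field_periodic _ _ tf.2).
- by move=> x; apply: sumr_ge0 => k _; exact: sqr_ge0.
- move=> x; apply: sl; rewrite normrZ ger0_norm ?mulr_ge0 ?invr_ge0 ?ler0n//.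
  by rewrite ler_piMl// ler_pdivrMr// mul1r ler_nat ltnW.
Qed.

(** The square of chi(y + z) - chi(y) is averaged over y and over z in the unit cell. Since chi has
    mean zero the result is twice the mean of chi^2, while [shift_energy] with W = 0 bounds it by
    |z|^2 <= d times the Dirichlet energy. *)
Lemma poincare chi : test 1 chi -> mean 1 chi = 0 ->
  mean 1 (fun x => chi x ^+ 2) <= d%:R * mean 1 (fun x => \sum_k pd k chi x ^+ 2).
Proof.
move=> tc m0; have L0 := @ltr01 R; have bc := test_buc L0 tc.
have bpd k := test_pd_buc k L0 tc.
set E := mean 1 (fun x => \sum_k pd k chi x ^+ 2).
have E0 : 0 <= E by apply: mean_ge0 => //; [buc_tac|move=> x; apply: sumr_ge0 => k _; exact: sqr_ge0].
have bc2 : buc (fun x => chi x ^+ 2) by buc_tac.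
have pc2 : ms_periodic 1 (fun x => chi x ^+ 2) by move=> x k; rewrite tc.2.
pose F (p : pt * pt) := (chi (p.2 + p.1) - chi p.2) ^+ 2.
have bF : buc F.
  apply: buc_expr; apply: bucB; last exact: (@buc_snd _ _ _ chi).
  exact: (buc_swap (buc_pair_add bc)).
have h1 : mean 1 (fun z => mean 1 (fun y => F (z, y))) <= d%:R * E.
  rewrite -(mean_cst (d := d) (d%:R * E) L0); apply: le_mean_cube => //.
  - exact: (buc_mean L0 bF).
  - exact: buc_cst.
  move=> z Hz; have := @shift_energy 1 (fun=> 0) chi 0 z 0 L0 (buc_cst _) _ tc _.
  rewrite mulr0 expR0 mul1r => H.
  apply: le_trans (_ : sqn z * E <= _); last first.
    rewrite ler_wpM2r//; apply: (@le_trans _ _ (\sum_(k < d) 1)); last by rewrite sumr_const card_ord.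
    by apply: ler_sum => k _; have /andP[z0 z1] := Hz k; rewrite -[leRHS](expr1n _ 2) ler_pXn2r ?nnegrE.
  have w1 x : weight (fun=> 0) x = 1 :> R by rewrite /weight mulr0 expR0.
  have -> : E = energy 1 (weight (fun=> 0)) 0 chi.
    congr mean; apply/funext => x; rewrite w1 mulr1; apply: eq_bigr => k _.
    by rewrite /field mxE sub0r sqrrN.
  have {}H := H ltac:(by move=> ? ?) ltac:(by move=> x y _; rewrite subrr normr0).
  apply: le_trans H; rewrite le_eqVlt; apply/orP; left; apply/eqP.
  congr mean; apply/funext => y; rewrite w1 mulr1 big1 ?sub0r ?sqrrN// => k _.
  by rewrite mxE mulr0.
rewrite mean_swap// in h1.
have h2 y : mean 1 (fun z => F (z, y)) = mean 1 (fun x => chi x ^+ 2) + chi y ^+ 2.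
  have bsh := buc_shift y bc.
  transitivity (mean 1 (fun z => chi (z + y) ^+ 2 - (2 * chi y) * chi (z + y) + chi y ^+ 2)).
    by congr mean; apply/funext => z; rewrite /F/= [y + z]addrC; ring.
  rewrite meanD//; [|by buc_tac|exact: buc_cst].
  rewrite mean_cst// meanB//; [|by buc_tac|by buc_tac].
  rewrite meanZ// (mean_shift y L0 bc tc.2) m0 mulr0 subr0.
  by rewrite (mean_shift y L0 bc2 pc2).
have E2 : mean 1 (fun y => mean 1 (fun z => F (z, y))) = mean 1 (fun x => chi x ^+ 2) + mean 1 (fun x => chi x ^+ 2).
  rewrite -[in X in _ = X + _](mean_cst (d := d) (mean 1 (fun x => chi x ^+ 2)) L0) -meanD//; last exact: buc_cst.
  by congr mean; apply/funext => y.
rewrite E2 in h1; apply: le_trans h1; rewrite lerDl.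
by apply: mean_ge0 => // x; exact: sqr_ge0.
Qed.

End Shifts.

(** * Averaging against kernels of width M *)

Section KernelEstimates.
Context {R : realType} {d : nat}.
Notation pt := 'rV[R]_d.
Notation e_ k := (ms_ebasis R k).
Implicit Types (f F G U W chi v : pt -> R) (x y z l : pt) (L delta A : R).

(** Difference quotients have mean zero by translation invariance and converge uniformly to the
    derivative. Applied to products, this is integration by parts on the torus. *)
Lemma mean_pd L f k : 0 < L -> test L f -> mean L (pd k f) = 0.
Proof.
move=> L0 tf; have bf := test_buc L0 tf; have bp := test_pd_buc k L0 tf.
apply/eqP; rewrite -normr_le0; apply/ler_addgt0Pr => e e0; rewrite add0r.
have [s s0 Hs] := smooth_uniform_diff L0 tf.1 tf.2 e0.
have bsh := buc_shift (s *: e_ k) bf.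
have n_e : `|s *: e_ k| <= s.
  apply: rV_norm_le; first exact: ltW.
  by move=> i; rewrite !mxE normrM (gtr0_norm s0); case: eqP => _; rewrite ?normr1 ?mulr1// normr0 mulr0 ltW.
have E x : `|s * pd k f x - (f (x + s *: e_ k) - f x)| <= e * s.
  have := Hs x _ n_e; rewrite (bigD1 k)//= !mxE eqxx mulr1 big1 ?addr0 => [|i ik].
    rewrite distrC => h; apply: le_trans h _; exact: (ler_wpM2l (ltW e0)).
  by rewrite !mxE (negbTE ik) mulr0 mul0r.
have := mean_dist L0 (bucM (buc_cst s) bp) (bucB bsh bf) E.
rewrite meanB// mean_shift//; last exact: tf.2.
by rewrite subrr subr0 meanZ// normrM gtr0_norm// mulrC ler_pM2r.
Qed.

Variables (C : R) (M N : nat).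
Hypotheses (M0 : (0 < M)%N) (MN : (3 * M < N)%N).

Let N0 : (0 < N)%N. Proof. by lia. Qed.
Let NR0 : 0 < N%:R :> R. Proof. by rewrite ltr0n. Qed.

Lemma bump_buc F : is_bump C M N F -> buc F.
Proof. by move=> bF; exact: smooth_buc NR0 (bump_smooth bF) (bump_periodic bF). Qed.

Lemma bump_mean F : is_bump C M N F -> mean N%:R F = 1.
Proof.
move=> bF; rewrite -(mean_cavg N0 (bump_buc bF) (bump_periodic bF)).
rewrite -[RHS](mean_cst (d := d) 1 (@ltr01 R)); congr mean.
by apply/funext => z; exact: (bump_cavg bF).
Qed.

(** After exchanging the means, each z in the support of K contributes a shift of length at most c,
    which costs exp(2 delta), and K has mean 1. The extra shift tau will be 0 or M e_k. *)
Lemma kernel_mean K F W (tau : pt) (c delta : R) : is_bump C M N K ->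
  buc F -> ms_periodic N%:R F -> (forall x, 0 <= F x) ->
  buc W -> ms_periodic N%:R W -> slow c delta W ->
  (forall z, box (3 * M)%:R z -> `|z + tau| <= c) ->
  mean N%:R (fun x => mean N%:R (fun z => K z * F (z + x + tau)) * weight W x) <=
  expR (2 * delta) * mean N%:R (fun x => F x * weight W x).
Proof.
move=> kK bF pF F0 bW pW sl Hz; have bK := bump_buc kK; have bw := weight_buc bW.
have bpair : buc (fun p : pt * pt => F (p.2 + p.1 + tau)).
  exact: (buc_swap (buc_pair_add (buc_shift tau bF))).
have bp : buc (fun p : pt * pt => K p.2 * F (p.2 + p.1 + tau) * weight W p.1).
  by apply: bucM (bucM _ bpair) _; [exact: (@buc_snd _ _ _ K)|exact: (@buc_fst _ _ _ (weight W))].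
have -> : (fun x => mean N%:R (fun z => K z * F (z + x + tau)) * weight W x) =
    fun x => mean N%:R (fun z => K z * F (z + x + tau) * weight W x).
  by apply/funext => x; rewrite meanZr//; exact: bucM bK (buc_section x bpair).
rewrite (mean_swap NR0 NR0 bp)/=; set V := expR _ * _.
have -> : V = mean N%:R (fun z => K z * V) by rewrite meanZr// bump_mean// mul1r.
apply: le_mean_cube => //; [exact: (buc_mean NR0 (buc_swap bp))|exact: bucM bK (buc_cst _)|].
move=> z zN; have [->|Kz] := eqVneq (K z) 0.
  rewrite mul0r (_ : (fun x => _) = fun=> 0) ?mean_cst//.
  by apply/funext => x; rewrite !mul0r.
have -> : (fun x => K z * F (z + x + tau) * weight W x) =
    fun x => K z * (F (x + (z + tau)) * weight W x).
  by apply/funext => x; rewrite mulrA addrA (addrC x).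
rewrite meanZ//; last exact: bucM (buc_shift (z + tau) bF) bw.
rewrite ler_wpM2l ?(bump_ge0 kK)//; apply: mean_weight_shift => // x.
exact: sl (Hz _ (bump_supp kK zN Kz)).
Qed.

Lemma kernel_energy K v W (tau : pt) (c delta : R) : is_bump C M N K ->
  buc v -> ms_periodic N%:R v -> buc W -> ms_periodic N%:R W -> slow c delta W ->
  (forall z, box (3 * M)%:R z -> `|z + tau| <= c) ->
  mean N%:R (fun x => mean N%:R (fun z => K z * v (z + x + tau)) ^+ 2 * weight W x) <=
  expR (2 * delta) * mean N%:R (fun x => v x ^+ 2 * weight W x).
Proof.
move=> kK bv pv bW pW sl Hz; have bK := bump_buc kK; have bw := weight_buc bW.
have bpair : buc (fun p : pt * pt => v (p.2 + p.1 + tau)).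
  exact: (buc_swap (buc_pair_add (buc_shift tau bv))).
have bsec x : buc (fun z => v (z + x + tau)) := buc_section x bpair.
have bKp : buc (fun p : pt * pt => K p.2) by exact: buc_snd.
have kn x : `|K x| = K x by rewrite ger0_norm// (bump_ge0 kK).
have pv2 : ms_periodic N%:R (fun x => v x ^+ 2) by move=> x k; rewrite pv.
apply: le_trans (kernel_mean kK (buc_expr 2 bv) pv2 (fun x => sqr_ge0 _) bW pW sl Hz).
apply: le_mean => //.
- exact: bucM (buc_expr 2 (buc_mean NR0 (bucM bKp bpair))) bw.
- exact: bucM (buc_mean NR0 (bucM bKp (buc_expr 2 bpair))) bw.
move=> x; rewrite ler_wpM2r ?(ltW (weight_gt0 _ _))//.
apply: le_trans (mean_CS NR0 bK (bsec x)) _.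
have -> : (fun z => `|K z|) = K by apply/funext => z; exact: kn.
rewrite bump_mean// mul1r (_ : (fun z => `|K z| * _) = fun z => K z * v (z + x + tau) ^+ 2)//.
by apply/funext => z; rewrite kn.
Qed.

(* The derivative of the kernel being a difference quotient over distance M, that of a smoothed
   function is of order 1/M. *)
Lemma pd_smoothing_bump Phi (K : pt -> R) k v x : is_bump C M N Phi -> is_bump C M N K ->
  (forall x, pd k Phi x = M%:R^-1 * (K x - K (x - M%:R *: e_ k))) ->
  test N%:R v ->
  pd k (smoothing N%:R Phi v) x =
  M%:R^-1 * (mean N%:R (fun z => K z * v (z + x + M%:R *: e_ k)) -
             mean N%:R (fun z => K z * v (z + x + 0))).
Proof.
move=> kP kK dP tv; have bP := bump_buc kP; have bK := bump_buc kK.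
have bv := test_buc NR0 tv; have bpv := test_pd_buc k NR0 tv.
have tP : test N%:R Phi := conj (bump_smooth kP) (bump_periodic kP).
have tvx : test N%:R (fun z => v (z + x)).
  by split; [exact: smooth_shift tv.1|exact: periodic_shift tv.2].
have tPv : test N%:R (fun z => Phi z * v (z + x)).
  split; first exact: smoothM tP.1 tvx.1.
  by move=> z i; rewrite tP.2 (tvx.2 z i).
have bvx := test_buc NR0 tvx; have bpvx := test_pd_buc k NR0 tvx.
have bKv : buc (fun z => K z * v (z + x + M%:R *: e_ k)).
  by apply: bucM => //; exact: (buc_shift x (buc_shift (M%:R *: e_ k) bv)).
have bKx := buc_shift (- (M%:R *: e_ k)) bK.
rewrite pd_smoothing//; [|exact: tv.1|exact: tv.2]; rewrite /smoothing.
(* Integration by parts moves the derivative from v to Phi; the translation of K is then carried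
   over to v by a change of variables. *)
have := mean_pd k NR0 tPv; rewrite (_ : pd k _ = fun z =>
    Phi z * pd k v (z + x) + M%:R^-1 * (K z * v (z + x) - K (z - M%:R *: e_ k) * v (z + x))); last first.
  apply/funext => z; rewrite differentiable_pdM; [|exact: smooth_diff tP.1|exact: smooth_diff tvx.1].
  by rewrite pd_shift dP; ring.
rewrite meanD//; last 2 first.
- by apply: bucM bP _; exact: buc_shift.
- by apply: bucM (buc_cst _) _; apply: bucB; exact: bucM.
rewrite meanZ//; last by apply: bucB; exact: bucM.
rewrite meanB//; [|exact: bucM|exact: bucM].
have -> : mean N%:R (fun z => K (z - M%:R *: e_ k) * v (z + x)) =
    mean N%:R (fun z => K z * v (z + x + M%:R *: e_ k)).
  rewrite -(@mean_shift _ _ _ (fun z => K z * v (z + x + M%:R *: e_ k)) (- (M%:R *: e_ k)))//; last first.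
    by move=> z i; rewrite (bump_periodic kK) (periodic_shift x (periodic_shift (M%:R *: e_ k) tv.2) z i).
  by congr mean; apply/funext => z; rewrite [z - _ + x]addrAC subrK.
have -> : (fun z => K z * v (z + x + 0)) = fun z => K z * v (z + x).
  by apply/funext => z; rewrite addr0.
by move=> /eqP; rewrite addr_eq0 => /eqP ->; rewrite -mulrN opprB.
Qed.

End KernelEstimates.

Section WeightSplit.
Context {R : realType} {d : nat}.
Notation pt := 'rV[R]_d.
Notation e_ k := (ms_ebasis R k).
Implicit Types (f F G U W chi v : pt -> R) (x y z l : pt) (L delta A : R).

Lemma weightD U W x : weight (fun x => U x + W x) x = weight U x * weight W x.
Proof. by rewrite /weight mulrDr expRD. Qed.

Lemma weight_ge U A x : (forall x, `|U x| <= A) -> expR (- 2 * A) <= weight U x.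
Proof. by move=> h; rewrite ler_expR ler_nM2l ?oppr_lt0// (le_trans (ler_norm _)). Qed.

Lemma weight_le U A x : (forall x, `|U x| <= A) -> weight U x <= expR (2 * A).
Proof. by move=> h; rewrite ler_expR; have := h x; rewrite ler_norml => /andP[]; lra. Qed.

Lemma mean_cell_shift N F G : (0 < N)%N -> buc F -> ms_periodic 1 F -> buc G ->
  mean 1 (fun y => mean N%:R (fun x => F (x + y) * G x)) = mean 1 F * mean N%:R G.
Proof.
move=> N0 bF pF bG; have NR0 : 0 < N%:R :> R by rewrite ltr0n.
have bp : buc (fun p : pt * pt => F (p.2 + p.1) * G p.2).
  by apply: bucM; [exact: (buc_swap (buc_pair_add bF))|exact: buc_snd].
rewrite (mean_swap (@ltr01 R) NR0 bp)/= -meanZ//; congr mean; apply/funext => x.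
have bFx := buc_shift x bF.
have -> : (fun y => F (x + y) * G x) = fun y => F (y + x) * G x.
  by apply/funext => y; rewrite addrC.
by rewrite meanZr// mean_shift.
Qed.

(** For each y in the unit cell, ZUW is the mean of weight U (x + y) times weight W (x + y).
    Freezing W at x costs exp(2 delta), and averaging over y then factorizes by
    [mean_cell_shift]. *)
Lemma weight_split N U W delta : (0 < N)%N -> buc U -> ms_periodic 1 U ->
  buc W -> ms_periodic N%:R W -> slow 1 delta W ->
  let Z := mean 1 (weight U) * mean N%:R (weight W) in
  let ZUW := mean N%:R (weight (fun x => U x + W x)) in
  Z <= expR (2 * delta) * ZUW /\ ZUW <= expR (2 * delta) * Z.
Proof.
move=> N0 bU pU bW pW sl Z ZUW; have NR0 : 0 < N%:R :> R by rewrite ltr0n.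
have bw := weight_buc bW; have ba := weight_buc bU.
have pa := weight_periodic pU; have pw := weight_periodic pW.
have paN : ms_periodic N%:R (weight U).
  by move=> x k; have := periodic_int x k N pa; rewrite -pmulrn.
have baw : buc (fun x => weight U x * weight W x) by exact: bucM.
have EZ : ZUW = mean N%:R (fun x => weight U x * weight W x).
  by congr mean; apply/funext => x; rewrite weightD.
have ZE : Z = mean 1 (fun y => mean N%:R (fun x => weight U (x + y) * weight W x)).
  by rewrite mean_cell_shift.
have bp : buc (fun p : pt * pt => weight U (p.2 + p.1) * weight W p.2).
  by apply: bucM; [exact: (buc_swap (buc_pair_add ba))|exact: buc_snd].
have bm := buc_mean NR0 bp.
have y1 y : (forall j, 0 <= y ord0 j <= 1) -> `|y| <= 1.
  by move=> h; apply: rV_norm_le => // j; have /andP[? ?] := h j; rewrite ger0_norm.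
have sh y : ZUW = mean N%:R (fun x => weight U (x + y) * weight W (x + y)).
  by rewrite EZ -(@mean_shift _ _ _ (fun x => weight U x * weight W x) y)// => x k; rewrite paN pw.
have bsh y : buc (fun x => weight U (x + y) * weight W (x + y)) by exact: (buc_shift y baw).
have bsh' y : buc (fun x => weight U (x + y) * weight W x).
  by apply: bucM => //; exact: buc_shift.
split; rewrite ZE.
- rewrite -(mean_cst (d := d) (_ * ZUW) (@ltr01 R)); apply: le_mean_cube => //; first exact: buc_cst.
  move=> y /y1 hy; rewrite (sh y) -meanZ//; apply: le_mean => //; first exact: bucM (buc_cst _) _.
  by move=> x; rewrite mulrCA ler_wpM2l ?(ltW (weight_gt0 _ _))// weight_slow// sl.
- rewrite -[leLHS](mean_cst (d := d) _ (@ltr01 R)) -meanZ//; apply: le_mean_cube => //; [exact: buc_cst|exact: bucM (buc_cst _) _|].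
  move=> y /y1 hy; rewrite (sh y) -meanZ//; apply: le_mean => //; first exact: bucM (buc_cst _) _.
  move=> x; rewrite mulrCA ler_wpM2l ?(ltW (weight_gt0 _ _))//.
  rewrite -[X in _ <= _ * weight W X](addrK y x); apply: weight_slow.
  by rewrite sl// normrN.
Qed.

(** The Poincare inequality is unweighted, so the weight is removed and restored, at a cost exp(2 A)
    each time. The 6 arises from |grad chi|^2 <= 2 |e_i|^2 + 2 |e_i - grad chi|^2, whose two squares
    have weighted means at most Z and 2 Z. *)
Lemma corrector_bound U A chi i : buc U -> (forall x, `|U x| <= A) ->
  test 1 chi -> mean 1 chi = 0 -> energy 1 (weight U) (e_ i) chi <= 2 * mean 1 (weight U) ->
  mean 1 (fun x => chi x ^+ 2 * weight U x) <=
  6 * d%:R * expR (4 * A) * mean 1 (weight U).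
Proof.
move=> bU HA tc m0 HE; have L0 := @ltr01 R.
have bc := test_buc L0 tc; have bp k := test_pd_buc k L0 tc.
have ba := weight_buc bU; have bf k := field_buc (e_ i) k L0 tc.
have b2 : buc (fun x => \sum_k pd k chi x ^+ 2) by buc_tac.
have b3 : buc (fun x => (\sum_k field (e_ i) chi k x ^+ 2) * weight U x) by buc_tac.
set Z := mean 1 (weight U) in HE *.
have e2 : 0 < expR (2 * A) by exact: expR_gt0.
have eW x : 1 <= expR (2 * A) * weight U x.
  rewrite -ler_pdivrMl// mulr1 -expRN -mulNr; exact: weight_ge.
have h1 : mean 1 (fun x => chi x ^+ 2 * weight U x) <= expR (2 * A) * mean 1 (fun x => chi x ^+ 2).
  rewrite -meanZ//; last by buc_tac.
  apply: le_mean => //; [by buc_tac|by buc_tac|move=> x].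
  by rewrite mulrC ler_wpM2r ?sqr_ge0// weight_le.
have h2 := poincare tc m0.
have h3 : mean 1 (fun x => \sum_k pd k chi x ^+ 2) <= expR (2 * A) * (6 * Z).
  apply: (@le_trans _ _ (mean 1 (fun x => expR (2 * A) * (2 * weight U x + 2 * ((\sum_k field (e_ i) chi k x ^+ 2) * weight U x))))).
    apply: le_mean => //; first by buc_tac.
    move=> x; set S := \sum_(k < d) field _ _ _ _ ^+ 2.
    have S0 : 0 <= S by apply: sumr_ge0 => k _; exact: sqr_ge0.
    apply: (@le_trans _ _ (2 * 1 + 2 * S)).
      rewrite -[X in 2 * X + _](sqn_ebasis i) /sqn /S !mulr_sumr -big_split/=; apply: ler_sum => k _.
      rewrite /field; have := sqr_ge0 (2 * e_ i ord0 k - pd k chi x).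
      by move: (e_ i ord0 k) (pd k chi x) => u w; nra.
    have -> : expR (2 * A) * (2 * weight U x + 2 * (S * weight U x)) = (2 * 1 + 2 * S) * (expR (2 * A) * weight U x) by ring.
    by rewrite ler_peMr//; lra.
  rewrite meanZ//; last by buc_tac.
  rewrite ler_pM2l// meanD//; [|by buc_tac|by buc_tac].
  rewrite !meanZ// -/(energy 1 (weight U) (e_ i) chi).
  by rewrite -/Z; lra.
apply: le_trans h1 _; apply: le_trans (ler_wpM2l (ltW e2) h2) _.
apply: le_trans (ler_wpM2l (ltW e2) (ler_wpM2l (ler0n _ _) h3)) _.
have -> : 4 * A = 2 * A + 2 * A by ring.
by rewrite expRD le_eqVlt; apply/orP; left; apply/eqP; ring.
Qed.

End WeightSplit.

(** * Upper bound for one scale *)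

Section CrudeComparison.
Context {R : realType} {d : nat}.
Notation pt := 'rV[R]_d.
Notation e_ k := (ms_ebasis R k).
Implicit Types (f U W : pt -> R) (x l : pt) (L A : R).

(** Adding U changes the numerator and the normalization of the quotient by a factor of at most
    exp(2 A) each. This handles ratios rho too small for a kernel to fit between the scales. *)
Lemma crude_le L U W A l : 0 < L -> buc U -> buc W -> (forall x, `|U x| <= A) ->
  ms_eff_qform L (fun x => U x + W x) l <= expR (4 * A) * ms_eff_qform L W l.
Proof.
move=> L0 bU bW HA; have bUW := bucD bU bW; have bw := weight_buc bW.
have ba := weight_buc bU; have baw := weight_buc bUW.
rewrite -ler_pdivrMl ?expR_gt0// -expRN; apply: le_qform => // f tf.
have bf k := field_buc l k L0 tf.
set q := ms_eff_qform _ _ _; have q0 : 0 <= q by exact: qform_ge0.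
have h1 := qform_le L0 bUW l tf; rewrite -/q in h1.
have h2 : energy L (weight (fun x => U x + W x)) l f <= expR (2 * A) * energy L (weight W) l f.
  have b2 : buc (fun x => \sum_k field l f k x ^+ 2) by buc_tac.
  rewrite -meanZ; [|exact: L0|exact: bucM].
  apply: le_mean; [exact: L0|exact: bucM|exact: bucM (buc_cst _) (bucM b2 bw)|move=> x].
  rewrite weightD [leRHS]mulrCA ler_wpM2l//; first by apply: sumr_ge0 => k _; exact: sqr_ge0.
  by rewrite ler_wpM2r ?(ltW (weight_gt0 _ _))// weight_le.
have h3 : mean L (weight W) <= expR (2 * A) * mean L (weight (fun x => U x + W x)).
  rewrite -meanZ//; apply: le_mean; [exact: L0|exact: bw|exact: bucM (buc_cst _) _|move=> x].
  rewrite weightD mulrA ler_peMl ?(ltW (weight_gt0 _ _))//.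
  by rewrite -ler_pdivrMl ?expR_gt0// mulr1 -expRN -mulNr weight_ge.
have E0 : 0 < expR (2 * A) by exact: expR_gt0.
rewrite mulrCA -ler_pdivlMl ?expR_gt0// -expRN opprK.
apply: (le_trans (ler_wpM2r q0 h3)); rewrite -mulrA.
have -> : 4 * A = 2 * A + 2 * A by ring.
by rewrite expRD -[leRHS]mulrA ler_pM2l// (le_trans h1).
Qed.

Lemma crude_ge L U W A l : 0 < L -> buc U -> buc W -> (forall x, `|U x| <= A) ->
  ms_eff_qform L W l <= expR (4 * A) * ms_eff_qform L (fun x => U x + W x) l.
Proof.
move=> L0 bU bW HA.
have := @crude_le L (fun x => - U x) (fun x => U x + W x) A l L0 (bucN bU) (bucD bU bW).
have -> : (fun x => - U x + (U x + W x)) = W by apply/funext => x; rewrite addKr.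
by apply => x; rewrite normrN.
Qed.

(** Gradients have mean zero, so by Jensen's inequality the constant field l has least energy among
    all l - grad f. *)
Lemma qform_zero_ge L l : 0 < L -> sqn l <= ms_eff_qform L (fun=> 0 : R) l.
Proof.
move=> L0; have b0 : buc (fun _ : pt => 0 : R) by exact: buc_cst.
have w1 : weight (fun=> 0 : R) = fun _ : pt => 1 :> R.
  by apply/funext => x; rewrite /weight mulr0 expR0.
apply: le_qform => // f tf; rewrite w1 mean_cst// mul1r.
have bf k := field_buc l k L0 tf.
have -> : energy L (fun=> 1) l f = \sum_k mean L (fun x => field l f k x ^+ 2).
  rewrite -mean_sum//; last by move=> k; exact: buc_expr.
  by congr mean; apply/funext => x; rewrite mulr1.
apply: ler_sum => k _.
have := @mean_CS _ d L (fun=> 1) (field l f k) L0 (buc_cst _) (bf k).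
rewrite normr1 mean_cst// mul1r.
have -> : (fun x => 1 * field l f k x) = fun x => l ord0 k - pd k f x by apply/funext => x; rewrite mul1r.
have -> : (fun x => 1 * field l f k x ^+ 2) = fun x => field l f k x ^+ 2 by apply/funext => x; rewrite mul1r.
rewrite meanB//; [|exact: buc_cst|exact: test_pd_buc tf].
by rewrite mean_cst// mean_pd// subr0.
Qed.

Lemma lambda_max_form L U l : 0 < L -> buc U -> (0 < d)%N ->
  ms_eff_qform L U l <= ms_lambda_max (ms_eff_diff L U) * sqn l.
Proof. by move=> L0 bU d0; rewrite -qform_mx//; apply: lambda_max_ge => //; exact: eff_diff_sym. Qed.

Lemma lambda_min_form L U l : 0 < L -> buc U -> (0 < d)%N ->
  ms_lambda_min (ms_eff_diff L U) * sqn l <= ms_eff_qform L U l.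
Proof. by move=> L0 bU d0; rewrite -qform_mx//; apply: lambda_min_le => //; exact: eff_diff_sym. Qed.

Lemma lambda_min_qform_ge0 L U : 0 < L -> buc U -> (0 < d)%N ->
  0 <= ms_lambda_min (ms_eff_diff L U).
Proof.
move=> L0 bU d0; apply: lambda_min_ge0 => //; first exact: eff_diff_sym.
by move=> l; rewrite qform_mx//; exact: qform_ge0.
Qed.

Lemma lambda_min_le1 L U : 0 < L -> buc U -> (0 < d)%N ->
  ms_lambda_min (ms_eff_diff L U) <= 1.
Proof.
move=> L0 bU d0; have := lambda_min_form (e_ (Ordinal d0)) L0 bU d0.
rewrite sqn_ebasis mulr1 => h; apply: (le_trans h).
by rewrite -(sqn_ebasis (Ordinal d0)); exact: qform_le_sqn.
Qed.

(** Comparison with the zero potential in one basis direction. *)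
Lemma lambda_max_lower L U A : 0 < L -> buc U -> (0 < d)%N -> (forall x, `|U x| <= A) ->
  expR (- 4 * A) <= ms_lambda_max (ms_eff_diff L U).
Proof.
move=> L0 bU d0 HA; have := lambda_max_form (e_ (Ordinal d0)) L0 bU d0.
rewrite sqn_ebasis mulr1; apply: le_trans.
have b0 : buc (fun _ : pt => 0 : R) by exact: buc_cst.
have := crude_ge (e_ (Ordinal d0)) L0 bU b0 HA.
have -> : (fun x => U x + 0) = U by apply/funext => x; rewrite addr0.
move=> h; rewrite mulNr expRN -[leLHS]mulr1 ler_pdivrMl ?expR_gt0//.
by apply: le_trans h; rewrite -(sqn_ebasis (Ordinal d0)); exact: qform_zero_ge.
Qed.

End CrudeComparison.

Section UpperStep.
Context {R : realType} {d : nat}.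
Notation pt := 'rV[R]_d.
Notation e_ k := (ms_ebasis R k).
Implicit Types (f F G U W v : pt -> R) (x y z l : pt).

Lemma field_test L l f k : test L f -> test L (field l f k).
Proof.
move=> tf; split; last exact: field_periodic tf.2.
have -> : field l f k = fun x => l ord0 k + (-1) * pd k f x.
  by apply/funext => x; rewrite mulN1r.
by apply: smoothD; [exact: smooth_cst|apply: smoothZ; exact: smooth_pd tf.1].
Qed.

Lemma sqr_sub_young (s a b : R) : 0 < s ->
  (a - b) ^+ 2 <= (1 + s) * a ^+ 2 + (1 + s^-1) * b ^+ 2.
Proof.
move=> s0; have h : 0 <= s^-1 * (s * a + b) ^+ 2 by rewrite mulr_ge0 ?invr_ge0 ?sqr_ge0// ltW.
have E : s^-1 * (s * a + b) ^+ 2 = s * a ^+ 2 + 2 * a * b + s^-1 * b ^+ 2.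
  by field; rewrite gt_eqF.
by rewrite E in h; rewrite sqrrB !mulrDl !mul1r; lra.
Qed.

Variables (C delta : R) (M N : nat) (Phi : pt -> R) (K : 'I_d -> pt -> R).
Hypotheses (M0 : (0 < M)%N) (MN : (3 * M < N)%N) (kP : is_bump C M N Phi)
  (kK : forall i, is_bump C M N (K i))
  (dP : forall i x, pd i Phi x = M%:R^-1 * (K i x - K i (x - M%:R *: e_ i))).

Let N0 : (0 < N)%N. Proof. by lia. Qed.
Let NR0 : 0 < N%:R :> R. Proof. by rewrite ltr0n. Qed.
Let MR0 : 0 < M%:R :> R. Proof. by rewrite ltr0n. Qed.
Let bP : buc Phi. Proof. exact: bump_buc MN _ kP. Qed.

Lemma smoothing_test f : test N%:R f -> test N%:R (smoothing N%:R Phi f).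
Proof.
move=> tf; split; first exact: smooth_smoothing tf.1 tf.2.
exact: smoothing_periodic tf.2.
Qed.

Lemma field_smoothing l f k : test N%:R f ->
  field l (smoothing N%:R Phi f) k = smoothing N%:R Phi (field l f k).
Proof.
move=> tf; have bp := test_pd_buc k NR0 tf; apply/funext => x.
have bpx := buc_shift x bp.
rewrite /field (pd_smoothing k NR0 bP tf.1 tf.2) /smoothing.
have -> : (fun z => Phi z * (l ord0 k - pd k f (z + x))) =
    fun z => Phi z * l ord0 k - Phi z * pd k f (z + x).
  by apply/funext => z; rewrite mulrBr.
rewrite meanB//; [|exact: bucM bP (buc_cst _)|exact: bucM bP bpx].
by rewrite meanZr// (bump_mean M0 MN kP) mul1r.
Qed.

Variables (W : pt -> R).
Hypotheses (bW : buc W) (pW : ms_periodic N%:R W) (sl : slow (4 * M)%:R delta W).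

Let bw : buc (weight W). Proof. exact: weight_buc. Qed.

Lemma box_norm (L : R) (z : pt) : 0 <= L -> box L z -> `|z| <= L.
Proof.
by move=> L0 zb; apply: rV_norm_le => // j; have /andP[? ?] := zb j; rewrite ger0_norm.
Qed.

(** Origin of the 4M in the slowness hypothesis: 3M for the support of the kernel and M for the
    translation in its derivative. *)
Lemma box_shift_norm k z : box (3 * M)%:R z -> `|z + M%:R *: e_ k| <= (4 * M)%:R.
Proof.
move=> zb; apply: le_trans (ler_normD _ _) _.
have -> : (4 * M)%N = (3 * M + M)%N by lia.
rewrite natrD; apply: lerD; first exact: box_norm (ler0n _ _) zb.
apply: rV_norm_le => [|j]; first exact: ler0n.
rewrite !mxE normrM ger0_norm//; case: eqP => _; rewrite ?normr1 ?mulr1//.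
by rewrite normr0 mulr0.
Qed.

Lemma smoothing_energy l f : test N%:R f ->
  energy N%:R (weight W) l (smoothing N%:R Phi f) <= expR (2 * delta) * energy N%:R (weight W) l f.
Proof.
move=> tf; have tS := smoothing_test tf.
have bf k := field_buc l k NR0 tf; have bS k := field_buc l k NR0 tS.
have Esum h : test N%:R h -> energy N%:R (weight W) l h =
    \sum_k mean N%:R (fun x => field l h k x ^+ 2 * weight W x).
  move=> th; have bh k := field_buc l k NR0 th.
  rewrite -mean_sum//; last by move=> k; exact: bucM (buc_expr _ _) _.
  by congr mean; apply/funext => x; rewrite mulr_suml.
rewrite !Esum// mulr_sumr; apply: ler_sum => k _.
have := @kernel_energy _ _ C M N M0 MN Phi (field l f k) W 0 (4 * M)%:R delta kP (bf k)
  (field_periodic l k tf.2) bW pW sl.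
have E x : mean N%:R (fun z => Phi z * field l f k (z + x + 0)) =
    field l (smoothing N%:R Phi f) k x.
  by rewrite field_smoothing//; congr mean; apply/funext => z; rewrite addr0.
rewrite (_ : (fun x => mean _ _ ^+ 2 * _) =
  fun x => field l (smoothing N%:R Phi f) k x ^+ 2 * weight W x); last by apply/funext => x; rewrite E.
apply => z zb; rewrite addr0; apply: le_trans (box_norm _ zb) _ => //.
by rewrite ler_nat leq_mul2r orbT.
Qed.

(** By [pd_smoothing_bump] each derivative is 1/M times the difference of two K-averages of the
    field, both controlled by [kernel_energy]. The 4 comes from (a - b)^2 <= 2 (a^2 + b^2), and d
    counts the directions of differentiation. *)
Lemma smoothing_energy_pd l f : test N%:R f ->
  mean N%:R (fun x => (\sum_k \sum_i pd k (field l (smoothing N%:R Phi f) i) x ^+ 2) * weight W x) <=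
  4 * d%:R / M%:R ^+ 2 * (expR (2 * delta) * energy N%:R (weight W) l f).
Proof.
move=> tf; have tS := smoothing_test tf.
have bf k := field_buc l k NR0 tf; have tf' i := field_test l i tf.
have bpS k i := test_pd_buc k NR0 (field_test l i tS).
pose V i := mean N%:R (fun x => field l f i x ^+ 2 * weight W x).
have EE : energy N%:R (weight W) l f = \sum_i V i.
  rewrite /V -mean_sum//; last by move=> k; exact: bucM (buc_expr _ _) _.
  by congr mean; apply/funext => x; rewrite mulr_suml.
have key k i : mean N%:R (fun x => pd k (field l (smoothing N%:R Phi f) i) x ^+ 2 * weight W x) <=
    4 / M%:R ^+ 2 * (expR (2 * delta) * V i).
  pose T tau x := mean N%:R (fun z => K k z * field l f i (z + x + tau)).
  have bT tau : buc (T tau).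
    have bK : buc (fun p : pt * pt => K k p.2).
      by apply: (@buc_snd _ _ _ (K k)); exact: bump_buc MN _ (kK k).
    exact: (buc_mean NR0 (bucM bK (buc_swap (buc_pair_add (buc_shift tau (bf i)))))).
  have HT tau : (forall z, box (3 * M)%:R z -> `|z + tau| <= (4 * M)%:R) ->
      mean N%:R (fun x => T tau x ^+ 2 * weight W x) <= expR (2 * delta) * V i.
    exact: (@kernel_energy _ _ C M N M0 MN (K k) (field l f i) W tau (4 * M)%:R delta (kK k) (bf i)
      (field_periodic l i tf.2) bW pW sl).
  have h1 := HT _ (box_shift_norm k).
  have h2 : mean N%:R (fun x => T 0 x ^+ 2 * weight W x) <= expR (2 * delta) * V i.
    apply: HT => z zb; rewrite addr0; apply: le_trans (box_norm _ zb) _ => //.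
    by rewrite ler_nat leq_mul2r orbT.
  set S1 := T (M%:R *: e_ k) in h1; set S2 := T 0 in h2.
  have b1 : buc S1 by exact: bT.
  have b2 : buc S2 by exact: bT.
  have b1' := bucM (buc_expr 2 b1) bw; have b2' := bucM (buc_expr 2 b2) bw.
  apply: (@le_trans _ _ (mean N%:R (fun x => 2 / M%:R ^+ 2 * (S1 x ^+ 2 * weight W x + S2 x ^+ 2 * weight W x)))).
    apply: le_mean => //; first exact: bucM (buc_expr _ (bpS k i)) bw.
      exact: bucM (buc_cst _) (bucD b1' b2').
    move=> x; rewrite field_smoothing// (pd_smoothing_bump M0 MN x kP (kK k) (dP k) (tf' i)).
    rewrite -/(T (M%:R *: e_ k) x) -/(T 0 x) -/S1 -/S2.
    rewrite -mulrDl [in leRHS]mulrA ler_wpM2r ?(ltW (weight_gt0 _ _))//.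
    rewrite exprMn exprVn (mulrC 2) -mulrA ler_wpM2l ?invr_ge0 ?exprn_ge0 ?ler0n//.
    exact: sqrB_le2.
  rewrite meanZ//; last exact: bucD.
  rewrite (meanD NR0 b1' b2'); have -> : 4 / M%:R ^+ 2 = 2 / M%:R ^+ 2 * 2 :> R by rewrite mulrAC -natrM.
  rewrite -[leRHS]mulrA; apply: ler_wpM2l; first by rewrite divr_ge0 ?exprn_ge0.
  by rewrite mulr2n mulrDl !mul1r; exact: lerD h1 h2.
have bp2 k i := bucM (buc_expr 2 (bpS k i)) bw.
have -> : (fun x => (\sum_k \sum_i pd k (field l (smoothing N%:R Phi f) i) x ^+ 2) * weight W x) =
    fun x => \sum_k \sum_i pd k (field l (smoothing N%:R Phi f) i) x ^+ 2 * weight W x.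
  by apply/funext => x; rewrite mulr_suml; apply: eq_bigr => k _; rewrite mulr_suml.
rewrite mean_sum//; last by move=> k; apply: buc_sum => i _; exact: bp2.
apply: (@le_trans _ _ (\sum_(k < d) (4 / M%:R ^+ 2 * (expR (2 * delta) * energy N%:R (weight W) l f)))).
  apply: ler_sum => k _; rewrite mean_sum// EE !mulr_sumr; apply: ler_sum => i _.
  by rewrite mulrA -[_ * V i]mulrA mulrA -[leRHS]mulrA; exact: key.
by rewrite sumr_const card_ord -[leLHS]mulr_natl !mulrA (mulrC d%:R).
Qed.

End UpperStep.

Section TwoScale.
Context {R : realType} {d : nat}.
Notation pt := 'rV[R]_d.
Notation e_ k := (ms_ebasis R k).
Implicit Types (f F G U W v : pt -> R) (x y z l : pt).

Lemma periodic1_nat N f : ms_periodic 1 f -> ms_periodic N%:R f.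
Proof. by move=> pf x k; have := periodic_int x k N pf; rewrite -pmulrn. Qed.

(* The two-scale competitor: a slowly varying test function plus the fast correctors weighted by its slopes. *)
Definition two_scale (chi : 'I_d -> pt -> R) y l f x : R :=
  f x + \sum_i chi i (x + y) * field l f i x.

Lemma two_scale_test N chi y l f : (0 < N)%N -> (forall i, test 1 (chi i)) ->
  test N%:R f -> test N%:R (two_scale chi y l f).
Proof.
move=> N0 tchi tf; apply: testD => //; apply: test_sum => i.
have tg := field_test l i tf; split.
  by apply: smoothM tg.1; exact: smooth_shift (tchi i).1.
by move=> x k; rewrite (periodic_shift y (periodic1_nat N (tchi i).2)) tg.2.
Qed.

(** The field of f is the sum of its components times e_i, so it merges with the terms where the
    derivative hits the correctors into fields of the correctors. What remains carries a derivative
    of the slopes and is the error. *)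
Lemma field_two_scale N chi y l f k x : (0 < N)%N -> (forall i, test 1 (chi i)) ->
  test N%:R f -> field l (two_scale chi y l f) k x =
  \sum_i field l f i x * field (e_ i) (chi i) k (x + y) -
  \sum_i chi i (x + y) * pd k (field l f i) x.
Proof.
move=> N0 tchi tf; have sg i := (field_test l i tf).1.
have sc i : ms_smooth (fun x => chi i (x + y)) by exact: smooth_shift (tchi i).1.
have scg i : ms_smooth (fun x => chi i (x + y) * field l f i x) by exact: smoothM.
rewrite {1}/field /two_scale differentiable_pdD; last 2 first.
- exact: smooth_diff tf.1.
- by apply: smooth_diff; exact: smooth_sum.
rewrite pd_sum//; have E i : pd k (fun z => chi i (z + y) * field l f i z) x =
    chi i (x + y) * pd k (field l f i) x + field l f i x * pd k (chi i) (x + y).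
  by rewrite differentiable_pdM ?pd_shift//; exact: smooth_diff.
rewrite (eq_bigr _ (fun i _ => E i)) big_split/=.
have -> : \sum_i field l f i x * field (e_ i) (chi i) k (x + y) =
    field l f k x - \sum_i field l f i x * pd k (chi i) (x + y).
  under eq_bigr do rewrite /field mulrBr.
  rewrite sumrB; congr (_ - _); rewrite (bigD1 k)//= mxE eqxx mulr1 big1 ?addr0// => i ik.
  by rewrite mxE eq_sym (negbTE ik) mulr0.
by rewrite /field; ring.
Qed.

Lemma slowW c c' delta W : c' <= c -> slow c delta W -> slow c' delta W.
Proof. by move=> cc sl x y hy; apply: sl; exact: le_trans hy cc. Qed.

(** Testing with h(x - y) puts the weight of U in phase with the correctors, which [two_scale]
    evaluates at x + y; W, being slow, is moved back at the cost exp(2 delta). *)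
Lemma qform_shifted_test N U W delta h y l : (0 < N)%N -> buc U -> ms_periodic 1 U ->
  buc W -> ms_periodic N%:R W -> slow 1 delta W -> test N%:R h -> `|y| <= 1 ->
  mean N%:R (weight (fun x => U x + W x)) * ms_eff_qform N%:R (fun x => U x + W x) l <=
  expR (2 * delta) *
  mean N%:R (fun x => (\sum_k field l h k x ^+ 2) * (weight U (x + y) * weight W x)).
Proof.
move=> N0 bU pU bW pW sl th y1; have NR0 : 0 < N%:R :> R by rewrite ltr0n.
have bUW := bucD bU bW; have ba := weight_buc bU; have bw := weight_buc bW.
have bay := buc_shift y ba; have bwy := buc_shift y bw.
have bf k := field_buc l k NR0 th.
have bS : buc (fun x => \sum_k field l h k x ^+ 2) by buc_tac.
have thy : test N%:R (fun x => h (x - y)).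
  by split; [exact: smooth_shift th.1|exact: periodic_shift th.2].
apply: le_trans (qform_le NR0 bUW l thy) _.
have -> : energy N%:R (weight (fun x => U x + W x)) l (fun x => h (x - y)) =
    mean N%:R (fun x => (\sum_k field l h k x ^+ 2) * (weight U (x + y) * weight W (x + y))).
  rewrite -(@mean_shift _ _ _ (fun x => (\sum_k field l h k x ^+ 2) * (weight U (x + y) * weight W (x + y))) (- y))//.
  - have E k x : field l (fun x => h (x - y)) k x = field l h k (x - y).
      by rewrite /field pd_shift.
    rewrite /energy; congr mean; apply/funext => x; rewrite subrK weightD.
    by under eq_bigr do rewrite E.
  - exact: bucM bS (bucM bay bwy).
  - move=> x k; rewrite (periodic_shift y (periodic1_nat N (weight_periodic pU))).
    rewrite (periodic_shift y (weight_periodic pW)); congr (_ * _).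
    by apply: eq_bigr => j _; rewrite (field_periodic _ _ th.2).
rewrite -meanZ//; last exact: bucM bS (bucM bay bw).
apply: le_mean => //; [exact: bucM bS (bucM bay bwy)|exact: bucM (buc_cst _) (bucM bS (bucM bay bw))|].
move=> x; rewrite [leRHS]mulrCA ler_wpM2l//; first by apply: sumr_ge0 => k _; exact: sqr_ge0.
rewrite [leRHS]mulrCA ler_wpM2l ?(ltW (weight_gt0 _ _))//.
rewrite -[X in _ <= _ * weight W X](addrK y x); apply: weight_slow.
by rewrite sl// normrN.
Qed.

End TwoScale.

Section UpperBound.
Context {R : realType} {d : nat}.
Notation pt := 'rV[R]_d.
Notation e_ k := (ms_ebasis R k).
Implicit Types (f F G v : pt -> R) (x y z l : pt).
Variables (C delta A : R) (M N : nat) (Phi : pt -> R) (K : 'I_d -> pt -> R) (U W : pt -> R).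
Hypotheses (M0 : (0 < M)%N) (MN : (3 * M < N)%N) (kP : is_bump C M N Phi)
  (kK : forall i, is_bump C M N (K i))
  (dP : forall i x, pd i Phi x = M%:R^-1 * (K i x - K i (x - M%:R *: e_ i)))
  (bW : buc W) (pW : ms_periodic N%:R W) (sl : slow (4 * M)%:R delta W)
  (bU : buc U) (pU : ms_periodic 1 U) (HA : forall x, `|U x| <= A) (d0 : (0 < d)%N).

Let N0 : (0 < N)%N. Proof. by lia. Qed.
Let NR0 : 0 < N%:R :> R. Proof. by rewrite ltr0n. Qed.
Let MR0 : 0 < M%:R :> R. Proof. by rewrite ltr0n. Qed.
Let ba : buc (weight U). Proof. exact: weight_buc. Qed.
Let bw : buc (weight W). Proof. exact: weight_buc. Qed.
Let sl1 : slow 1 delta W.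
Proof. by apply: slowW sl; rewrite ler1n; lia. Qed.

Notation Z1 := (mean 1 (weight U)).
Notation lam := (ms_lambda_max (ms_eff_diff 1 U)).
Notation s := (M%:R^-1 : R).

(** The precision s = 1 / M matches the other errors. It is at most 1, which with q(e_i) <= 1 gives
    the energy bound 2 Z1 required by [corrector_bound]; the second factor d is the sum over i. *)
Lemma fast_correctors : exists2 chi : 'I_d -> pt -> R, forall i, test 1 (chi i) &
  (forall g : pt, energy 1 (weight U) g (fun x => \sum_i g ord0 i * chi i x) <=
     Z1 * ((lam + s) * sqn g)) /\
  mean 1 (fun x => (\sum_i chi i x ^+ 2) * weight U x) <= 6 * d%:R ^+ 2 * expR (4 * A) * Z1.
Proof.
have L0 := @ltr01 R; have s0 : 0 < s by rewrite invr_gt0.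
have s1 : s <= 1 by rewrite invf_le1// ler1n.
have Z0 : 0 < Z1 by exact: mean_weight_gt0.
have [chi Hchi Hmin] := near_minimizers L0 bU s0; exists chi => [i|]; first exact: (Hchi i).1.
split=> [g|].
  by apply: le_trans (Hmin g) _; rewrite ler_pM2l// mulrDl lerD2r; exact: lambda_max_form.
have bc i : buc (chi i) := test_buc L0 (Hchi i).1.
have b2 i : buc (fun x => chi i x ^+ 2 * weight U x) := bucM (buc_expr 2 (bc i)) ba.
have -> : (fun x => (\sum_i chi i x ^+ 2) * weight U x) = fun x => \sum_i chi i x ^+ 2 * weight U x.
  by apply/funext => x; rewrite mulr_suml.
rewrite mean_sum//; apply: (@le_trans _ _ (\sum_(i < d) 6 * d%:R * expR (4 * A) * Z1)).
  apply: ler_sum => i _; apply: (corrector_bound bU HA (Hchi i).1 (Hchi i).2).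
  have -> : chi i = fun x => \sum_j e_ i ord0 j * chi j x.
    apply/funext => x; rewrite (bigD1 i)//= mxE eqxx mul1r big1 ?addr0// => j ji.
    by rewrite mxE (negbTE ji) mul0r.
  apply: le_trans (Hmin (e_ i)) _; rewrite mulrC ler_wpM2r ?(ltW Z0)// sqn_ebasis mulr1.
  have := qform_le_sqn L0 bU (e_ i); rewrite sqn_ebasis; lra.
by rewrite sumr_const card_ord -[leLHS]mulr_natl le_eqVlt; apply/orP; left; apply/eqP; ring.
Qed.

(** The left side is free of y, so [qform_shifted_test] may be averaged over y in the unit cell;
    each of the two terms from Young's inequality is then treated by exchanging the means. *)
Lemma upper_bound_test l f : test N%:R f ->
  mean N%:R (weight (fun x => U x + W x)) * ms_eff_qform N%:R (fun x => U x + W x) l <=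
  expR (2 * delta) * ((1 + s) * (Z1 * (lam + s)) +
    (1 + s^-1) * (6 * d%:R ^+ 2 * expR (4 * A) * Z1 * (4 * d%:R / M%:R ^+ 2))) *
  (expR (2 * delta) * energy N%:R (weight W) l f).
Proof.
move=> tf; have L0 := @ltr01 R; have [chi tchi [Hmin HF]] := fast_correctors.
have s0 : 0 < s by rewrite invr_gt0.
pose fb := smoothing N%:R Phi f; have tfb : test N%:R fb := smoothing_test M0 MN kP tf.
pose g i x := field l fb i x; pose ck i k z := field (e_ i) (chi i) k z.
have bg i : buc (g i) := field_buc l i NR0 tfb.
have bck i k : buc (ck i k) := field_buc (e_ i) k L0 (tchi i).
have bpg i k : buc (pd k (g i)) := test_pd_buc k NR0 (field_test l i tfb).
have bc i : buc (chi i) := test_buc L0 (tchi i).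
pose F z := (\sum_i chi i z ^+ 2) * weight U z.
pose P x := \sum_k \sum_i pd k (g i) x ^+ 2.
have bF : buc F by apply: bucM => //; apply: buc_sum => i _; exact: buc_expr.
have pF : ms_periodic 1 F.
  move=> x k; rewrite /F (weight_periodic pU); congr (_ * _).
  by apply: eq_bigr => i _; rewrite (tchi i).2.
have bPw : buc (fun x => P x * weight W x).
  by apply: bucM => //; apply: buc_sum => k _; apply: buc_sum => i _; exact: buc_expr.
pose X (p : pt * pt) := (\sum_k (\sum_i g i p.2 * ck i k (p.2 + p.1)) ^+ 2) *
  weight U (p.2 + p.1) * weight W p.2.
have bX : buc X.
  apply: bucM; last exact: (@buc_snd _ _ _ (weight W)).
  apply: bucM; last exact: (buc_swap (buc_pair_add ba)).
  apply: buc_sum => k _; apply: buc_expr; apply: buc_sum => i _.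
  by apply: bucM; [exact: (@buc_snd _ _ _ (g i))|exact: (buc_swap (buc_pair_add (bck i k)))].
have bXy y : buc (fun x => X (y, x)) := buc_section y bX.
have bFP y : buc (fun x => F (x + y) * (P x * weight W x)) := bucM (buc_shift y bF) bPw.
have bFPp : buc (fun p : pt * pt => F (p.2 + p.1) * (P p.2 * weight W p.2)).
  by apply: bucM; [exact: (buc_swap (buc_pair_add bF))|exact: (@buc_snd _ _ _ (fun x => P x * weight W x))].
have bm1 : buc (fun y => mean N%:R (fun x => X (y, x))) := buc_mean NR0 bX.
have bm2 : buc (fun y => mean N%:R (fun x => F (x + y) * (P x * weight W x))) := buc_mean NR0 bFPp.
rewrite -[leLHS](mean_cst (d := d) _ L0).
apply: (@le_trans _ _ (mean 1 (fun y => expR (2 * delta) *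
    ((1 + s) * mean N%:R (fun x => X (y, x)) +
     (1 + s^-1) * mean N%:R (fun x => F (x + y) * (P x * weight W x)))))).
  apply: le_mean_cube => //; first exact: buc_cst.
    by apply: bucM (buc_cst _) _; apply: bucD; apply: bucM (buc_cst _) _.
  move=> y yb; have y1 : `|y| <= 1 by exact: box_norm yb.
  apply: le_trans (qform_shifted_test l N0 bU pU bW pW sl1 (two_scale_test y l N0 tchi tfb) y1) _.
  rewrite ler_pM2l ?expR_gt0// -meanZ// -[X in _ <= _ + X]meanZ// -meanD//; last 2 first.
  - exact: bucM (buc_cst _) _.
  - exact: bucM (buc_cst _) _.
  apply: le_mean => //.
  - have bft k := field_buc l k NR0 (two_scale_test y l N0 tchi tfb).
    by apply: bucM (bucM (buc_shift y ba) bw); apply: buc_sum => k _; exact: buc_expr.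
  - by apply: bucD; apply: bucM (buc_cst _) _.
  move=> x; rewrite /X /F /P /=.
  have -> : forall a b S T Q : R, (1 + s) * (S * a * b) + (1 + s^-1) * (T * a * (Q * b)) =
    ((1 + s) * S + (1 + s^-1) * (T * Q)) * (a * b) by move=> *; ring.
  rewrite ler_wpM2r//; first by rewrite mulr_ge0// ltW// weight_gt0.
  rewrite [X in _ <= _ + _ * X]mulr_sumr !mulr_sumr -big_split/=; apply: ler_sum => k _.
  rewrite (field_two_scale y l k x N0 tchi tfb); apply: le_trans (sqr_sub_young _ _ s0) _.
  rewrite lerD2l ler_wpM2l ?addr_ge0 ?invr_ge0 ?(ltW s0)//.
  exact: sum_sqr_CS.
rewrite meanZ//; last by apply: bucD; apply: bucM (buc_cst _) _.
rewrite -mulrA ler_pM2l ?expR_gt0// meanD//; last 2 first.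
- exact: bucM (buc_cst _) _.
- exact: bucM (buc_cst _) _.
rewrite (meanZ _ L0 bm1) (meanZ _ L0 bm2) [leRHS]mulrDl; apply: lerD.
- rewrite -mulrA ler_wpM2l ?addr_ge0 ?(ltW s0)// (mean_swap L0 NR0 bX).
  have Eg := smoothing_energy M0 MN kP bW pW sl l tf.
  apply: le_trans (_ : _ <= mean N%:R (fun x => Z1 * (lam + s) * ((\sum_k g k x ^+ 2) * weight W x))) _.
    apply: le_mean => //; first exact: (buc_mean L0 (buc_swap bX)).
      by apply: bucM (buc_cst _) (bucM _ bw); apply: buc_sum => i _; exact: buc_expr.
    (* At fixed x the slopes form a constant vector, and the average over y is the energy of the
       combined correctors in that direction. *)
    move=> x; pose gx : pt := \row_i g i x.
    have gE i : gx ord0 i = g i x by rewrite mxE.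
    pose Q z := (\sum_k (\sum_i gx ord0 i * ck i k z) ^+ 2) * weight U z.
    have bQ : buc Q.
      by apply: bucM => //; apply: buc_sum => k _; apply: buc_expr; apply: buc_sum => i _; exact: bucM (buc_cst _) _.
    have pQ : ms_periodic 1 Q.
      move=> z j; rewrite /Q (weight_periodic pU); congr (_ * _).
      by apply: eq_bigr => k _; congr (_ ^+ 2); apply: eq_bigr => i _; rewrite /ck (field_periodic _ _ (tchi i).2).
    have -> : (fun y => X (y, x)) = fun y => Q (y + x) * weight W x.
      apply/funext => y; rewrite /X /Q/= [y + x]addrC; congr (_ * _ * _).
      by apply: eq_bigr => k _; congr (_ ^+ 2); apply: eq_bigr => i _; rewrite gE.
    rewrite meanZr//; last exact: buc_shift.
    rewrite mean_shift// mulrA ler_wpM2r ?(ltW (weight_gt0 _ _))//.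
    have := Hmin gx; rewrite /sqn (eq_bigr (fun k => g k x ^+ 2)) => [|k _]; last by rewrite gE.
    rewrite mulrA; apply: le_trans; rewrite le_eqVlt; apply/orP; left; apply/eqP.
    congr mean; apply/funext => z; congr (_ * _); apply: eq_bigr => k _.
    have := field_sum (fun i => gx ord0 i) (fun i => e_ i) k z (fun i => (tchi i).1).
    by rewrite -row_ebasis => ->.
  rewrite meanZ//; last by apply: bucM bw; apply: buc_sum => i _; exact: buc_expr.
  rewrite ler_wpM2l// mulr_ge0 ?(ltW (mean_weight_gt0 L0 bU))// addr_ge0 ?(ltW s0)//.
  exact: le_trans (expR_ge0 _) (lambda_max_lower L0 bU d0 HA).
(* In the error term the correctors decouple from the derivatives of the slopes, and the latter
   supply 1 / M^2. *)
- rewrite -[leRHS]mulrA; apply: ler_wpM2l; first by rewrite addr_ge0// invr_ge0 ltW.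
  rewrite mean_cell_shift//.
  rewrite -[leRHS]mulrA; apply: ler_pM => //.
  + apply: mean_ge0 => // x; rewrite mulr_ge0 ?(ltW (weight_gt0 _ _))//.
    by apply: sumr_ge0 => i _; exact: sqr_ge0.
  + apply: mean_ge0 => // x; rewrite mulr_ge0 ?(ltW (weight_gt0 _ _))//.
    by apply: sumr_ge0 => k _; apply: sumr_ge0 => i _; exact: sqr_ge0.
  + exact: (smoothing_energy_pd M0 MN kP kK dP bW pW sl l tf).
Qed.

(** 6 delta collects the normalization, the translated test function and the smoothing, 2 delta
    each. Additive errors are divided by lambda_max through exp(4 A) lambda_max >= 1: (1 + s) s <= 2
    s yields 2 exp(4 A), and 24 d^3 exp(4 A)(s + s^2) yields the last summand. *)
Lemma upper_step l : ms_eff_qform N%:R (fun x => U x + W x) l <=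
  expR (6 * delta + (1 + 2 * expR (4 * A) + 48 * d%:R ^+ 3 * expR (8 * A)) / M%:R) *
  (lam * ms_eff_qform N%:R W l).
Proof.
have L0 := @ltr01 R; have s0 : 0 < s by rewrite invr_gt0.
have s1 : s <= 1 by rewrite invf_le1// ler1n.
have Z0 : 0 < Z1 by exact: mean_weight_gt0.
have bUW := bucD bU bW.
have lam0 := lambda_max_lower L0 bU d0 HA.
set C2 := 1 + _ + _; set q := ms_eff_qform _ _ l.
have q0 : 0 <= q by exact: qform_ge0.
have e4 : 0 < expR (4 * A) by exact: expR_gt0.
have le4 : 1 <= expR (4 * A) * lam.
  by rewrite -ler_pdivrMl// mulr1 -expRN -mulNr.
have lamp : 0 < lam by exact: lt_le_trans (expR_gt0 _) lam0.
have key : (1 + s) * (Z1 * (lam + s)) +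
    (1 + s^-1) * (6 * d%:R ^+ 2 * expR (4 * A) * Z1 * (4 * d%:R / M%:R ^+ 2)) <=
    Z1 * (lam * expR (C2 / M%:R)).
  have -> : (1 + s) * (Z1 * (lam + s)) +
    (1 + s^-1) * (6 * d%:R ^+ 2 * expR (4 * A) * Z1 * (4 * d%:R / M%:R ^+ 2)) =
    Z1 * ((1 + s) * (lam + s) + 24 * d%:R ^+ 3 * expR (4 * A) * ((1 + s^-1) * s ^+ 2)).
    by rewrite exprVn; ring.
  rewrite ler_pM2l//; apply: (@le_trans _ _ (lam * (1 + C2 / M%:R))); last by rewrite ler_pM2l// expR_ge1Dx.
  have -> : (1 + s^-1) * s ^+ 2 = s + s ^+ 2 by field; rewrite gt_eqF.
  have ss : s ^+ 2 <= s by rewrite expr2 ler_piMr// ltW.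
  set D := 24 * _ * _.
  have D0 : 0 <= D by rewrite !mulr_ge0 ?exprn_ge0 ?ler0n// ltW.
  have e8 : expR (8 * A) = expR (4 * A) * expR (4 * A).
    by rewrite -expRD; congr expR; ring.
  have h1 : D * (s + s ^+ 2) <= 2 * D * s by have := ler_wpM2l D0 ss; rewrite mulrDr -mulrA; lra.
  have h2 : 2 * D * s <= 2 * D * s * (expR (4 * A) * lam) by rewrite ler_peMr// mulr_ge0 ?(ltW s0)// mulr_ge0.
  have h3 : (1 + s) * s <= 2 * s * (expR (4 * A) * lam).
    apply: (@le_trans _ _ (2 * s)); first by rewrite ler_wpM2r ?(ltW s0)//; lra.
    by rewrite ler_peMr// mulr_ge0// ltW.
  have -> : lam * (1 + C2 / M%:R) = lam + lam * s + 2 * s * (expR (4 * A) * lam) + 2 * D * s * (expR (4 * A) * lam).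
    by rewrite /C2 /D e8; ring.
  have -> : (1 + s) * (lam + s) = lam + lam * s + (1 + s) * s by ring.
  by rewrite -addrA -[leRHS]addrA; apply: lerD => //; apply: lerD => //; exact: le_trans h1 h2.
have [hZ _] := weight_split N0 bU pU bW pW sl1.
have E6 : 6 * delta = 2 * delta + (2 * delta + 2 * delta) by ring.
rewrite mulrA -ler_pdivrMl; last by rewrite mulr_gt0 ?expR_gt0.
apply: le_qform => // f tf; have := upper_bound_test l tf; rewrite -/q => h.
set E := energy _ _ _ _ in h *.
have E0 : 0 <= E.
  by apply: energy_ge0 => // x; exact: ltW (weight_gt0 _ _).
rewrite mulrCA ler_pdivrMl; last by rewrite mulr_gt0 ?expR_gt0.
rewrite -(ler_pM2l Z0) mulrA; apply: le_trans (ler_wpM2r q0 hZ) _.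
rewrite -mulrA; apply: (le_trans (ler_wpM2l (expR_ge0 _) h)).
rewrite E6 !expRD.
have -> : Z1 * (expR (2 * delta) * (expR (2 * delta) * expR (2 * delta)) * expR (C2 / M%:R) * lam * E) =
  expR (2 * delta) * (expR (2 * delta) * (Z1 * (lam * expR (C2 / M%:R))) * (expR (2 * delta) * E)) by ring.
apply: (ler_wpM2l (expR_ge0 _)); apply: (ler_wpM2r (mulr_ge0 (expR_ge0 _) E0)).
exact: (ler_wpM2l (expR_ge0 _)).
Qed.

End UpperBound.

(** * Lower bound for one scale *)

Section CellConvolution.
Context {R : realType} {d : nat}.
Notation pt := 'rV[R]_d.
Notation e_ k := (ms_ebasis R k).
Implicit Types (f F G U W u v : pt -> R) (x y z l : pt).

(** Here y is the position on the large torus and z the position inside a cell. For N-periodic K and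
    v this is 1-periodic in z, with mean [smoothing N%:R K v y] over the cell. *)
Definition cconv N (K v : pt -> R) (y z : pt) : R := cavg N (fun x => K x * v (x + y)) z.

Lemma buc_cconv N K v : buc K -> buc v -> buc (fun p : pt * pt => cconv N K v p.1 p.2).
Proof.
move=> bK bv; apply: bucM (buc_cst _) _; apply: buc_sum => k _; apply: bucM.
  exact: (@buc_snd _ _ _ (fun z => K (z + lattice k)) (buc_shift _ bK)).
have := buc_swap (buc_pair_add (buc_shift (lattice k) bv)).
congr buc; apply/funext => p /=; by rewrite [_ + _ + lattice k]addrAC.
Qed.

Lemma cconv_periodic N K v y : (0 < N)%N -> ms_periodic N%:R K -> ms_periodic N%:R v ->
  ms_periodic 1 (cconv N K v y).
Proof.
move=> N0 pK pv; apply: cavg_periodic => // x k.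
by rewrite pK (periodic_shift y pv).
Qed.

Lemma mean_cconv N K v y : (0 < N)%N -> buc K -> ms_periodic N%:R K ->
  buc v -> ms_periodic N%:R v -> mean 1 (cconv N K v y) = smoothing N%:R K v y.
Proof.
move=> N0 bK pK bv pv; apply: mean_cavg => //; first exact: bucM bK (buc_shift y bv).
by move=> x k; rewrite pK (periodic_shift y pv).
Qed.

(* Shifting the argument of the average by a lattice vector moves the shift from the kernel to the function. *)
Lemma cconv_lattice_shift N (m : nat) K v y z k : (0 < N)%N ->
  ms_periodic N%:R K -> ms_periodic N%:R v ->
  cavg N (fun x => K (x - m%:R *: e_ k) * v (x + y)) z =
  cconv N K (fun x => v (x + m%:R *: e_ k)) y z.
Proof.
move=> N0 pK pv; pose F x := K x * v (x + m%:R *: e_ k + y).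
have pF : ms_periodic N%:R F.
  by move=> x i; rewrite /F pK (periodic_shift (m%:R *: e_ k) (periodic_shift y pv)).
have -> : (fun x => K (x - m%:R *: e_ k) * v (x + y)) = fun x => F (x - m%:R *: e_ k).
  by apply/funext => x; rewrite /F subrK.
rewrite cavg_shift; have := periodic_int (z - m%:R *: e_ k) k m (cavg_periodic N0 pF).
rewrite -pmulrn subrK => <-; congr cavg; apply/funext => x.
by rewrite /F addrAC.
Qed.

Variables (C delta : R) (M N : nat) (W : pt -> R).
Hypotheses (M0 : (0 < M)%N) (MN : (3 * M < N)%N)
  (bW : buc W) (pW : ms_periodic N%:R W) (sl : slow (4 * M)%:R delta W).

Let N0 : (0 < N)%N. Proof. by lia. Qed.
Let NR0 : 0 < N%:R :> R. Proof. by rewrite ltr0n. Qed.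
Let MR0 : 0 < M%:R :> R. Proof. by rewrite ltr0n. Qed.
Let bw : buc (weight W). Proof. exact: weight_buc. Qed.

Lemma slow_ge0 : 0 <= delta.
Proof.
by apply: le_trans (sl 0 (y := 0) _); rewrite ?normr_ge0// normr0 ler0n.
Qed.

Lemma slow_expR_ge1 : 1 <= expR (2 * delta).
Proof. by rewrite -expR0 ler_expR mulr_ge0// slow_ge0. Qed.

(** The discrete, signed counterpart of [kernel_energy]: differences of kernel values have no sign,
    so the total variation of c replaces the mass 1. *)
Lemma finite_kernel_energy (I : finType) (c : I -> R) (x : I -> pt) u :
  buc u -> ms_periodic N%:R u -> (forall i, c i != 0 -> `|x i| <= (4 * M)%:R) ->
  mean N%:R (fun y => (\sum_i c i * u (x i + y)) ^+ 2 * weight W y) <=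
  (\sum_i `|c i|) ^+ 2 * (expR (2 * delta) * mean N%:R (fun y => u y ^+ 2 * weight W y)).
Proof.
move=> bu pu Hx; have bu2 : buc (fun y => u y ^+ 2) by exact: buc_expr.
have bui i : buc (fun y => u (x i + y)).
  by have := buc_shift (x i) bu; congr buc; apply/funext => y; rewrite addrC.
have b1 i : buc (fun y => `|c i| * (u (x i + y) ^+ 2 * weight W y)).
  exact: bucM (buc_cst _) (bucM (buc_expr 2 (bui i)) bw).
set S := \sum_i `|c i|; have S0 : 0 <= S by apply: sumr_ge0 => i _.
apply: (@le_trans _ _ (mean N%:R (fun y => S * \sum_i `|c i| * (u (x i + y) ^+ 2 * weight W y)))).
  apply: le_mean => //.
  - apply: bucM => //; apply: buc_expr; apply: buc_sum => i _; exact: bucM (buc_cst _) (bui i).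
  - by apply: bucM (buc_cst _) _; apply: buc_sum => i _.
  move=> y; apply: le_trans (ler_wpM2r (ltW (weight_gt0 _ _)) (sum_CS _ _)) _.
  rewrite -mulrA ler_wpM2l// mulr_suml.
  by apply: ler_sum => i _; rewrite -mulrA.
rewrite meanZ//; last by apply: buc_sum => i _.
rewrite expr2 -mulrA ler_wpM2l// mean_sum// /S mulr_suml; apply: ler_sum => i _.
rewrite meanZ//; last exact: bucM (buc_expr 2 (bui i)) bw.
have [->|ci] := eqVneq (c i) 0; first by rewrite normr0 !mul0r.
rewrite ler_wpM2l//.
have := @mean_weight_shift _ _ N%:R W (fun y => u y ^+ 2) (x i) delta NR0 bW pW bu2.
have -> : (fun y => u (x i + y) ^+ 2 * weight W y) = fun y => u (y + x i) ^+ 2 * weight W y.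
  by apply/funext => y; rewrite addrC.
apply => [y k|y|y]; [by rewrite pu|exact: sqr_ge0|].
by apply: sl; exact: Hx.
Qed.

(* Difference quotient of [l . x - f] over distance M in direction k. *)
Definition slope l f k x : R := l ord0 k - M%:R^-1 * (f (x + M%:R *: e_ k) - f x).

Lemma slope_buc l f k : buc f -> buc (slope l f k).
Proof.
by move=> bf; apply: bucB (buc_cst _) _; apply: bucM (buc_cst _) _; apply: bucB => //; exact: buc_shift.
Qed.

Lemma slope_periodic l f k (L : R) : ms_periodic L f -> ms_periodic L (slope l f k).
Proof. by move=> pf x i; rewrite /slope pf (periodic_shift (M%:R *: e_ k) pf). Qed.

Lemma norm_Mebasis k : `|M%:R *: e_ k : pt| <= M%:R.
Proof.
apply: rV_norm_le => [|j]; first exact: ler0n.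
rewrite !mxE normrM ger0_norm//; case: eqP => _; rewrite ?normr1 ?mulr1//.
by rewrite normr0 mulr0.
Qed.

Lemma slope_energy l f k : test N%:R f ->
  mean N%:R (fun x => slope l f k x ^+ 2 * weight W x) <=
  expR (2 * delta) * energy N%:R (weight W) l f.
Proof.
move=> tf; have bf := test_buc NR0 tf.
have slk : slow `|M%:R *: e_ k : pt| delta W.
  apply: slowW sl; apply: le_trans (norm_Mebasis k) _; rewrite ler_nat; lia.
have := shift_energy l NR0 bW pW tf slk.
rewrite sqnZ sqn_ebasis mulr1 => h.
have M2 : 0 < M%:R ^+ 2 :> R by rewrite exprn_gt0.
rewrite -(ler_pM2l M2) -meanZ//; last exact: bucM (buc_expr 2 (slope_buc l k bf)) bw.
apply: le_trans h; rewrite le_eqVlt; apply/orP; left; apply/eqP.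
congr mean; apply/funext => x; rewrite mulrA -exprMn; congr (_ ^+ 2 * _).
rewrite (bigD1 k)//= !mxE eqxx mulr1 big1 ?addr0 => [|i ik]; last first.
  by rewrite !mxE (negbTE ik) mulr0 mul0r.
by rewrite /slope mulrBr mulrA divff ?gt_eqF// mul1r.
Qed.

(** The two differences commute: the increment of a slope over th is 1/M times the difference, over
    distance M, of the increment of f over th, and the energy of the latter is bounded by
    [shift_energy]. Hence the 1 / M^2. *)
Lemma slope_shift_energy l f k (th : pt) : `|th| <= 1 -> test N%:R f ->
  mean N%:R (fun x => (slope l f k (x + th) - slope l f k x) ^+ 2 * weight W x) <=
  4 * d%:R / M%:R ^+ 2 * (expR (4 * delta) * energy N%:R (weight W) l f).
Proof.
move=> th1 tf; have bf := test_buc NR0 tf; set E := energy _ _ _ _.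
have E0 : 0 <= E by apply: energy_ge0 => // x; exact: ltW (weight_gt0 _ _).
have M1 : 1 <= (4 * M)%:R :> R by rewrite ler1n; lia.
pose D x := \sum_j th ord0 j * l ord0 j - (f (x + th) - f x).
have bD : buc D by apply: bucB (buc_cst _) _; apply: bucB => //; exact: buc_shift.
have pD : ms_periodic N%:R D by move=> x j; rewrite /D tf.2 (periodic_shift th tf.2).
have bD2 : buc (fun x => D x ^+ 2) := buc_expr 2 bD.
have bDM := buc_shift (M%:R *: e_ k) bD2.
have sth : sqn th <= d%:R.
  apply: (@le_trans _ _ (\sum_(j < d) 1)); last by rewrite sumr_const card_ord.
  apply: ler_sum => j _; rewrite -[X in X <= _]real_normK ?num_real// expr_le1//.
  exact: le_trans (rV_coord_le _ _) th1.
set V := mean N%:R (fun x => D x ^+ 2 * weight W x).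
have hV : V <= d%:R * (expR (2 * delta) * E).
  have slth : slow `|th| delta W by apply: slowW sl; exact: le_trans th1 M1.
  apply: le_trans (shift_energy l NR0 bW pW tf slth) _.
  by rewrite ler_wpM2r// mulr_ge0 ?expR_ge0.
have V0 : 0 <= V.
  apply: mean_ge0 => //; first exact: bucM.
  by move=> x; rewrite mulr_ge0 ?sqr_ge0// ltW// weight_gt0.
have hVM : mean N%:R (fun x => D (x + M%:R *: e_ k) ^+ 2 * weight W x) <= expR (2 * delta) * V.
  apply: (@mean_weight_shift _ _ N%:R W (fun x => D x ^+ 2)) => //.
  - by move=> x j; rewrite pD.
  - by move=> x; exact: sqr_ge0.
  - by move=> x; apply: sl; apply: le_trans (norm_Mebasis k) _; rewrite ler_nat; lia.
apply: (@le_trans _ _ (mean N%:R (fun x => 2 / M%:R ^+ 2 *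
    (D (x + M%:R *: e_ k) ^+ 2 * weight W x + D x ^+ 2 * weight W x)))).
  have bs := slope_buc l k bf.
  apply: le_mean => //.
  - by apply: bucM => //; apply: buc_expr; apply: bucB => //; exact: buc_shift.
  - by apply: bucM (buc_cst _) _; apply: bucD; exact: bucM.
  move=> x; rewrite -mulrDl [in leRHS]mulrA ler_wpM2r ?(ltW (weight_gt0 _ _))//.
  have -> : slope l f k (x + th) - slope l f k x = M%:R^-1 * (D (x + M%:R *: e_ k) - D x).
    by rewrite /slope /D [x + th + _]addrAC; ring.
  rewrite exprMn exprVn (mulrC 2) -mulrA ler_wpM2l ?invr_ge0 ?exprn_ge0 ?ler0n//.
  exact: sqrB_le2.
rewrite meanZ//; last by apply: bucD; exact: bucM.
rewrite meanD//; [|exact: bucM|exact: bucM]; rewrite -/V.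
have h1 : V <= expR (2 * delta) * V by rewrite ler_peMl// slow_expR_ge1.
have e4 : expR (4 * delta) = expR (2 * delta) * expR (2 * delta).
  by rewrite -expRD; congr expR; ring.
apply: (@le_trans _ _ (2 / M%:R ^+ 2 * (2 * (expR (2 * delta) * (d%:R * (expR (2 * delta) * E)))))).
  rewrite ler_wpM2l ?divr_ge0 ?exprn_ge0 ?ler0n// mulr2n mulrDl mul1r.
  apply: lerD; last apply: (le_trans h1); first apply: (le_trans hVM);
    exact: (ler_wpM2l (expR_ge0 _) hV).
by rewrite e4 le_eqVlt; apply/orP; left; apply/eqP; ring.
Qed.

(** A1 collects the change of the kernel, of order C / M by [bump_lip]; A2 collects the change of
    the slope, bounded by [slope_shift_energy], with coefficients that add up to 1 by
    [bump_cavg]. *)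
Lemma cell_oscillation K l f k z z' : is_bump C M N K -> box 1 z -> box 1 z' -> test N%:R f ->
  mean N%:R (fun y => (cconv N K (slope l f k) y z - cconv N K (slope l f k) y z') ^+ 2 * weight W y) <=
  (2 * C ^+ 2 + 8 * d%:R) / M%:R ^+ 2 * (expR (6 * delta) * energy N%:R (weight W) l f).
Proof.
move=> kK zb z'b tf; have bf := test_buc NR0 tf; set E := energy _ _ _ _.
have E0 : 0 <= E by apply: energy_ge0 => // x; exact: ltW (weight_gt0 _ _).
have bu := slope_buc l k bf; have pu := slope_periodic l k tf.2.
set u := slope l f k in bu pu *.
pose th := z - z'; pose u' x := u (x + th) - u x.
have bu' : buc u' by apply: bucB => //; exact: buc_shift.
have pu' : ms_periodic N%:R u' by move=> x j; rewrite /u' pu (periodic_shift th pu).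
pose nu := N%:R^-1 ^+ d : R.
have nu0 : 0 <= nu by rewrite exprn_ge0// invr_ge0 ler0n.
pose c1 (n : {ffun 'I_d -> 'I_N}) := nu * (K (z + lattice n) - K (z' + lattice n)).
pose c2 (n : {ffun 'I_d -> 'I_N}) := nu * K (z' + lattice n).
pose A1 y := \sum_n c1 n * u (z + lattice n + y).
pose A2 y := \sum_n c2 n * u' (z' + lattice n + y).
have EA y : cconv N K u y z - cconv N K u y z' = A1 y + A2 y.
  rewrite /cconv /cavg -mulrBr -sumrB mulr_sumr -big_split/=; apply: eq_bigr => n _.
  rewrite /c1 /c2 /u' /th (_ : z' + lattice n + y + (z - z') = z + lattice n + y).
    by rewrite /nu; ring.
  by rewrite addrC !addrA subrK.
have lat (x : pt) (n : {ffun 'I_d -> 'I_N}) : box 1 x -> box N%:R (x + lattice n).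
  move=> xb j; rewrite !mxE; have /andP[x0 x1] := xb j; rewrite addr_ge0//=.
  have : (n j : nat)%:R + 1 <= N%:R :> R by rewrite natr1 ler_nat.
  by move=> h; apply: le_trans h; rewrite addrC lerD2l.
have z4 (x : pt) (n : {ffun 'I_d -> 'I_N}) : box 1 x -> K (x + lattice n) != 0 -> box (3 * M)%:R (x + lattice n).
  by move=> xb; apply: (bump_supp kK); exact: lat.
have th1 : `|th| <= 1.
  apply: rV_norm_le => // j; rewrite !mxE ler_norml.
  by have := zb j; have := z'b j; lra.
have M34 : (3 * M)%:R + 1 <= (4 * M)%:R :> R by rewrite natr1 ler_nat; lia.
have h1 : mean N%:R (fun y => A1 y ^+ 2 * weight W y) <= (C / M%:R) ^+ 2 * (expR (4 * delta) * E).
  apply: le_trans (finite_kernel_energy bu pu _) _ => [n|].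
    rewrite /c1 mulf_eq0 negb_or subr_eq0 => /andP[_ ne].
    (* If only the translate of z' lies in the support, that of z is at most 1 away from it, which
       still fits within 4M. *)
    have [Kz|/(z4 _ _ zb) zM] := eqVneq (K (z + lattice n)) 0; last first.
      by apply: le_trans (box_norm (ler0n _ _) zM) _; apply: le_trans M34; rewrite lerDl.
    rewrite Kz eq_sym in ne; have zM := box_norm (ler0n _ _) (z4 _ _ z'b ne).
    have -> : z + lattice n = (z' + lattice n) + th by rewrite /th [RHS]addrC !addrA subrK.
    by apply: le_trans (ler_normD _ _) _; apply: le_trans M34; exact: lerD.
  have -> : expR (4 * delta) * E = expR (2 * delta) * (expR (2 * delta) * E).
    by rewrite mulrA -expRD; congr (expR _ * _); ring.
  apply: ler_pM.
  - exact: sqr_ge0.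
  - rewrite mulr_ge0 ?expR_ge0//; apply: mean_ge0 => //; first exact: bucM (buc_expr 2 bu) bw.
    by move=> x; rewrite mulr_ge0 ?sqr_ge0// ltW// weight_gt0.
  - have hs : \sum_n `|c1 n| <= C / M%:R.
      apply: le_trans (bump_lip kK zb z'b); rewrite mulr_sumr; apply: ler_sum => n _.
      by rewrite /c1 normrM (ger0_norm nu0).
    rewrite ler_pXn2r// nnegrE; first by apply: sumr_ge0 => n _.
    by apply: le_trans hs; apply: sumr_ge0 => n _.
  - by rewrite ler_wpM2l ?expR_ge0//; exact: slope_energy.
have h2 : mean N%:R (fun y => A2 y ^+ 2 * weight W y) <=
    4 * d%:R / M%:R ^+ 2 * (expR (6 * delta) * E).
  apply: le_trans (finite_kernel_energy bu' pu' _) _ => [n|].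
    rewrite /c2 mulf_eq0 negb_or => /andP[_ /(z4 _ _ z'b) zM].
    by apply: le_trans (box_norm (ler0n _ _) zM) _; apply: le_trans M34; rewrite lerDl.
  have -> : \sum_n `|c2 n| = 1.
    rewrite -(bump_cavg kK z') /cavg mulr_sumr; apply: eq_bigr => n _.
    by rewrite /c2 normrM (ger0_norm nu0) ger0_norm// (bump_ge0 kK).
  rewrite expr1n mul1r.
  have -> : 4 * d%:R / M%:R ^+ 2 * (expR (6 * delta) * E) =
      expR (2 * delta) * (4 * d%:R / M%:R ^+ 2 * (expR (4 * delta) * E)).
    have -> : 6 * delta = 2 * delta + 4 * delta by ring.
    by rewrite expRD; ring.
  by rewrite ler_wpM2l ?expR_ge0//; exact: slope_shift_energy.
have bsum (c : {ffun 'I_d -> 'I_N} -> R) (x : pt) v : buc v ->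
    buc (fun y => \sum_n c n * v (x + lattice n + y)).
  move=> bv; apply: buc_sum => n _; apply: bucM (buc_cst _) _.
  by have := buc_shift (x + lattice n) bv; congr buc; apply/funext => y; rewrite addrC.
have bA1 : buc A1 by exact: bsum.
have bA2 : buc A2 by exact: bsum.
have bA1' := bucM (buc_expr 2 bA1) bw; have bA2' := bucM (buc_expr 2 bA2) bw.
apply: (@le_trans _ _ (mean N%:R (fun y => 2 * (A1 y ^+ 2 * weight W y) + 2 * (A2 y ^+ 2 * weight W y)))).
  apply: le_mean => //.
  - have -> : (fun y => (cconv N K u y z - cconv N K u y z') ^+ 2 * weight W y) =
        fun y => (A1 y + A2 y) ^+ 2 * weight W y by apply/funext => y; rewrite EA.
    by apply: bucM => //; apply: buc_expr; exact: bucD.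
  - by apply: bucD; exact: bucM (buc_cst _) _.
  move=> y; rewrite EA -mulrDr -mulrDl mulrA ler_wpM2r ?(ltW (weight_gt0 _ _))//.
  exact: sqrD_le2.
rewrite meanD//; [|exact: bucM (buc_cst _) _|exact: bucM (buc_cst _) _].
rewrite !meanZ//.
have h1' : mean N%:R (fun y => A1 y ^+ 2 * weight W y) <= (C / M%:R) ^+ 2 * (expR (6 * delta) * E).
  apply: le_trans h1 _; rewrite ler_wpM2l ?sqr_ge0// ler_wpM2r// ler_expR ler_wpM2r ?slow_ge0//.
  by rewrite ler_nat.
apply: le_trans (lerD (ler_wpM2l (ler0n _ 2) h1') (ler_wpM2l (ler0n _ 2) h2)) _.
by rewrite exprMn exprVn le_eqVlt; apply/orP; left; apply/eqP; ring.
Qed.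

End CellConvolution.

Section LowerBound.
Context {R : realType} {d : nat}.
Notation pt := 'rV[R]_d.
Notation e_ k := (ms_ebasis R k).
Implicit Types (f F G u v : pt -> R) (x y z l : pt).

Lemma sqr_field_periodic L l f : ms_periodic L f ->
  ms_periodic L (fun x => \sum_k field l f k x ^+ 2).
Proof. by move=> pf x i; apply: eq_bigr => k _; rewrite (field_periodic _ _ pf). Qed.

Lemma mean_sqr_le L F : 0 < L -> buc F -> mean L F ^+ 2 <= mean L (fun x => F x ^+ 2).
Proof.
move=> L0 bF; have := @mean_CS _ d L (fun=> 1) F L0 (buc_cst _) bF.
rewrite normr1 mean_cst// mul1r; congr (_ ^+ 2 <= _); congr mean; apply/funext => x;
  by rewrite mul1r.
Qed.

Variables (C delta A : R) (M N : nat) (Phi : pt -> R) (K : 'I_d -> pt -> R) (U W : pt -> R).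
Hypotheses (M0 : (0 < M)%N) (MN : (3 * M < N)%N) (kP : is_bump C M N Phi)
  (kK : forall i, is_bump C M N (K i))
  (dP : forall i x, pd i Phi x = M%:R^-1 * (K i x - K i (x - M%:R *: e_ i)))
  (bW : buc W) (pW : ms_periodic N%:R W) (sl : slow (4 * M)%:R delta W)
  (bU : buc U) (pU : ms_periodic 1 U) (HA : forall x, `|U x| <= A) (d0 : (0 < d)%N).

Let N0 : (0 < N)%N. Proof. by lia. Qed.
Let NR0 : 0 < N%:R :> R. Proof. by rewrite ltr0n. Qed.
Let MR0 : 0 < M%:R :> R. Proof. by rewrite ltr0n. Qed.
Let L0 : 0 < 1 :> R. Proof. exact: ltr01. Qed.
Let ba : buc (weight U). Proof. exact: weight_buc. Qed.
Let bw : buc (weight W). Proof. exact: weight_buc. Qed.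
Let bP : buc Phi. Proof. exact: bump_buc MN _ kP. Qed.
Let bK i : buc (K i). Proof. exact: bump_buc MN _ (kK i). Qed.
Let sl1 : slow 1 delta W.
Proof. by apply: slowW sl; rewrite ler1n; lia. Qed.

Notation Z1 := (mean 1 (weight U)).
Notation lam := (ms_lambda_min (ms_eff_diff 1 U)).
Notation s := (M%:R^-1 : R).

Lemma smoothing_mean_weight F : buc F -> ms_periodic N%:R F -> (forall x, 0 <= F x) ->
  mean N%:R (fun y => smoothing N%:R Phi F y * weight W y) <=
  expR (2 * delta) * mean N%:R (fun x => F x * weight W x).
Proof.
move=> bF pF F0; have Hz z : box (3 * M)%:R z -> `|z + 0| <= (4 * M)%:R.
  by move=> zb; rewrite addr0 (le_trans (box_norm (ler0n _ _) zb))// ler_nat; lia.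
have := kernel_mean M0 MN kP bF pF F0 bW pW sl Hz.
have -> // : (fun x => mean N%:R (fun z => Phi z * F (z + x + 0)) * weight W x) =
    fun y => smoothing N%:R Phi F y * weight W y.
by apply/funext => x; congr (mean _ _ * _); apply/funext => z; rewrite addr0.
Qed.

(** An exact identity: the product rule brings in the derivative of Phi, a difference of translates
    of K; as M e_k is a lattice vector, it becomes the increment of f in the slope. The averaged
    field is thus a slope average minus a gradient on the unit cell. *)
Lemma field_cconv l f k y z : test N%:R f ->
  cconv N Phi (field l f k) y z =
  cconv N (K k) (slope M l f k) y z - pd k (cconv N Phi f y) z.
Proof.
move=> tf; have sfy : ms_smooth (fun x => f (x + y)) by exact: smooth_shift tf.1.
have sP := bump_smooth kP.
have E1 : cconv N Phi (field l f k) y z =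
    l ord0 k - cavg N (fun x => Phi x * pd k f (x + y)) z.
  rewrite -[l ord0 k]mulr1 -(bump_cavg kP z) -cavgZ -cavgB; congr cavg.
  by apply/funext => x; rewrite /field; ring.
have E2 : cconv N (K k) (slope M l f k) y z = l ord0 k -
    s * (cconv N (K k) (fun x => f (x + M%:R *: e_ k)) y z - cconv N (K k) f y z).
  have hl : l ord0 k = cavg N (fun x => l ord0 k * K k x) z.
    by rewrite cavgZ (bump_cavg (kK k)) mulr1.
  rewrite [X in X - _]hl -cavgB -cavgZ -cavgB; congr cavg.
  by apply/funext => x; rewrite /slope; ring.
have E3 : pd k (cconv N Phi f y) z = cavg N (fun x => Phi x * pd k f (x + y)) z +
    s * (cconv N (K k) f y z - cconv N (K k) (fun x => f (x + M%:R *: e_ k)) y z).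
  rewrite -(cconv_lattice_shift M y z k N0 (bump_periodic (kK k)) tf.2).
  rewrite -cavgB -cavgZ -cavgD pd_cavg; last exact: smoothM.
  congr cavg; apply/funext => x.
  rewrite differentiable_pdM; [|exact: smooth_diff|exact: smooth_diff].
  by rewrite pd_shift dP; ring.
by rewrite E1 E2 E3; ring.
Qed.

Lemma cconv_test f y : test N%:R f -> test 1 (cconv N Phi f y).
Proof.
move=> tf; split; last exact: cconv_periodic (bump_periodic kP) tf.2.
by apply: smooth_cavg; apply: smoothM (bump_smooth kP) _; exact: smooth_shift tf.1.
Qed.

(** The gradient in [field_cconv] has mean zero over the cell, so the slope average fluctuates
    around the smoothed field at y. *)
Lemma mean_cconv_field l f k y : test N%:R f ->
  mean 1 (cconv N (K k) (slope M l f k) y) = field l (smoothing N%:R Phi f) k y.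
Proof.
move=> tf; have bf := test_buc NR0 tf; have tc := cconv_test y tf.
rewrite (field_smoothing M0 MN kP)// -mean_cconv//; last 3 first.
- exact: bump_periodic kP.
- exact: field_buc tf.
- exact: field_periodic tf.2.
have -> : cconv N Phi (field l f k) y =
    fun z => cconv N (K k) (slope M l f k) y z - pd k (cconv N Phi f y) z.
  by apply/funext => z; exact: field_cconv.
rewrite meanB//; last exact: test_pd_buc tc.
  by rewrite (mean_pd k L0 tc) subr0.
exact: (buc_section y (buc_cconv N (bK k) (slope_buc M l k bf))).
Qed.

(** The smoothed field is the cell mean of the slope average, so Jensen's inequality in z' bounds
    the deviation at z by oscillations between two points of the cell. *)
Lemma cell_variance l f k : test N%:R f ->
  mean N%:R (fun y => mean 1 (fun z => (cconv N (K k) (slope M l f k) y z -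
    field l (smoothing N%:R Phi f) k y) ^+ 2) * weight W y) <=
  (2 * C ^+ 2 + 8 * d%:R) / M%:R ^+ 2 * (expR (6 * delta) * energy N%:R (weight W) l f).
Proof.
move=> tf; have bf := test_buc NR0 tf; set B := _ / _ * _.
pose G (p : pt * pt) := cconv N (K k) (slope M l f k) p.1 p.2.
have bG : buc G := buc_cconv N (bK k) (slope_buc M l k bf).
have bGy y : buc (fun z => G (y, z)) := buc_section y bG.
have bGz z : buc (fun y => G (y, z)) := buc_section z (buc_swap bG).
have bxi := field_buc l k NR0 (smoothing_test M0 MN kP tf).
set xi := field _ _ _ in bxi *.
have bH : buc (fun p => (G p - xi p.1) ^+ 2 * weight W p.1).
  apply: bucM; last exact: (@buc_fst _ _ _ (weight W)).
  by apply: buc_expr; apply: bucB => //; exact: (@buc_fst _ _ _ xi).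
have -> : (fun y => mean 1 (fun z => (cconv N (K k) (slope M l f k) y z - xi y) ^+ 2) * weight W y) =
    fun y => mean 1 (fun z => (G (y, z) - xi y) ^+ 2 * weight W y).
  by apply/funext => y; rewrite meanZr//; apply: buc_expr; apply: bucB (buc_cst _).
rewrite (mean_swap NR0 L0 bH)/= -(mean_cst (d := d) B L0); apply: le_mean_cube => //.
- exact: (buc_mean NR0 (buc_swap bH)).
- exact: buc_cst.
move=> z zb.
have bGG : buc (fun p => (G (p.1, z) - G p) ^+ 2 * weight W p.1).
  apply: bucM; last exact: (@buc_fst _ _ _ (weight W)).
  by apply: buc_expr; apply: bucB => //; exact: (@buc_fst _ _ _ (fun y => G (y, z))).
apply: (@le_trans _ _ (mean N%:R (fun y => mean 1 (fun z' => (G (y, z) - G (y, z')) ^+ 2 * weight W y)))).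
  apply: le_mean => //.
  - by apply: bucM bw; apply: buc_expr; exact: bucB.
  - exact: (buc_mean L0 bGG).
  move=> y; have bD : buc (fun z' => G (y, z) - G (y, z')) by apply: bucB (buc_cst _) _.
  rewrite meanZr//; last exact: buc_expr.
  rewrite ler_wpM2r ?(ltW (weight_gt0 _ _))//; apply: le_trans (mean_sqr_le L0 bD).
  rewrite meanB//; last exact: buc_cst.
  by rewrite mean_cst// /xi -(mean_cconv_field l k y tf).
rewrite (mean_swap NR0 L0 bGG)/= -(mean_cst (d := d) B L0); apply: le_mean_cube => //.
- exact: (buc_mean NR0 (buc_swap bGG)).
- exact: buc_cst.
by move=> z' zb'; exact: cell_oscillation.
Qed.

(* On each unit cell, [cconv N Phi f y] is a competitor for D(U) in the direction of the smoothed field,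
   which by [cell_variance] nearly does not vary over the cell. *)
Lemma cell_lower l f y : test N%:R f ->
  lam * Z1 * (\sum_k field l (smoothing N%:R Phi f) k y ^+ 2) <=
  (1 + s) * smoothing N%:R Phi (fun x => (\sum_k field l f k x ^+ 2) * weight U x) y +
  (1 + s^-1) * (expR (2 * A) * \sum_k mean 1 (fun z =>
    (cconv N (K k) (slope M l f k) y z - field l (smoothing N%:R Phi f) k y) ^+ 2)).
Proof.
move=> tf; have bf := test_buc NR0 tf; have tc := cconv_test y tf.
have s0 : 0 < s by rewrite invr_gt0.
have bfk k := field_buc l k NR0 tf.
pose xi : pt := \row_k field l (smoothing N%:R Phi f) k y.
have xiE k : field l (smoothing N%:R Phi f) k y = xi ord0 k by rewrite mxE.
pose G k z := cconv N (K k) (slope M l f k) y z.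
pose P k z := cconv N Phi (field l f k) y z.
have bG k : buc (G k) := buc_section y (buc_cconv N (bK k) (slope_buc M l k bf)).
have bPk k : buc (P k) := buc_section y (buc_cconv N bP (bfk k)).
have bfx k := field_buc xi k L0 tc.
have bay := buc_shift y ba.
have bGx k : buc (fun z => (G k z - xi ord0 k) ^+ 2).
  by apply: buc_expr; apply: bucB (buc_cst _).
under eq_bigr do rewrite xiE; rewrite -/(sqn xi).
under [X in _ <= _ + _ * (_ * X)]eq_bigr do rewrite xiE -/(G _ _).
have Z0 : 0 < Z1 by exact: mean_weight_gt0.
have h1 : lam * Z1 * sqn xi <=
    mean 1 (fun z => (\sum_k field xi (cconv N Phi f y) k z ^+ 2) * weight U (z + y)).
  (* The competitor is written in coordinates centred at y and is translated back before being
     tested against U. *)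
  pose h z := cconv N Phi f y (z - y).
  have th : test 1 h by split; [exact: smooth_shift tc.1|exact: periodic_shift tc.2].
  pose Q z := (\sum_k field xi h k z ^+ 2) * weight U z.
  have bQ : buc Q by apply: bucM => //; apply: buc_sum => k _; apply: buc_expr; exact: field_buc th.
  have pQ : ms_periodic 1 Q.
    by move=> z k; rewrite /Q (weight_periodic pU) (sqr_field_periodic xi th.2 z k).
  apply: (@le_trans _ _ (Z1 * ms_eff_qform 1 U xi)).
    by rewrite mulrAC mulrC ler_wpM2l ?(ltW Z0)//; exact: lambda_min_form.
  apply: (le_trans (qform_le L0 bU xi th)).
  have -> : energy 1 (weight U) xi h = mean 1 (fun z => Q (z + y)) by rewrite (mean_shift y L0 bQ pQ).
  have -> : (fun z => Q (z + y)) =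
      fun z => (\sum_k field xi (cconv N Phi f y) k z ^+ 2) * weight U (z + y).
  have E k z : field xi h k (z + y) = field xi (cconv N Phi f y) k z.
    by rewrite /field pd_shift addrK.
  by apply/funext => z; rewrite /Q; under eq_bigr do rewrite E.
  exact: lexx.
apply: le_trans h1 _.
have bS1 : buc (fun z => (\sum_k P k z ^+ 2) * weight U (z + y)).
  by apply: bucM => //; apply: buc_sum => k _; exact: buc_expr.
have bS2 : buc (fun z => \sum_k (G k z - xi ord0 k) ^+ 2) by apply: buc_sum => k _.
apply: (@le_trans _ _ (mean 1 (fun z => (1 + s) * ((\sum_k P k z ^+ 2) * weight U (z + y)) +
    (1 + s^-1) * (expR (2 * A) * \sum_k (G k z - xi ord0 k) ^+ 2)))).
  apply: le_mean => //.
  - by apply: bucM => //; apply: buc_sum => k _; exact: buc_expr.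
  - by apply: bucD; apply: bucM (buc_cst _) _ => //; exact: bucM (buc_cst _) _.
  move=> z; apply: (@le_trans _ _ (((1 + s) * (\sum_k P k z ^+ 2) +
      (1 + s^-1) * \sum_k (G k z - xi ord0 k) ^+ 2) * weight U (z + y))).
    rewrite ler_wpM2r ?(ltW (weight_gt0 _ _))// !mulr_sumr -big_split; apply: ler_sum => k _ /=.
    (* By [field_cconv], the competitor has as field in direction xi the averaged field of f minus
       the deviation of the slope average from its cell mean. *)
    have -> : field xi (cconv N Phi f y) k z = P k z - (G k z - xi ord0 k).
      by rewrite /P (field_cconv l k y z tf) /field /G; ring.
    exact: sqr_sub_young.
  rewrite mulrDl mulrA lerD2l -mulrA ler_wpM2l ?addr_ge0 ?invr_ge0 ?(ltW s0)//.
  rewrite mulrC ler_wpM2r ?weight_le//.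
  by apply: sumr_ge0 => k _; exact: sqr_ge0.
rewrite meanD//; [|exact: bucM (buc_cst _) _|by apply: bucM (buc_cst _) _; exact: bucM (buc_cst _) _].
rewrite meanZ// [X in _ + X <= _]meanZ//; last exact: bucM (buc_cst _) _.
rewrite meanZ// mean_sum// lerD2r ler_wpM2l ?addr_ge0 ?(ltW s0)//.
pose S x := (\sum_k field l f k x ^+ 2) * weight U x.
have bS : buc S by apply: bucM => //; apply: buc_sum => k _; exact: buc_expr.
have pS : ms_periodic N%:R S.
  by move=> x k; rewrite /S (periodic1_nat N (weight_periodic pU)) (sqr_field_periodic l tf.2 x k).
rewrite -(mean_cconv y N0 bP (bump_periodic kP) bS pS).
apply: le_mean => //; first exact: (buc_section y (buc_cconv N bP bS)).
move=> z; have pay : ms_periodic 1 (fun x => weight U (x + y)).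
  exact: periodic_shift (weight_periodic pU).
have -> : cconv N Phi S y z = weight U (z + y) *
    cavg N (fun x => \sum_k Phi x * field l f k (x + y) ^+ 2) z.
  rewrite -(cavgM_periodic _ _ z pay); congr cavg; apply/funext => x.
  by rewrite /S -mulr_sumr; ring.
rewrite mulrC ler_wpM2l ?(ltW (weight_gt0 _ _))// cavg_sum; apply: ler_sum => k _.
(* Jensen's inequality: the translates of Phi are nonnegative with lattice average 1. *)
apply: le_trans (cavg_CS _ _ _ _) _.
have nP : (fun x => `|Phi x|) = Phi by apply/funext => x; rewrite ger0_norm// (bump_ge0 kP).
rewrite nP (bump_cavg kP) mul1r le_eqVlt; apply/orP; left; apply/eqP; congr cavg.
by apply/funext => x; rewrite ger0_norm// (bump_ge0 kP).
Qed.

(** The smoothed f is a competitor for W, and [cell_lower], integrated in y against the weight of W,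
    bounds its energy. The variance term involves the energy of f for W alone; returning to U + W
    costs the second factor exp(2 A). *)
Lemma lower_bound_test l f : test N%:R f ->
  lam * Z1 * (mean N%:R (weight W) * ms_eff_qform N%:R W l) <=
  ((1 + s) + (1 + s^-1) * (expR (4 * A) * (d%:R * ((2 * C ^+ 2 + 8 * d%:R) / M%:R ^+ 2)))) *
  (expR (6 * delta) * energy N%:R (weight (fun x => U x + W x)) l f).
Proof.
move=> tf; have bf := test_buc NR0 tf; have tS := smoothing_test M0 MN kP tf.
have s0 : 0 < s by rewrite invr_gt0.
have del0 := slow_ge0 sl.
have bfk k := field_buc l k NR0 tf; have bSk k := field_buc l k NR0 tS.
set EUW := energy N%:R (weight (fun x => U x + W x)) l f.
pose S x := (\sum_k field l f k x ^+ 2) * weight U x.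
have S0 x : 0 <= S x.
  by rewrite mulr_ge0 ?(ltW (weight_gt0 _ _))//; apply: sumr_ge0 => k _; exact: sqr_ge0.
have bS : buc S by apply: bucM => //; apply: buc_sum => k _; exact: buc_expr.
have pS : ms_periodic N%:R S.
  by move=> x k; rewrite /S (periodic1_nat N (weight_periodic pU)) (sqr_field_periodic l tf.2 x k).
have ES : EUW = mean N%:R (fun x => S x * weight W x).
  by congr mean; apply/funext => x; rewrite /S weightD mulrA.
pose V k y := mean 1 (fun z => (cconv N (K k) (slope M l f k) y z -
    field l (smoothing N%:R Phi f) k y) ^+ 2).
have bV k : buc (V k).
  apply: (@buc_mean _ _ _ _ (fun p => (cconv N (K k) (slope M l f k) p.1 p.2 -
    field l (smoothing N%:R Phi f) k p.1) ^+ 2)) => //.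
  apply: buc_expr; apply: bucB; first exact: (buc_cconv N (bK k) (slope_buc M l k bf)).
  exact: (@buc_fst _ _ _ (field l (smoothing N%:R Phi f) k)).
have bsS : buc (smoothing N%:R Phi S).
  apply: (@buc_mean _ _ _ _ (fun p : pt * pt => Phi p.2 * S (p.2 + p.1))) => //.
  by apply: bucM; [exact: (@buc_snd _ _ _ Phi)|exact: (buc_swap (buc_pair_add bS))].
have lam0 := lambda_min_qform_ge0 L0 bU d0.
have Z0 : 0 < Z1 by exact: mean_weight_gt0.
have c0 : 0 <= lam * Z1 by rewrite mulr_ge0// ltW.
apply: le_trans (ler_wpM2l c0 (qform_le NR0 bW l tS)) _.
have bT1 := bucM bsS bw; have bT2 k := bucM (bV k) bw.
have bSV : buc (fun y => \sum_k V k y * weight W y) by apply: buc_sum => k _.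
have bEn : buc (fun y => (\sum_k field l (smoothing N%:R Phi f) k y ^+ 2) * weight W y).
  by apply: bucM bw; apply: buc_sum => k _; exact: buc_expr.
rewrite -[leLHS](meanZ (lam * Z1) NR0 bEn).
apply: (@le_trans _ _ (mean N%:R (fun y => (1 + s) * (smoothing N%:R Phi S y * weight W y) +
    (1 + s^-1) * (expR (2 * A) * \sum_k V k y * weight W y)))).
  apply: le_mean; first exact: NR0.
  - by apply: bucM (buc_cst _) _; apply: bucM bw; apply: buc_sum => k _; exact: buc_expr.
  - by apply: bucD; apply: bucM (buc_cst _) _ => //; exact: bucM (buc_cst _) _.
  move=> y; rewrite mulrA; apply: le_trans (ler_wpM2r (ltW (weight_gt0 _ _)) (cell_lower l y tf)) _.
  rewrite mulrDl !mulrA lerD2l -mulr_suml; lra.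
rewrite meanD//; [|exact: bucM (buc_cst _) _|by apply: bucM (buc_cst _) _; exact: bucM (buc_cst _) _].
rewrite meanZ// [X in _ + X <= _]meanZ//; last exact: bucM (buc_cst _) _.
rewrite meanZ// mean_sum// [leRHS]mulrDl.
have EUW0 : 0 <= EUW.
  by apply: energy_ge0 => // [|x]; [exact: weight_buc (bucD bU bW)|exact: ltW (weight_gt0 _ _)].
apply: lerD.
  rewrite ler_wpM2l ?addr_ge0 ?(ltW s0)//; apply: le_trans (smoothing_mean_weight bS pS S0) _.
  rewrite -ES ler_wpM2r// ler_expR ler_wpM2r// ler_nat//.
rewrite -[leRHS]mulrA ler_wpM2l ?addr_ge0 ?invr_ge0 ?(ltW s0)//.
have hE : energy N%:R (weight W) l f <= expR (2 * A) * EUW.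
  rewrite ES -meanZ//; last exact: bucM.
  apply: le_mean; first exact: NR0.
  - by apply: bucM bw; apply: buc_sum => k _; exact: buc_expr.
  - by apply: bucM (buc_cst _) _; exact: bucM.
  move=> x; rewrite mulrA ler_wpM2r ?(ltW (weight_gt0 _ _))// /S mulrCA ler_peMr//.
    by apply: sumr_ge0 => k _; exact: sqr_ge0.
  by rewrite -ler_pdivrMl ?expR_gt0// mulr1 -expRN -mulNr weight_ge.
have D0 : 0 <= (2 * C ^+ 2 + 8 * d%:R) / M%:R ^+ 2.
  exact: (divr_ge0 (addr_ge0 (mulr_ge0 (ler0n _ 2) (sqr_ge0 _)) (mulr_ge0 (ler0n _ 8) (ler0n _ _)))
    (exprn_ge0 _ (ler0n _ _))).
set D := _ / M%:R ^+ 2 in D0 *.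
apply: (@le_trans _ _ (expR (2 * A) * \sum_(k < d) (D * (expR (6 * delta) * (expR (2 * A) * EUW))))).
  rewrite ler_wpM2l ?expR_ge0//; apply: ler_sum => k _; apply: le_trans (cell_variance l k tf) _.
  by rewrite ler_wpM2l// ler_wpM2l ?expR_ge0.
have e4 : expR (4 * A) = expR (2 * A) * expR (2 * A).
  by rewrite -expRD; congr expR; ring.
rewrite sumr_const card_ord -[X in _ * X <= _]mulr_natl e4 le_eqVlt.
by apply/orP; left; apply/eqP; ring.
Qed.

(** 8 delta is the 6 delta of the variance term, which dominates the 2 delta of the smoothing, plus
    2 delta for the normalization. *)
Lemma lower_step l : lam * ms_eff_qform N%:R W l <=
  expR (8 * delta + (1 + expR (4 * A) * (d%:R * (4 * C ^+ 2 + 16 * d%:R))) / M%:R) *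
  ms_eff_qform N%:R (fun x => U x + W x) l.
Proof.
have s0 : 0 < s by rewrite invr_gt0.
have s1 : s <= 1 by rewrite invf_le1// ler1n.
have Z0 : 0 < Z1 by exact: mean_weight_gt0.
have ZW0 : 0 < mean N%:R (weight W) by exact: mean_weight_gt0.
have bUW := bucD bU bW.
have lam0 := lambda_min_qform_ge0 L0 bU d0.
set C3 := 1 + _; set q := ms_eff_qform N%:R W l.
have q0 : 0 <= q by exact: qform_ge0.
have key : (1 + s) + (1 + s^-1) * (expR (4 * A) * (d%:R * ((2 * C ^+ 2 + 8 * d%:R) / M%:R ^+ 2))) <=
    expR (C3 / M%:R).
  apply: le_trans (expR_ge1Dx _).
  have -> : (1 + s^-1) * (expR (4 * A) * (d%:R * ((2 * C ^+ 2 + 8 * d%:R) / M%:R ^+ 2))) =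
    expR (4 * A) * (d%:R * (2 * C ^+ 2 + 8 * d%:R)) * ((1 + s^-1) * s ^+ 2).
    by rewrite exprVn; ring.
  have -> : (1 + s^-1) * s ^+ 2 = s + s ^+ 2 by field; rewrite gt_eqF.
  have ss : s ^+ 2 <= s by rewrite expr2 ler_piMr// ltW.
  set D := expR _ * _.
  have D0 : 0 <= D.
    exact: (mulr_ge0 (expR_ge0 _) (mulr_ge0 (ler0n _ _) (addr_ge0 (mulr_ge0 (ler0n _ 2)
      (sqr_ge0 _)) (mulr_ge0 (ler0n _ 8) (ler0n _ _))))).
  have -> : C3 / M%:R = s + 2 * D * s by rewrite /C3 /D; ring.
  by have := ler_wpM2l D0 ss; rewrite mulrDr -!mulrA; lra.
have [_ hZ] := weight_split N0 bU pU bW pW sl1.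
set ZUW := mean N%:R (weight (fun x => U x + W x)) in hZ.
have ZUW0 : 0 < ZUW by exact: mean_weight_gt0.
rewrite -ler_pdivrMl ?expR_gt0//; apply: le_qform => // f tf.
have h := lower_bound_test l tf; rewrite -/q in h.
set E := energy _ _ _ _ in h *.
have E0 : 0 <= E by apply: energy_ge0 => // [|x]; [exact: weight_buc|exact: ltW (weight_gt0 _ _)].
rewrite -/ZUW mulrCA ler_pdivrMl ?expR_gt0//.
have lq0 : 0 <= lam * q by exact: mulr_ge0.
apply: le_trans (ler_wpM2r lq0 hZ) _.
have -> : expR (2 * delta) * (Z1 * mean N%:R (weight W)) * (lam * q) =
  expR (2 * delta) * (lam * Z1 * (mean N%:R (weight W) * q)) by ring.
have E8 : 8 * delta = 2 * delta + 6 * delta by ring.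
rewrite E8 !expRD.
have -> : expR (2 * delta) * expR (6 * delta) * expR (C3 / M%:R) * E =
  expR (2 * delta) * (expR (C3 / M%:R) * (expR (6 * delta) * E)) by ring.
apply: (ler_wpM2l (expR_ge0 _)); apply: (le_trans h).
exact: (ler_wpM2r (mulr_ge0 (expR_ge0 _) E0) key).
Qed.

End LowerBound.

(** * Scaling and iteration *)

Section Scaling.
Context {R : realType} {d : nat}.
Notation pt := 'rV[R]_d.
Implicit Types (f V : pt -> R) (x l : pt) (L c : R).

Lemma buc_scale c V : buc V -> buc (fun x => V (c *: x)).
Proof.
by apply: (@buc_comp _ _ _ `|c|) => x y; rewrite -scalerBr normrZ.
Qed.

(** The competitor c h(x / c) has gradient (grad h)(x / c), so energy and normalization are
    preserved; the reverse inequality is the same one for the factor 1 / c. *)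
Lemma qform_scale_le L c V l : 0 < L -> 0 < c -> buc V ->
  ms_eff_qform (L * c) (fun x => V (c^-1 *: x)) l <= ms_eff_qform L V l.
Proof.
move=> L0 c0 bV; have bV' := buc_scale c^-1 bV; have Lc0 : 0 < L * c by exact: mulr_gt0.
have bw := weight_buc bV.
have ZE : mean (L * c) (weight (fun x => V (c^-1 *: x))) = mean L (weight V).
  by rewrite -(mean_scale L0 c0 bw).
apply: le_qform => // h th; rewrite -ZE.
pose f x := c * h (c^-1 *: x).
have sh : ms_smooth (fun x => h (c^-1 *: x)) by exact: smooth_scale th.1.
have tf : test (L * c) f.
  split; first exact: smoothZ.
  move=> x k; rewrite /f scalerDr scalerA mulrCA mulVf ?gt_eqF// mulr1.
  by rewrite th.2.
apply: le_trans (qform_le Lc0 bV' l tf) _; rewrite le_eqVlt; apply/orP; left; apply/eqP.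
have bf k := field_buc l k L0 th.
have bF : buc (fun x => (\sum_k field l h k x ^+ 2) * weight V x).
  by apply: bucM => //; apply: buc_sum => k _; exact: buc_expr.
rewrite /energy -(mean_scale L0 c0 bF); congr mean; apply/funext => x; congr (_ * _).
apply: eq_bigr => k _; rewrite /field pdZ// pd_scale; last exact: th.1.
by rewrite mulrA mulfV ?gt_eqF// mul1r.
Qed.

Lemma qform_scale L c V l : 0 < L -> 0 < c -> buc V ->
  ms_eff_qform (L * c) (fun x => V (c^-1 *: x)) l = ms_eff_qform L V l.
Proof.
move=> L0 c0 bV; apply/eqP; rewrite eq_le qform_scale_le//.
have ci0 : 0 < c^-1 by rewrite invr_gt0.
have := qform_scale_le l (mulr_gt0 L0 c0) ci0 (buc_scale c^-1 bV).
have -> : (fun x => V (c^-1 *: (c^-1^-1 *: x))) = V.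
  by apply/funext => x; rewrite scalerA invrK mulVf ?gt_eqF// scale1r.
by rewrite mulfK ?gt_eqF.
Qed.

End Scaling.

Section OneStep.
Context {R : realType} {d : nat}.
Notation pt := 'rV[R]_d.
Hypothesis d0 : (0 < d)%N.

(* The kernel width is M = floor (sqrt rho): both 1/M and the oscillation (M / rho)^alpha of W at this
   scale are then O(rho^(- alpha / 2)); bounded values of rho are handled by [crude_le] and [crude_ge]. *)
Lemma one_step (A B : R) : 0 <= A -> 0 <= B -> exists2 C : R, 0 <= C &
  forall (alpha rho : R) (N : nat) (U W : pt -> R) (l : pt),
  0 < alpha <= 1 -> 2 <= rho <= N%:R -> buc U -> ms_periodic 1 U ->
  (forall x, `|U x| <= A) -> buc W -> ms_periodic N%:R W ->
  (forall x y : pt, `|W (x + y) - W x| <= B * powR (`|y| / rho) alpha) ->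
  let e := expR (C * powR rho (- (alpha / 2))) in
  ms_lambda_min (ms_eff_diff 1 U) * ms_eff_qform N%:R W l <=
    e * ms_eff_qform N%:R (fun x => U x + W x) l /\
  ms_eff_qform N%:R (fun x => U x + W x) l <=
    e * (ms_lambda_max (ms_eff_diff 1 U) * ms_eff_qform N%:R W l).
Proof.
move=> A0 B0; have [Cb Cb0 Hb] := @bump_exists R d.
pose C2 : R := 1 + 2 * expR (4 * A) + 48 * d%:R ^+ 3 * expR (8 * A).
pose C3 : R := 1 + expR (4 * A) * (d%:R * (4 * Cb ^+ 2 + 16 * d%:R)).
have C20 : 0 <= C2.
  by rewrite !addr_ge0 ?mulr_ge0 ?expR_ge0 ?exprn_ge0 ?ler0n.
have C30 : 0 <= C3.
  by rewrite addr_ge0// mulr_ge0 ?expR_ge0// mulr_ge0// addr_ge0// mulr_ge0// sqr_ge0.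
(* With th = rho^(- alpha / 2), delta = 4 B th and 1 / M <= 2 th, the first two summands cover the
   exponents of both steps; 32 A covers exp(8 A) when th >= 1 / 4. *)
exists (32 * B + 2 * (C2 + C3) + 32 * A).
  by rewrite !addr_ge0// mulr_ge0// addr_ge0.
move=> alpha rho N U W l /andP[al0 al1] /andP[rho2 rhoN] bU pU HA bW pW HW e.
have rho0 : 0 < rho by lra.
have NR0 : 0 < N%:R :> R by lra.
pose t := Num.sqrt rho.
have t0 : 0 < t by rewrite sqrtr_gt0.
have tt : t ^+ 2 = rho by rewrite sqr_sqrtr// ltW.
have t1 : 1 <= t by rewrite -(@ler_pXn2r _ 2)// ?nnegrE ?ltW// tt expr1n; lra.
have thE : powR rho (- (alpha / 2)) = powR t (- alpha).
  by rewrite /t -powR12_sqrt ?(ltW rho0)// -powRrM; congr powR; ring.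
rewrite thE in e *; set th := powR t (- alpha) in e *.
have th_t : t^-1 <= th.
  by rewrite -powR_inv1 ?(ltW t0)// /th; apply: ler_powR => //; rewrite lerN2.
have th0 : 0 <= th by exact: powR_ge0.
have bUW := bucD bU bW.
have lmin0 := lambda_min_qform_ge0 (@ltr01 R) bU d0.
have qW0 := qform_ge0 NR0 bW l; have qUW0 := qform_ge0 NR0 bUW l.
have lmax0 := lambda_max_lower (@ltr01 R) bU d0 HA.
have lmaxp : 0 <= ms_lambda_max (ms_eff_diff 1 U) := le_trans (expR_ge0 _) lmax0.
have [r16|r16] := ltP rho 16.
  have t4 : t <= 4.
    by rewrite -(@ler_pXn2r _ 2)// ?nnegrE ?(ltW t0)// tt; lra.
  have th4 : 1 <= 4 * th.
    apply: (@le_trans _ _ (4 * t^-1)); last by rewrite ler_pM2l.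
    by rewrite ler_pdivlMr// mul1r.
  have e8 : expR (8 * A) <= e.
    rewrite /e ler_expR; have h1 := ler_wpM2l A0 th4.
    have h2 : 0 <= (32 * B + 2 * (C2 + C3)) * th.
      by rewrite mulr_ge0// addr_ge0 ?mulr_ge0// addr_ge0.
    by rewrite mulr1 in h1; rewrite mulrDl; lra.
  have e44 : expR (8 * A) = expR (4 * A) * expR (4 * A).
    by rewrite -expRD; congr expR; ring.
  have e41 : 1 <= expR (4 * A) by rewrite -expR0 ler_expR mulr_ge0.
  split.
    have lmin1 := lambda_min_le1 (@ltr01 R) bU d0.
    apply: (@le_trans _ _ (ms_eff_qform N%:R W l)); first by rewrite ler_piMl.
    apply: le_trans (crude_ge l NR0 bU bW HA) _; rewrite ler_wpM2r//.
    by apply: le_trans e8; rewrite e44 ler_peMl// expR_ge0.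
  apply: le_trans (crude_le l NR0 bU bW HA) _.
  apply: (@le_trans _ _ (expR (8 * A) * (ms_lambda_max (ms_eff_diff 1 U) * ms_eff_qform N%:R W l))).
    rewrite e44 -mulrA ler_wpM2l ?expR_ge0// mulrA ler_peMl//.
    by rewrite -ler_pdivrMl ?expR_gt0// mulr1 -expRN -mulNr.
  by rewrite ler_wpM2r// mulr_ge0.
have t4 : 4 <= t.
  by rewrite -(@ler_pXn2r _ 2)// ?nnegrE ?(ltW t0)// tt; lra.
pose M := Num.truncn t.
have /andP[Mt tM] : M%:R <= t < M.+1%:R by exact: truncn_itv (ltW t0).
have M4 : (4 <= M)%N by rewrite truncn_ge_nat// ltW.
have M0 : (0 < M)%N by apply: leq_trans M4.
have MR0 : 0 < M%:R :> R by rewrite ltr0n.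
(* The threshold t >= 4 gives 3 M <= 3 t < t^2 = rho <= N. *)
have MN : (3 * M < N)%N.
  rewrite -(ltr_nat R) natrM; apply: lt_le_trans rhoN; rewrite -tt expr2.
  by apply: (@le_lt_trans _ _ (3 * t)); [rewrite ler_pM2l|rewrite ltr_pM2r//; lra].
have Mi : M%:R^-1 <= 2 * th.
  apply: (@le_trans _ _ (2 * t^-1)); last by rewrite ler_pM2l.
  rewrite -[M%:R^-1]mul1r ler_pdivrMr// mulrAC ler_pdivlMr// mul1r.
  by move: tM; rewrite -natr1; lra.
pose delta := 4 * B * th.
have sl : slow (4 * M)%:R delta W.
  move=> x y hy; apply: le_trans (HW x y) _; rewrite /delta -mulrA mulrCA ler_wpM2l//.
  have h : `|y| / rho <= 4 * t^-1.
    rewrite ler_pdivrMr// -tt expr2 -mulrA mulKf ?gt_eqF//.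
    by apply: le_trans hy _; rewrite natrM ler_pM2l.
  apply: (@le_trans _ _ (powR (4 * t^-1) alpha)).
    by apply: ge0_ler_powR; rewrite ?nnegrE ?(ltW al0)// ?divr_ge0 ?mulr_ge0 ?invr_ge0 ?(ltW t0) ?(ltW rho0).
  rewrite powRM ?invr_ge0 ?(ltW t0)//; apply: ler_pM; rewrite ?powR_ge0//.
    by apply: ler1_powR => //; lra.
  by rewrite -powR_inv1 ?(ltW t0)// -powRrM mulN1r.
have [Phi [K [kP kK dP]]] := Hb M N M0 MN.
have hlow := lower_step M0 MN kP kK dP bW pW sl bU pU HA d0 l.
have hup := upper_step M0 MN kP kK dP bW pW sl bU pU HA d0 l.
have hA : 0 <= 32 * A * th by rewrite !mulr_ge0.
have hB : 0 <= B * th by rewrite mulr_ge0.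
have hC2 : 0 <= C2 * th by rewrite mulr_ge0.
have hC3 : 0 <= C3 * th by rewrite mulr_ge0.
split.
  apply: le_trans hlow _; rewrite ler_wpM2r// -/C3 /e ler_expR /delta.
  by have := ler_wpM2l C30 Mi; move: hA hB hC2 hC3; clear; nra.
apply: le_trans hup _; rewrite ler_wpM2r ?mulr_ge0// -/C2 /e ler_expR /delta.
by have := ler_wpM2l C20 Mi; move: hA hB hC2 hC3; clear; nra.
Qed.

End OneStep.

(** * Hoelder potentials in the sup norm *)

Section HolderPotentials.
Context {R : realType} {d : nat}.
Notation pt := 'rV[R]_d.
Implicit Types (T : pt -> R) (x y l : pt).
Variables (alpha H : R).
Hypotheses (d0 : (0 < d)%N) (alpha01 : 0 < alpha <= 1) (H0 : 0 <= H).

Let al0 : 0 < alpha. Proof. by case/andP: alpha01. Qed.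
Let al1 : alpha <= 1. Proof. by case/andP: alpha01. Qed.

Lemma enorm_le x : ms_enorm x <= d%:R * `|x|.
Proof.
rewrite -(@ler_pXn2r _ 2)// ?nnegrE ?sqrtr_ge0 ?mulr_ge0// enorm_sqr.
apply: (@le_trans _ _ (\sum_(k < d) `|x| ^+ 2)).
  apply: ler_sum => k _; rewrite -[X in X <= _]real_normK ?num_real// ler_pXn2r ?nnegrE//.
  exact: rV_coord_le.
rewrite sumr_const card_ord -[leLHS]mulr_natl exprMn ler_wpM2r ?sqr_ge0//.
by rewrite expr2 ler_peMr// ler1n.
Qed.

(** The Hoelder quotient uses the Euclidean norm and the topology of row vectors the sup norm; the
    factor d is the price of the passage, as (d t)^alpha <= d t^alpha. *)
Lemma holder_norm T x y : ms_holder_bounded alpha T -> ms_holder_semi alpha T <= H ->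
  `|T x - T y| <= H * d%:R * powR `|x - y| alpha.
Proof.
move=> bT hT; have [->|xy] := eqVneq x y.
  by rewrite subrr normr0 !mulr_ge0 ?powR_ge0.
have e0 : 0 < ms_enorm (x - y).
  by rewrite sqrtr_gt0; apply: sqn_gt0; rewrite subr_eq0.
apply: (@le_trans _ _ (H * powR (ms_enorm (x - y)) alpha)).
  rewrite -ler_pdivrMr ?powR_gt0//; apply: le_trans hT; apply: ub_le_sup => //.
  by exists x, y.
rewrite -mulrA ler_wpM2l//; apply: (@le_trans _ _ (powR (d%:R * `|x - y|) alpha)).
  by apply: ge0_ler_powR; rewrite ?nnegrE ?(ltW al0) ?(ltW e0) ?mulr_ge0// enorm_le.
by rewrite powRM// ler_wpM2r ?powR_ge0// ler1_powR// ler1n.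
Qed.

Lemma holder_bound T x : ms_holder_bounded alpha T -> ms_holder_semi alpha T <= H ->
  ms_periodic 1 T -> T 0 = 0 -> `|T x| <= H * d%:R.
Proof.
move=> bT hT pT T0; have [n Hn] := lattice_reduce x (@ltr01 R).
rewrite -(periodic_lattice x n pT) -[T _]subr0 -T0.
apply: le_trans (holder_norm _ 0 bT hT) _.
rewrite subr0 ler_piMr ?mulr_ge0//.
set z := x + _ in Hn *.
have z1 : `|z| <= 1 by apply: rV_norm_le => // j; have /andP[? ?] := Hn j; rewrite ger0_norm.
have -> : 1 = powR 1 alpha :> R by rewrite powR1.
by apply: ge0_ler_powR; rewrite ?nnegrE ?(ltW al0).
Qed.

Lemma holder_buc T : ms_holder_bounded alpha T -> ms_holder_semi alpha T <= H ->
  ms_periodic 1 T -> T 0 = 0 -> buc T.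
Proof.
move=> bT hT pT T0; split; first by exists (H * d%:R) => x; exact: holder_bound.
move=> e e0; have D0 : 0 < H * d%:R + 1 by rewrite ltr_wpDl// mulr_ge0.
have q0 : 0 < e / (H * d%:R + 1) by exact: divr_gt0.
exists (powR (e / (H * d%:R + 1)) alpha^-1); first exact: powR_gt0.
move=> x y hxy; apply: le_trans (holder_norm x y bT hT) _.
have h : powR `|x - y| alpha <= e / (H * d%:R + 1).
  set q := e / _ in q0 hxy *; have -> : q = powR (powR q alpha^-1) alpha.
    by rewrite -powRrM mulVf ?gt_eqF// powRr1// ltW.
  by apply: ge0_ler_powR; rewrite ?nnegrE ?(ltW al0) ?powR_ge0.
apply: le_trans (ler_wpM2l (mulr_ge0 H0 (ler0n _ d)) h) _.
by rewrite mulrCA ler_piMr ?(ltW e0)// ler_pdivrMr// mul1r lerDl.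
Qed.

Lemma geometric_powR_sum m :
  \sum_(j < m) powR (2^-1 ^+ j) alpha <= (1 - powR 2^-1 alpha)^-1 :> R.
Proof.
set tau := powR 2^-1 alpha; have t0 : 0 <= tau by exact: powR_ge0.
have t1 : tau < 1.
  have -> : 1 = powR 1 alpha :> R by rewrite powR1.
  by apply: gt0_ltr_powR; rewrite ?nnegrE// invf_lt1// ltr1n.
have E j : powR (2^-1 ^+ j) alpha = tau ^+ j :> R.
  elim: j => [|j IH]; first by rewrite !expr0 powR1.
  by rewrite !exprS powRM ?exprn_ge0// IH.
under eq_bigr do rewrite E.
rewrite -[leRHS]mul1r ler_pdivlMr ?subr_gt0// mulrC.
have := subrX1 tau m; rewrite -[tau - 1]opprB mulNr => h.
by have := exprn_ge0 m t0; lra.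
Qed.

End HolderPotentials.

(** * Iteration over the scales *)

Section MultiScale.
Context {R : realType} {d : nat}.
Notation pt := 'rV[R]_d.
Variables (alpha H rho : R) (U : nat -> pt -> R) (r : nat -> nat).
Hypotheses (d0 : (0 < d)%N) (alpha01 : 0 < alpha <= 1) (H0 : 0 <= H) (rho2 : 2 <= rho)
  (hr : forall k, (1 <= k)%N -> rho <= (r k)%:R) (r2 : forall k, (1 <= k)%N -> (2 <= r k)%N)
  (pU : forall k, ms_periodic 1 (U k)) (U0 : forall k, U k 0 = 0)
  (bH : forall k, ms_holder_bounded alpha (U k))
  (hH : forall k, ms_holder_semi alpha (U k) <= H).

Notation Rk := (fun k => (ms_Rscale r k)%:R : R).

Let bU k : buc (U k) := holder_buc d0 alpha01 H0 (bH k) (hH k) (pU k) (U0 k).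

Lemma Rscale0 : ms_Rscale r 0 = 1%N.
Proof. by rewrite /ms_Rscale big_geq. Qed.

Lemma RscaleS k : ms_Rscale r k.+1 = (ms_Rscale r k * r k.+1)%N.
Proof. by rewrite /ms_Rscale big_nat_recr. Qed.

Lemma Rscale_gt0 k : (0 < ms_Rscale r k)%N.
Proof.
elim: k => [|k IH]; first by rewrite Rscale0.
by rewrite RscaleS muln_gt0 IH/=; apply: ltn_trans (r2 _).
Qed.

Let Rk0 k : 0 < Rk k. Proof. by rewrite ltr0n Rscale_gt0. Qed.

Lemma Rscale_dvd p j : exists m : nat, ms_Rscale r (p + j) = (m * ms_Rscale r p)%N.
Proof.
elim: j => [|j [m E]]; first by exists 1%N; rewrite addn0 mul1n.
by exists (m * r (p + j).+1)%N; rewrite addnS RscaleS E mulnAC.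
Qed.

(** Only the ratio next to scale p is estimated by rho, the later ones by 2: this keeps one factor
    rho and leaves a summable geometric series. *)
Lemma Rscale_growth p j : rho * 2 ^+ j * Rk p <= Rk (j + p.+1)%N.
Proof.
elim: j => [|j IH].
  by rewrite expr0 mulr1 add0n RscaleS natrM mulrC ler_pM2l// hr.
rewrite addSn RscaleS natrM exprS; apply: (@le_trans _ _ (rho * 2 ^+ j * Rk p * 2)).
  by rewrite le_eqVlt; apply/orP; left; apply/eqP; ring.
apply: ler_pM => //; last by rewrite ler_nat r2.
by rewrite !mulr_ge0 ?exprn_ge0 ?ler0n// (le_trans _ rho2).
Qed.

(** The potentials coarser than scale p, in the coordinates where [U p] has period 1: the W of the
    one-scale comparison. *)
Definition tail p n (x : pt) : R := ms_Vsum U Rk p.+1 n (Rk p *: x).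

Lemma tailE p n x : tail p n x =
  \sum_(j < n - p) U (j + p.+1)%N ((Rk p / Rk (j + p.+1)%N) *: x).
Proof.
rewrite /tail /ms_Vsum -{1}[p.+1]add0n big_addn subSS big_mkord.
by apply: eq_bigr => j _; rewrite scalerA mulrC.
Qed.

Lemma tail_buc p n : buc (tail p n).
Proof.
have -> : tail p n = fun x => \sum_(j < n - p) U (j + p.+1)%N ((Rk p / Rk (j + p.+1)%N) *: x).
  by apply/funext => x; rewrite tailE.
by apply: buc_sum => j _; exact: buc_scale.
Qed.

(** In the rescaled coordinates the j-th term varies by at most H d (|y| / (rho 2^j))^alpha, and the
    sum over j is bounded uniformly in p and n. *)
Lemma tail_modulus p n (x y : pt) : `|tail p n (x + y) - tail p n x| <=
  H * d%:R / (1 - powR 2^-1 alpha) * powR (`|y| / rho) alpha.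
Proof.
have [al0 al1] := andP alpha01; have rho0 : 0 < rho := lt_le_trans (ltr0Sn R 1) rho2.
rewrite !tailE -sumrB; apply: le_trans (ler_norm_sum _ _ _) _.
have yr0 : 0 <= `|y| / rho by rewrite divr_ge0// ltW.
apply: (@le_trans _ _ (\sum_(j < n - p) H * d%:R * powR (`|y| / rho) alpha * powR (2^-1 ^+ j) alpha)).
  apply: ler_sum => j _; apply: le_trans (holder_norm d0 alpha01 H0 _ _ (bH _) (hH _)) _.
  rewrite -[leRHS]mulrA ler_wpM2l ?mulr_ge0// -powRM ?exprn_ge0//.
  apply: ge0_ler_powR; rewrite ?nnegrE ?(ltW al0)//.
    by rewrite (mulr_ge0 yr0)// exprn_ge0.
  rewrite -scalerBr addrC addKr normrZ ger0_norm ?divr_ge0 ?(ltW (Rk0 _))//.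
  rewrite -[leRHS]mulrA mulrC ler_wpM2l// exprVn -invfM ler_pdivrMr// ler_pdivlMl//; last first.
    by rewrite mulr_gt0// exprn_gt0.
  exact: Rscale_growth.
rewrite -mulr_sumr mulrAC ler_wpM2r ?powR_ge0// ler_wpM2l ?mulr_ge0//.
exact: geometric_powR_sum.
Qed.

Lemma tail_periodic p n N : ms_Rscale r n = (N * ms_Rscale r p)%N -> ms_periodic N%:R (tail p n).
Proof.
move=> EN x k; rewrite !tailE; apply: eq_bigr => j _.
have jn : (j + p.+1 <= n)%N by have := ltn_ord j; lia.
have [m Em] := Rscale_dvd (j + p.+1)%N (n - (j + p.+1)); rewrite subnKC// in Em.
rewrite scalerDr scalerA.
have -> : Rk p / Rk (j + p.+1)%N * N%:R = 1 *~ m :> R.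
  rewrite mulrAC -natrM mulnC -EN Em natrM mulfK ?gt_eqF//.
exact: periodic_int.
Qed.

Lemma Vsum_split p n : (p <= n)%N ->
  ms_Vsum U Rk p n = fun x => U p ((Rk p)^-1 *: x) + tail p n ((Rk p)^-1 *: x).
Proof.
move=> pn; apply/funext => x; rewrite /ms_Vsum big_ltn ?ltnS//; congr (_ + _).
by rewrite /tail scalerA mulfV ?gt_eqF// scale1r.
Qed.

Lemma qform_last n l : ms_eff_qform (Rk n) (ms_Vsum U Rk n n) l = ms_eff_qform 1 (U n) l.
Proof.
have -> : ms_Vsum U Rk n n = fun x => U n ((Rk n)^-1 *: x).
  by apply/funext => x; rewrite /ms_Vsum big_nat1.
by rewrite -[X in ms_eff_qform X _]mul1r; exact: (qform_scale l (@ltr01 R) (Rk0 n) (bU n)).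
Qed.

Lemma qform_peel p n l : (p <= n)%N -> exists N : nat,
  [/\ ms_Rscale r n = (N * ms_Rscale r p)%N,
    ms_eff_qform (Rk n) (ms_Vsum U Rk p n) l =
      ms_eff_qform N%:R (fun x => U p x + tail p n x) l &
    ms_eff_qform (Rk n) (ms_Vsum U Rk p.+1 n) l = ms_eff_qform N%:R (tail p n) l].
Proof.
move=> pn; have [N EN] := Rscale_dvd p (n - p); rewrite subnKC// in EN.
have NR0 : 0 < N%:R :> R.
  by rewrite ltr0n; have := Rscale_gt0 n; rewrite EN muln_gt0 => /andP[].
have E1 := qform_scale l NR0 (Rk0 p) (bucD (bU p) (tail_buc p n)).
have E2 := qform_scale l NR0 (Rk0 p) (tail_buc p n).
rewrite -natrM -EN in E1 E2; exists N; split; [exact: EN| |].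
  rewrite (Vsum_split pn); exact: E1.
have -> : ms_Vsum U Rk p.+1 n = fun x => tail p n ((Rk p)^-1 *: x).
  apply/funext => x; have E : Rk p *: ((Rk p)^-1 *: x) = x.
    by rewrite scalerA (mulfV (lt0r_neq0 (Rk0 p))) scale1r.
  by rewrite /tail E.
exact: E2.
Qed.

Notation lmin k := (ms_lambda_min (ms_eff_diff 1 (U k))).
Notation lmax k := (ms_lambda_max (ms_eff_diff 1 (U k))).

(** Induction on the number j = n - p of coarser scales. The base case is D(U_n) itself, without
    loss, which is why n + 1 potentials cost only n factors. *)
Lemma iterate_steps (C : R) n l :
  (forall N (V W : pt -> R), rho <= N%:R -> buc V -> ms_periodic 1 V ->
    (forall x, `|V x| <= H * d%:R) -> buc W -> ms_periodic N%:R W ->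
    (forall x y : pt, `|W (x + y) - W x| <=
       H * d%:R / (1 - powR 2^-1 alpha) * powR (`|y| / rho) alpha) ->
    ms_lambda_min (ms_eff_diff 1 V) * ms_eff_qform N%:R W l <=
      expR C * ms_eff_qform N%:R (fun x => V x + W x) l /\
    ms_eff_qform N%:R (fun x => V x + W x) l <=
      expR C * (ms_lambda_max (ms_eff_diff 1 V) * ms_eff_qform N%:R W l)) ->
  forall j p, (p + j = n)%N ->
  expR (- (j%:R * C)) * \prod_(p <= k < n.+1) lmin k * sqn l <=
    ms_eff_qform (Rk n) (ms_Vsum U Rk p n) l <=
  expR (j%:R * C) * \prod_(p <= k < n.+1) lmax k * sqn l.
Proof.
move=> step; have L0 := @ltr01 R; elim=> [|j IH] p pn.
  rewrite addn0 in pn; rewrite pn !big_nat1 mul0r oppr0 expR0 !mul1r qform_last.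
  by rewrite lambda_min_form// lambda_max_form.
have /IH/andP[lo hi] : (p.+1 + j = n)%N by lia.
have pn' : (p <= n)%N by lia.
have [N [EN E1 E2]] := qform_peel l pn'; rewrite E1; rewrite E2 in lo hi.
(* N = R_n / R_p is a multiple of r_(p+1), since R_(p+1) divides R_n. *)
have rN : rho <= N%:R.
  have [m Em] := Rscale_dvd p.+1 (n - p.+1).
  rewrite subnKC in Em; last by lia.
  have {}Em : N = (m * r p.+1)%N.
    apply/eqP; rewrite -(eqn_pmul2r (Rscale_gt0 p)) -EN Em RscaleS; apply/eqP; lia.
  have m0 : (0 < m)%N.
    by have := Rscale_gt0 n; rewrite EN Em; case: m {Em} => //; rewrite !mul0n.
  apply: le_trans (hr (isT : (1 <= p.+1)%N)) _; rewrite ler_nat Em.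
  by rewrite leq_pmull.
have bd x : `|U p x| <= H * d%:R by exact: holder_bound (bH p) (hH p) (pU p) (U0 p).
have [s1 s2] := step N (U p) (tail p n) rN (bU p) (pU p) bd (tail_buc p n)
  (tail_periodic EN) (tail_modulus p n).
have pn1 : (p < n.+1)%N by rewrite ltnS.
rewrite !(big_ltn pn1) -natr1 mulrDl mul1r opprD !expRD; apply/andP; split.
  have lm0 : 0 <= lmin p by exact: lambda_min_qform_ge0.
  rewrite -(ler_pM2l (expR_gt0 C)); apply: le_trans s1.
  apply: le_trans (ler_wpM2l lm0 lo).
  set P := \prod_(_ <= _ < _) _; rewrite le_eqVlt; apply/orP; left; apply/eqP.
  have E : expR C * expR (- C) = 1 by rewrite expRN mulfV// gt_eqF// expR_gt0.
  by rewrite -[RHS]mul1r -E; ring.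
have lM0 : 0 <= lmax p := le_trans (expR_ge0 _) (lambda_max_lower L0 (bU p) d0 bd).
apply: (le_trans s2); apply: le_trans (ler_wpM2l (expR_ge0 C) (ler_wpM2l lM0 hi)) _.
by set P := \prod_(_ <= _ < _) _; rewrite le_eqVlt; apply/orP; left; apply/eqP; ring.
Qed.

Lemma Vsum_buc n : buc (ms_Vsum U Rk 0 n).
Proof.
rewrite Vsum_split//; apply: bucD; first exact: buc_scale.
exact: (buc_scale (Rk 0)^-1 (tail_buc 0 n)).
Qed.

End MultiScale.

Lemma mxform_scalar {R : realType} {d : nat} (c : R) (l : 'rV[R]_d) :
  mxform c%:M l l = c * sqn l.
Proof.
rewrite /mxform mul_mx_scalar -scalemxAl mxE sqn_form mxform1; congr (_ * _).
by rewrite mxE; apply: eq_bigr => i _; rewrite mxE.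
Qed.

Theorem theorem3p1 (R : realType) (d : nat) (alpha Ka K0 : R) :
  0 < alpha <= 1 ->
  exists C : R, forall (U : nat -> 'rV[R]_d -> R) (r : nat -> nat),
    (forall k, ms_periodic (1 : R) (U k)) ->
    (forall k, U k (0 : 'rV[R]_d) = 0) ->
    (forall k, ms_holder_bounded alpha (U k)) ->
    has_ubound (range (fun k => ms_holder_semi alpha (U k))) ->
    Ka = sup (range (fun k => ms_holder_semi alpha (U k))) ->
    K0 = sup (range (fun k => ms_osc (U k))) ->
    (forall k, (1 <= k)%N -> (2 <= r k)%N) ->
    let rho_min := inf [set ((r k)%:R : R) | k in [set k | (1 <= k)%N]] : R in
    Ka <= powR rho_min alpha ->
    let eps := C * powR rho_min (- (alpha / 2)) in
    let Rk := fun k => ((ms_Rscale r k)%:R : R) in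
    forall n : nat, (1 <= n)%N ->
      ms_mx_le ((expR (- (n%:R * eps)) *
              \prod_(0 <= k < n.+1) ms_lambda_min (ms_eff_diff (1 : R) (U k)))%:M)
            (ms_eff_diff (Rk n) (ms_Vsum U Rk 0 n)) /\
      ms_mx_le (ms_eff_diff (Rk n) (ms_Vsum U Rk 0 n))
            ((expR (n%:R * eps) *
              \prod_(0 <= k < n.+1) ms_lambda_max (ms_eff_diff (1 : R) (U k)))%:M).
Proof.
move=> alpha01; have [al0 al1] := andP alpha01.
(* In dimension 0 there are no eigenvalues, but all quadratic forms vanish. *)
have [d0|] := posnP d.
  subst d; exists 0 => U r _ _ _ _ _ _ _ rho_min _ eps Rk n _.
  by split=> l; rewrite -!/(mxform _ _ _) !mxformE !big_ord0.
(* The constant is chosen before U is given, when Ka is still an arbitrary real; its absolute value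
   keeps all constants nonnegative. *)
move=> d0; pose H := `|Ka|; have H0 : 0 <= H by exact: normr_ge0.
pose A := H * d%:R; have A0 : 0 <= A by rewrite mulr_ge0.
(* The geometric series of ratio 2^(- alpha) from [tail_modulus]. *)
pose B := A / (1 - powR 2^-1 alpha).
have B0 : 0 <= B.
  have e1 : powR 1 alpha = 1 :> R by rewrite powR1.
  rewrite divr_ge0// subr_ge0 -[leRHS]e1.
  by apply: ge0_ler_powR; rewrite ?nnegrE ?(ltW al0)// invf_le1// ler1n.
have [C C0 HC] := one_step d0 A0 B0; exists C.
move=> U r pU U0 bH ubH KaE _ r2 rho_min _ eps Rk n n1.
have hH k : ms_holder_semi alpha (U k) <= H.
  apply: le_trans (ler_norm Ka); rewrite KaE; exact: ub_le_sup.
have hr k : (1 <= k)%N -> rho_min <= (r k)%:R.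
  move=> k1; apply: ge_inf; last by exists k.
  by exists 0 => _ [i _ <-].
have rho2 : 2 <= rho_min.
  apply: lb_le_inf; first by exists (r 1%N)%:R, 1%N.
  by move=> _ [k k1 <-]; rewrite ler_nat r2.
have Rk0 : 0 < Rk n by rewrite /Rk ltr0n Rscale_gt0.
have bV := Vsum_buc d0 alpha01 H0 r2 pU U0 bH hH n.
have main l := iterate_steps d0 alpha01 H0 rho2 hr r2 pU U0 bH hH (C := eps) (l := l)
  (fun N V W rN bV' pV' hV bW pW hW => HC alpha rho_min N V W l alpha01
    (introT andP (conj rho2 rN)) bV' pV' hV bW pW hW) (add0n n).
split=> l; rewrite -!/(mxform _ _ _) mxform_scalar qform_mx//; by case/andP: (main l).
Qed.
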